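(* Let $\lambda,\mu\in\mathbb{R}$ with $\mu>0$ and $\lambda+\mu>0$, and let $R>0$. The Steklov-Lamé spectrum (with multiplicity) of the disk of radius $R$ in $\mathbb{R}^2$ centered at the origin is the sorted list of the following real numbers: (i) $0$ (with multiplicity $3$), (ii) $\frac{2(\lambda+\mu)}{R}$, (iii) $\frac{4\mu(\lambda+\mu)}{(\lambda+3\mu)R}$ (counted twice), (iv) $\frac{2\mu(n-1)}{R}$ (counted twice), for $n=2,3,\dots$, (v) $\frac{2(n+1)\mu(\lambda+\mu)}{(\lambda+3\mu)R}$ (counted twice), for $n=2,3,\dots$. The eigenfunctions in each of these cases (for each $n$ separately in (iv) and (v)) are linear combinations of the following functions, written in Cartesian components as functions of the polar coordinates $(r,\theta)$: (i) $(1,0)$, $(0,1)$, $r(-\sin\theta,\cos\theta)$; (ii) $r(\cos\theta,\sin\theta)$; (iii) $\Big(2(R^2-r^2)+\frac{(\lambda+3\mu)r^2\cos(2\theta)}{\lambda+\mu},\ \frac{(\lambda+3\mu)r^2\sin(2\theta)}{\lambda+\mu}\Big)$ and $\Big(\frac{(\lambda+3\mu)r^2\sin(2\theta)}{\lambda+\mu},\ 2(R^2-r^2)-\frac{(\lambda+3\mu)r^2\cos(2\theta)}{\lambda+\mu}\Big)$; (iv) $r^{n-1}\big(\cos((n-1)\theta),-\sin((n-1)\theta)\big)$ and $r^{n-1}\big(\sin((n-1)\theta),\cos((n-1)\theta)\big)$; (v) $(f_1,f_2)$ and $(f_3,f_4)$, where $$f_1=\tfrac{r^{n-1}}{(\lambda+\mu)n}\big(-(\lambda+\mu)(n+1)(r^2-R^2)\cos((n-1)\theta)+(\lambda+3\mu)r^2\cos((n+1)\theta)\big),$$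 $$f_2=\tfrac{r^{n-1}}{(\lambda+\mu)n}\big((\lambda+\mu)(n+1)(r^2-R^2)\sin((n-1)\theta)+(\lambda+3\mu)r^2\sin((n+1)\theta)\big),$$ $$f_3=\tfrac{r^{n-1}}{(\lambda+\mu)n}\big((\lambda+\mu)(n+1)(r^2-R^2)\sin((n-1)\theta)-(\lambda+3\mu)r^2\sin((n+1)\theta)\big),$$ $$f_4=\tfrac{r^{n-1}}{(\lambda+\mu)n}\big((\lambda+\mu)(n+1)(r^2-R^2)\cos((n-1)\theta)+(\lambda+3\mu)r^2\cos((n+1)\theta)\big).$$
   Context: For a vector field $u$ on a bounded Lipschitz domain $\Omega\subset\mathbb{R}^2$ let $e(u)=\frac12(\nabla u+\nabla u^T)$, and for a $2\times2$ matrix $\xi$ let $A\xi=2\mu\xi+\lambda\,\mathrm{tr}(\xi)\,\mathrm{Id}$. $\mathbf{n}$ denotes the outer unit normal to $\partial\Omega$. The Steklov-Lamé eigenvalue problem is: find $\Lambda\in\mathbb{R}$ and a nonzero $u\in H^1(\Omega)^2$ with $-\mathrm{div}\,Ae(u)=0$ in $\Omega$ and $Ae(u)\mathbf{n}=\Lambda u$ on $\partial\Omega$, i.e. $\int_\Omega Ae(u):e(v)=\Lambda\int_{\partial\Omega}u\cdot v$ for all $v\in H^1(\Omega)^2$. The Steklov-Lamé spectrum is the sequence of eigenvalues repeated according to multiplicity. If numbers from different cases (or different $n$) coincide, their multiplicities add and the eigenspace is spanned by the union of the corresponding functions. *)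

(* Defs.v *)
From HB Require Import structures.
From mathcomp Require Import all_boot all_order all_algebra.
From mathcomp Require Import all_classical all_reals all_analysis.

Set Implicit Arguments.
Unset Strict Implicit.
Unset Printing Implicit Defensive.

Import Order.TTheory GRing.Theory Num.Theory.
Import numFieldNormedType.Exports.

Local Open Scope classical_set_scope.
Local Open Scope ring_scope.

Section Domain.
Variable R : realType.

Definition area : {measure set (measurableTypeR R * measurableTypeR R) -> \bar R} :=
  (@lebesgue_measure R \x @lebesgue_measure R)%E.

Definition disk (rad : R) : set (R * R) :=
  [set x | x.1 ^+ 2 + x.2 ^+ 2 < rad ^+ 2].

Definition circle_point (rad t : R) : R * R := (rad * cos t, rad * sin t).

(* arc-length integral over the boundary circle: ds = rad dt *)
Definition boundary_integral (rad : R) (h : R * R -> \bar R) : \bar R :=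
  (rad%:E * \int[lebesgue_measure]_(t in `[0%R, (2 * pi)%R])
    h (circle_point rad t))%E.

Definition axis (i : 'I_2) : R * R := if i == ord0 then (1, 0) else (0, 1).

Definition partial (i : 'I_2) (f : R * R -> R) : R * R -> R :=
  fun x => 'D_(axis i) f x.

Fixpoint Ck (k : nat) (f : R * R -> R) : Prop :=
  continuous f /\
  if k is k'.+1 then
    forall i, (forall x, derivable f x (axis i)) /\ Ck k' (partial i f)
  else True.

Definition smooth (f : R * R -> R) : Prop := forall k, Ck k f.

Definition test_function (rad : R) (phi : R * R -> R) : Prop :=
  smooth phi /\
  exists K : set (R * R),
    [/\ compact K, K `<=` disk rad & forall x, ~ K x -> phi x = 0].

Definition L2_disk (rad : R) (f : R * R -> R) : Prop :=
  measurable_fun (disk rad) f /\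
  (\int[area]_(x in disk rad) (f x ^+ 2)%:E < +oo)%E.

Definition L2_circle (rad : R) (f : R * R -> R) : Prop :=
  measurable_fun `[0, 2 * pi] (f \o circle_point rad) /\
  (boundary_integral rad (fun x => (f x ^+ 2)%:E) < +oo)%E.

Definition L2_disk_cvg (rad : R) (f_ : nat -> R * R -> R) (f : R * R -> R) :
    Prop :=
  (fun k => \int[area]_(x in disk rad) ((f_ k x - f x) ^+ 2)%:E)%E @ \oo
    --> 0%E.

Definition L2_circle_cvg (rad : R) (f_ : nat -> R * R -> R) (f : R * R -> R) :
    Prop :=
  (fun k => boundary_integral rad (fun x => ((f_ k x - f x) ^+ 2)%:E)) @ \oo
    --> 0%E.

Definition weak_partial (rad : R) (i : 'I_2) (f g : R * R -> R) : Prop :=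
  forall phi, test_function rad phi ->
    (\int[area]_(x in disk rad) (f x * partial i phi x)%:E =
     - \int[area]_(x in disk rad) (g x * phi x)%:E)%E.

End Domain.

Section Fields.
Variable R : realType.

(* Fields are total functions on the plane; only their values on the disk
   (up to null sets), or on the circle for traces, matter. *)
Definition vfield := R * R -> 'cV[R]_2.

Definition component (u : vfield) (i : 'I_2) : R * R -> R := fun x => u x i ord0.

Definition vec2 (a b : R) : 'cV[R]_2 := \col_i (if i == ord0 then a else b).

Definition ae_eq_disk (rad : R) (u v : vfield) : Prop :=
  {ae area R, forall x, disk rad x -> u x = v x}.

(* u lies in H^1(disk)^2 with weak gradient G, where G i j = d_j u_i *)
Definition H1 (rad : R) (u : vfield) (G : R * R -> 'M[R]_2) : Prop :=
  forall i, L2_disk rad (component u i) /\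
    forall j, L2_disk rad (fun x => G x i j) /\
              weak_partial rad j (component u i) (fun x => G x i j).

(* T is the boundary trace of the H^1 field u with weak gradient G: the L2 limit
   of the boundary restrictions of fields smooth up to the boundary that
   converge to u in H^1. By the trace theorem every H^1 field has a trace,
   unique up to null sets of the circle. *)
Definition is_trace (rad : R) (u : vfield) (G : R * R -> 'M[R]_2) (T : vfield) :
    Prop :=
  (forall i, L2_circle rad (component T i)) /\
  exists w : nat -> vfield,
    (forall k i, smooth (component (w k) i)) /\
    forall i,
      [/\ L2_disk_cvg rad (fun k => component (w k) i) (component u i),
          forall j, L2_disk_cvg rad (fun k => partial j (component (w k) i))
                                    (fun x => G x i j)
        & L2_circle_cvg rad (fun k => component (w k) i) (component T i)].

Definition lin_comb (k : nat) (c : 'I_k -> R) (f : 'I_k -> vfield) : vfield :=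
  fun x => \sum_(i < k) c i *: f i x.

Definition measurable_field (rad : R) (u : vfield) : Prop :=
  forall i, measurable_fun (disk rad) (component u i).

(* Linear span modulo equality almost everywhere on the disk. The sigma-algebra
   is the Borel one, which is not complete, so a field equal almost everywhere
   to a measurable one need not be measurable. *)
Definition lin_span (rad : R) (F : set vfield) : set vfield :=
  [set u | measurable_field rad u /\
     exists (k : nat) (c : 'I_k -> R) (f : 'I_k -> vfield),
       (forall i, F (f i)) /\ ae_eq_disk rad u (lin_comb c f)].

(* m is the dimension of E modulo equality almost everywhere on the disk *)
Definition has_dimension (rad : R) (E : set vfield) (m : nat) : Prop :=
  exists b : 'I_m -> vfield,
    [/\ forall i, E (b i),
        forall c : 'I_m -> R,
          ae_eq_disk rad (lin_comb c b) (fun=> 0) -> forall i, c i = 0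
      & forall u, E u -> exists c : 'I_m -> R, ae_eq_disk rad u (lin_comb c b)].

End Fields.

Section SteklovLame.
Variables (R : realType) (lam mu rad : R).

Definition strain (G : 'M[R]_2) : 'M[R]_2 := 2^-1 *: (G + G^T).

Definition elastic (xi : 'M[R]_2) : 'M[R]_2 :=
  (2 * mu) *: xi + (lam * \tr xi)%:M.

Definition ddot (X Y : 'M[R]_2) : R := \sum_i \sum_j X i j * Y i j.

Definition dot2 (a b : 'cV[R]_2) : R := \sum_i a i ord0 * b i ord0.

Definition lame_eigenspace (L : R) : set (vfield R) :=
  [set u | exists (G : R * R -> 'M[R]_2) (T : vfield R),
     [/\ H1 rad u G, is_trace rad u G T
       & forall v Gv Tv, H1 rad v Gv -> is_trace rad v Gv Tv ->
          (\int[area R]_(x in disk rad)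
              (ddot (elastic (strain (G x))) (strain (Gv x)))%:E =
           L%:E * boundary_integral rad (fun x => (dot2 (T x) (Tv x))%:E))%E]].

Definition is_eigenfunction (L : R) (u : vfield R) : Prop :=
  lame_eigenspace L u /\ ~ ae_eq_disk rad u (fun=> 0).

Definition is_eigenvalue (L : R) : Prop := exists u, is_eigenfunction L u.

(* s lists the eigenvalues in nondecreasing order, each value occurring as many
   times as the dimension of its eigenspace *)
Definition is_spectrum (s : nat -> R) : Prop :=
  [/\ nondecreasing_seq s,
      forall L, is_eigenvalue L <-> exists j, s j = L
    & forall L, exists2 m, has_dimension rad (lame_eigenspace L) m
                         & ([set j | s j = L] #= `I_m)%card].

End SteklovLame.

(* Where a case has two functions, the boolean is false for the first one
   and true for the second. *)
Inductive mode : Type :=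
  | TranslationX
  | TranslationY
  | Rotation
  | Dilation
  | ModeIII of bool
  | ModeIV of nat & bool
  | ModeV of nat & bool.

Definition admissible : set mode :=
  [set m | match m with
           | ModeIV n _ | ModeV n _ => (2 <= n)%N
           | _ => True
           end].

Section Modes.
Variables (R : realType) (lam mu rad : R).

Definition mode_value (m : mode) : R :=
  match m with
  | TranslationX | TranslationY | Rotation => 0
  | Dilation => 2 * (lam + mu) / rad
  | ModeIII _ => 4 * mu * (lam + mu) / ((lam + 3 * mu) * rad)
  | ModeIV n _ => 2 * mu * (n%:R - 1) / rad
  | ModeV n _ =>
      2 * (n%:R + 1) * mu * (lam + mu) / ((lam + 3 * mu) * rad)
  end.

Definition mode_polar (m : mode) (r t : R) : 'cV[R]_2 :=
  match m with
  | TranslationX => vec2 1 0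
  | TranslationY => vec2 0 1
  | Rotation => r *: vec2 (- sin t) (cos t)
  | Dilation => r *: vec2 (cos t) (sin t)
  | ModeIII false =>
      vec2 (2 * (rad ^+ 2 - r ^+ 2)
              + (lam + 3 * mu) * r ^+ 2 * cos (2 * t) / (lam + mu))
           ((lam + 3 * mu) * r ^+ 2 * sin (2 * t) / (lam + mu))
  | ModeIII true =>
      vec2 ((lam + 3 * mu) * r ^+ 2 * sin (2 * t) / (lam + mu))
           (2 * (rad ^+ 2 - r ^+ 2)
              - (lam + 3 * mu) * r ^+ 2 * cos (2 * t) / (lam + mu))
  | ModeIV n false =>
      r ^+ (n - 1) *:
        vec2 (cos ((n%:R - 1) * t)) (- sin ((n%:R - 1) * t))
  | ModeIV n true =>
      r ^+ (n - 1) *: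
        vec2 (sin ((n%:R - 1) * t)) (cos ((n%:R - 1) * t))
  | ModeV n false =>
      (r ^+ (n - 1) / ((lam + mu) * n%:R)) *:
        vec2 (- ((lam + mu) * (n%:R + 1) * (r ^+ 2 - rad ^+ 2)
                   * cos ((n%:R - 1) * t))
                + (lam + 3 * mu) * r ^+ 2 * cos ((n%:R + 1) * t))
             ((lam + mu) * (n%:R + 1) * (r ^+ 2 - rad ^+ 2)
                   * sin ((n%:R - 1) * t)
                + (lam + 3 * mu) * r ^+ 2 * sin ((n%:R + 1) * t))
  | ModeV n true =>
      (r ^+ (n - 1) / ((lam + mu) * n%:R)) *:
        vec2 ((lam + mu) * (n%:R + 1) * (r ^+ 2 - rad ^+ 2)
                   * sin ((n%:R - 1) * t)
                - (lam + 3 * mu) * r ^+ 2 * sin ((n%:R + 1) * t))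
             ((lam + mu) * (n%:R + 1) * (r ^+ 2 - rad ^+ 2)
                   * cos ((n%:R - 1) * t)
                + (lam + 3 * mu) * r ^+ 2 * cos ((n%:R + 1) * t))
  end.

Definition polar_radius (x : R * R) : R := Num.sqrt (x.1 ^+ 2 + x.2 ^+ 2).

(* unique away from the origin, where every angle of [0, 2 pi) qualifies *)
Definition polar_angle (x : R * R) : R :=
  xget 0 [set t | [/\ 0 <= t, t < 2 * pi &
                      x = circle_point (polar_radius x) t]].

Definition mode_field (m : mode) : vfield R :=
  fun x => mode_polar m (polar_radius x) (polar_angle x).

(* s is the nondecreasing rearrangement of the family of all mode values *)
Definition is_sorted_mode_list (s : nat -> R) : Prop :=
  nondecreasing_seq s /\
  exists sigma : nat -> mode,
    set_bij setT admissible sigma /\ forall j, s j = mode_value (sigma j).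

End Modes.

(* Main.v *)
(* Identify R^2 with C. Each listed mode is a polynomial field whose stress is divergence
   free and whose traction on the circle is [mode_value] times its value, so by Green's
   formula it is a weak eigenfunction; its boundary values are a nonzero multiple of
   [e^(ikt)] or [i e^(ikt)], and every [k] in Z occurs exactly once in each form.
   Conversely, let [u] be an eigenfunction for [L]. By symmetry of the energy, the trace
   of [u] is orthogonal to all modes of value different from [L]. After subtraction of a
   combination [V] of the finitely many modes of value [L], the trace of [u - V] is
   orthogonal to the whole trigonometric system, hence zero. Then the energy of [u - V]
   is zero, so [d_1 (u - V)_1 = d_2 (u - V)_2 = 0], and the Poincare inequality obtained
   by integrating [d_i (x_i f^2)] over the disk yields [u = V]. *)

Require Import Defs.
From HB Require Import structures.
From mathcomp Require Import all_boot all_order all_algebra.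
From mathcomp Require Import all_classical all_reals all_analysis.
From mathcomp Require Import measurable_realfun.
From mathcomp Require Import zify ring lra.
Set Implicit Arguments.
Unset Strict Implicit.
Unset Printing Implicit Defensive.
Import Order.TTheory GRing.Theory Num.Theory.
Import numFieldNormedType.Exports.
Local Open Scope classical_set_scope.
Local Open Scope ring_scope.

(** * Square integrable functions *)

(** Korn's inequality and regularity theory are avoided. As [lam + mu > 0], the energy bounds the
    two diagonal derivatives d_1 u_1 and d_2 u_2, its off-diagonal part being just nonnegative; and
    a Poincare inequality containing the single derivative d_i recovers u_i from its trace. General
    H^1 fields are reached only through the smooth sequences that define their traces: integral
    identities and inequalities are proved for smooth functions and passed to the limit in L2. In
    complex form the modes are transparent. With z = x_1 + i x_2, case (iv) consists of the
    conjugate of z^(n-1) and i times it. Up to a factor, the first field of case (v) is K z^(n+1) +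
    (n+1) (rad^2 - |z|^2) conj(z)^(n-1), where K = (lam+3mu)/(lam+mu): this is the
    Kolosov-Muskhelishvili solution with potential z^(n+1), and the term in rad^2 is chosen to leave
    only K z^(n+1) on the circle. Hence each mode carries one Fourier frequency. Multiplicities are
    settled by counting: being the spectrum and being the sorted list both amount to monotonicity
    plus a prescribed cardinality of every fibre. *)

Section SquareIntegrable.
Context d (T : measurableType d) (R : realType) (m : {measure set T -> \bar R}).
Variable D : set T.
Hypothesis mD : measurable D.

Definition sqint (f : T -> R) : Prop :=
  measurable_fun D f /\ (\int[m]_(x in D) (f x ^+ 2)%:E < +oo)%E.

Definition inner (f g : T -> R) : R := \int[m]_(x in D) (f x * g x).

Lemma sqint_integrable_sqr f : sqint f -> m.-integrable D (EFin \o (fun x => f x ^+ 2)).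
Proof.
move=> [mf fi]; apply/integrableP; split.
  by apply/measurable_EFinP; exact: measurable_funX.
apply: le_lt_trans fi; apply: ge0_le_integral => //=.
- by do 2 apply: measurableT_comp => //; exact: measurable_funX.
- by apply/measurable_EFinP; exact: measurable_funX.
- by move=> x _; rewrite lee_fin ger0_norm// sqr_ge0.
Qed.

(** The product is dominated by [f ^+ 2 + g ^+ 2]. *)
Lemma sqint_integrable_mul f g : sqint f -> sqint g ->
  m.-integrable D (EFin \o (fun x => f x * g x)).
Proof.
move=> hf hg; have := integrableD mD (sqint_integrable_sqr hf) (sqint_integrable_sqr hg).
apply: le_integrable => //.
  by apply/measurable_EFinP; apply: measurable_funM; [case: hf|case: hg].
move=> x _ /=; rewrite lee_fin [leRHS]ger0_norm ?addr_ge0 ?sqr_ge0//.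
rewrite ler_norml; apply/andP; split; nra.
Qed.

Lemma sqint_integral_mulE f g : sqint f -> sqint g ->
  (\int[m]_(x in D) (f x * g x)%:E)%E = (inner f g)%:E.
Proof.
move=> hf hg; rewrite /inner /Rintegral fineK//.
exact: (integrable_fin_num mD (sqint_integrable_mul hf hg)).
Qed.

Lemma sqint_integral_sqrE f : sqint f ->
  (\int[m]_(x in D) (f x ^+ 2)%:E)%E = (inner f f)%:E.
Proof. by move=> hf; rewrite -sqint_integral_mulE. Qed.

Lemma sqintZ c f : sqint f -> sqint (fun x => c * f x).
Proof.
move=> hf; split; first by apply: measurable_funM => //; case: hf.
under eq_integral do rewrite exprMn EFinM.
have := integrable_fin_num mD (integrableZl mD (c ^+ 2) (sqint_integrable_sqr hf)).
by rewrite fin_numElt => /andP[].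
Qed.

Lemma sqintD f g : sqint f -> sqint g -> sqint (fun x => f x + g x).
Proof.
move=> hf hg; split; first by apply: measurable_funD; [case: hf|case: hg].
have i1 := integrableZl mD 2 (integrableD mD (sqint_integrable_sqr hf) (sqint_integrable_sqr hg)).
have := integrable_fin_num mD i1.
rewrite fin_numElt => /andP[_]; apply: le_lt_trans.
apply: ge0_le_integral => //=.
- by move=> x _; rewrite lee_fin sqr_ge0.
- by apply/measurable_EFinP; apply: measurable_funX; apply: measurable_funD; [case: hf|case: hg].
- by have := measurable_int _ i1.
- move=> x _; rewrite -EFinD -EFinM lee_fin -subr_ge0.
  have -> : 2 * (f x ^+ 2 + g x ^+ 2) - (f x + g x) ^+ 2 = (f x - g x) ^+ 2 by ring.
  exact: sqr_ge0.
Qed.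

Lemma sqintB f g : sqint f -> sqint g -> sqint (fun x => f x - g x).
Proof.
move=> hf hg; have -> : (fun x => f x - g x) = (fun x => f x + (-1) * g x).
  by apply/funext => x; rewrite mulN1r.
by apply: sqintD => //; exact: sqintZ.
Qed.

Lemma sqint0 : sqint (fun=> 0).
Proof.
split; first exact: measurable_cst.
by rewrite integral0_eq// => x _; rewrite expr0n.
Qed.

Lemma sqint_sum n (f : 'I_n -> T -> R) : (forall i, sqint (f i)) ->
  sqint (fun x => \sum_(i < n) f i x).
Proof.
elim: n f => [|n IH] f hf.
  by rewrite (_ : (fun x => _) = fun=> 0); [exact: sqint0|apply/funext => x; rewrite big_ord0].
rewrite (_ : (fun x => _) = (fun x => \sum_(i < n) f (widen_ord (leqnSn n) i) x + f ord_max x)).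
  by apply: sqintD => //; exact: IH.
by apply/funext => x; rewrite big_ord_recr.
Qed.

Lemma innerC f g : inner f g = inner g f.
Proof. by apply: eq_Rintegral => x _; rewrite mulrC. Qed.

Lemma innerZl c f g : sqint f -> sqint g -> inner (fun x => c * f x) g = c * inner f g.
Proof.
move=> hf hg; rewrite /inner -RintegralZl//; last exact: sqint_integrable_mul.
by apply: eq_Rintegral => x _; rewrite mulrA.
Qed.

Lemma innerDl f1 f2 g : sqint f1 -> sqint f2 -> sqint g ->
  inner (fun x => f1 x + f2 x) g = inner f1 g + inner f2 g.
Proof.
move=> hf1 hf2 hg; rewrite /inner -RintegralD//; try exact: sqint_integrable_mul.
by apply: eq_Rintegral => x _; rewrite mulrDl.
Qed.

Lemma innerBl f1 f2 g : sqint f1 -> sqint f2 -> sqint g ->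
  inner (fun x => f1 x - f2 x) g = inner f1 g - inner f2 g.
Proof.
move=> hf1 hf2 hg; rewrite /inner -RintegralB//; try exact: sqint_integrable_mul.
by apply: eq_Rintegral => x _; rewrite mulrBl.
Qed.

Lemma inner_sum n (f : 'I_n -> T -> R) g : (forall i, sqint (f i)) -> sqint g ->
  inner (fun x => \sum_(i < n) f i x) g = \sum_(i < n) inner (f i) g.
Proof.
move=> + hg; elim: n f => [|n IH] f hf.
  rewrite big_ord0 /inner (@eq_Rintegral _ _ _ _ _ (fun=> 0)) ?Rintegral_cst ?mul0r//.
  by move=> x _; rewrite big_ord0 mul0r.
rewrite big_ord_recr/= -IH// -innerDl//; last exact: sqint_sum.
by apply: eq_Rintegral => x _; rewrite big_ord_recr.
Qed.

Lemma inner_ge0 f : 0 <= inner f f.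
Proof. by apply: Rintegral_ge0 => x _; rewrite -expr2 sqr_ge0. Qed.

Lemma inner_ae f f' g : sqint f -> sqint f' -> sqint g ->
  ae_eq m D f f' -> inner f g = inner f' g.
Proof.
move=> hf hf' hg e; apply/EFin_inj; rewrite -!sqint_integral_mulE//.
apply: ae_eq_integral => //.
- by have := measurable_int _ (sqint_integrable_mul hf hg).
- by have := measurable_int _ (sqint_integrable_mul hf' hg).
- by apply: filterS e => x /[apply] ->.
Qed.

Lemma inner_eq0_ae f : sqint f -> inner f f = 0 -> ae_eq m D f (cst 0).
Proof.
move=> hf f0; have [mf _] := hf.
have : (\int[m]_(x in D) `|(f x * f x)%:E|)%E = 0.
  rewrite -[RHS]/(0%:E) -f0 -sqint_integral_mulE//; apply: eq_integral => x _.
  by rewrite /= ger0_norm// -expr2 sqr_ge0.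
move/ae_eq_integral_abs => /(_ mD).
case; first by apply/measurable_EFinP; exact: measurable_funM.
move=> N [mN N0 sN]; exists N; split => //; apply: subset_trans sN => x /=.
apply: contra_not => + Dx => /(_ Dx) [] /eqP.
by rewrite mulf_eq0 orbb => /eqP.
Qed.

(** Young's inequality with a free weight does the work of Cauchy-Schwarz; it holds pointwise, and
    the constants are not sharp. *)
Lemma inner_le_AMGM f g e : sqint f -> sqint g -> 0 < e ->
  `|inner f g| <= e * inner g g + e^-1 * inner f f.
Proof.
move=> hf hg e0; have hfg := sqint_integrable_mul hf hg.
apply: le_trans (le_normr_Rintegral mD hfg) _.
have hff := integrableZl mD e^-1 (sqint_integrable_mul hf hf).
have hgg := integrableZl mD e (sqint_integrable_mul hg hg).
rewrite /inner -!RintegralZl//; try exact: sqint_integrable_mul.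
rewrite -RintegralD//; apply: le_Rintegral => //.
- exact: integrable_norm.
- exact: (integrableD mD hgg hff).
- move=> x _; rewrite -(@ler_pM2l _ e)// mulrDr [e * (e^-1 * _)]mulrA divff ?gt_eqF// mul1r.
  rewrite -[X in X * `|_|]gtr0_norm// -normrM ler_norml; apply/andP; split; nra.
Qed.

Lemma inner_eq0l f g : sqint f -> sqint g -> inner f f = 0 -> inner f g = 0.
Proof.
move=> hf hg /(inner_eq0_ae hf) f0.
rewrite (inner_ae _ sqint0)// /inner (@eq_Rintegral _ _ _ _ _ (fun=> 0)) ?Rintegral_cst ?mul0r//.
by move=> x _; rewrite mul0r.
Qed.

(** Pointwise, the difference of the two sides is the square of [2 * g x - f x]. It transfers bounds
    between a function and its approximations. *)
Lemma inner_le_split (f g : T -> R) : sqint f -> sqint g ->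
  inner f f <= 2 * inner (fun x => g x - f x) (fun x => g x - f x) + 2 * inner g g.
Proof.
move=> hf hg; have hB := sqintB hg hf.
rewrite /inner -!RintegralZl//; try exact: sqint_integrable_mul.
have i1 := integrableZl mD 2 (sqint_integrable_mul hB hB).
have i2 := integrableZl mD 2 (sqint_integrable_mul hg hg).
rewrite -RintegralD//; apply: le_Rintegral => //; first exact: sqint_integrable_mul.
  exact: (integrableD mD i1 i2).
move=> x _; rewrite -subr_ge0 (_ : _ - _ = (2 * g x - f x) ^+ 2) ?sqr_ge0//; ring.
Qed.

Lemma inner_subC (f g : T -> R) :
  inner (fun x => f x - g x) (fun x => f x - g x) =
  inner (fun x => g x - f x) (fun x => g x - f x).
Proof. by apply: eq_Rintegral => x _; ring. Qed.

Lemma inner_sqrD (f g : T -> R) : sqint f -> sqint g ->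
  inner (fun x => f x + g x) (fun x => f x + g x) =
  inner f f + 2 * inner f g + inner g g.
Proof.
move=> hf hg; have hfg := sqintD hf hg.
rewrite innerDl// (innerC f (fun x => f x + g x)) (innerC g (fun x => f x + g x)).
by rewrite !innerDl// (innerC g f); ring.
Qed.

Lemma inner_sqrB (f g : T -> R) : sqint f -> sqint g ->
  inner (fun x => f x - g x) (fun x => f x - g x) =
  inner f f - 2 * inner f g + inner g g.
Proof.
move=> hf hg; have hfg := sqintB hf hg.
rewrite innerBl// (innerC f (fun x => f x - g x)) (innerC g (fun x => f x - g x)).
by rewrite !innerBl// (innerC g f); ring.
Qed.

Lemma cvg_inner_sub (f_ : nat -> T -> R) f : (forall k, sqint (f_ k)) -> sqint f ->
  (fun k => \int[m]_(x in D) ((f_ k x - f x) ^+ 2)%:E)%E @ \oo --> 0%E ->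
  (fun k => inner (fun x => f_ k x - f x) (fun x => f_ k x - f x)) @ \oo --> (0 : R).
Proof.
move=> hf_ hf.
have hB k : sqint (fun x => f_ k x - f x) by exact: sqintB.
by under eq_fun do rewrite sqint_integral_sqrE//; move/fine_cvg.
Qed.

(** Strong L2 convergence implies weak convergence. This carries Green's formula from smooth fields
    to H^1 fields. *)
Lemma cvg_inner f_ f g : (forall k, sqint (f_ k)) -> sqint f -> sqint g ->
  (fun k => \int[m]_(x in D) ((f_ k x - f x) ^+ 2)%:E)%E @ \oo --> 0%E ->
  (fun k => inner (f_ k) g) @ \oo --> inner f g.
Proof.
move=> hf_ hf hg h.
have hB k : sqint (fun x => f_ k x - f x) by exact: sqintB.
have {}h := cvg_inner_sub hf_ hf h.
apply/cvgrPdist_le => e e0.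
pose c := e / (2 * (inner g g + 1)).
have gg := inner_ge0 g.
have c0 : 0 < c by rewrite divr_gt0// mulr_gt0// ltr_wpDl.
have : \forall k \near \oo, `|0 - inner (fun x => f_ k x - f x)
  (fun x => f_ k x - f x)| <= c * e / 2.
  have c1 : 0 < c * e / 2 by rewrite divr_gt0// mulr_gt0.
  by move/cvgrPdist_le : h => /(_ _ c1).
apply: filterS => k; rewrite sub0r normrN ger0_norm ?inner_ge0// => hk.
rewrite -normrN opprB -innerBl//.
apply: le_trans (inner_le_AMGM _ _ c0) _ => //.
have -> : e = e / 2 + e / 2 by lra.
apply: lerD.
  have g1 : 0 < inner g g + 1 by rewrite ltr_wpDl.
  rewrite /c mulrAC ler_pdivrMr ?mulr_gt0//.
  by rewrite mulrA divfK ?lt0r_neq0// mulrDr mulr1 lerDl ltW.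
by rewrite ler_pdivrMl// mulrA.
Qed.

End SquareIntegrable.

(** * Smooth functions on the plane and the disk *)

Section PlaneMeasure.
Variable R : realType.
Implicit Types (f g : R * R -> R).

Lemma continuous_fst : continuous (fun x : R * R => x.1).
Proof. by move=> x; exact: cvg_fst. Qed.

Lemma continuous_snd : continuous (fun x : R * R => x.2).
Proof. by move=> x; exact: cvg_snd. Qed.

Lemma continuous_add f g : continuous f -> continuous g -> continuous (fun x => f x + g x).
Proof. by move=> cf cg x; apply: (@cvgD _ R^o); [exact: cf|exact: cg]. Qed.

Lemma continuous_mul f g : continuous f -> continuous g -> continuous (fun x => f x * g x).
Proof. by move=> cf cg x; apply: cvgM; [exact: cf|exact: cg]. Qed.

(** The plane carries the product sigma-algebra, so an open set is written as the union of the
    countably many boxes with rational centre and radius that it contains. *)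
Lemma open_measurable_plane (U : set (R * R)) : open U -> measurable U.
Proof.
move=> oU.
pose box (q : rat * rat * rat) : set (R * R) :=
  ball (ratr q.1.1 : R) (ratr q.2 : R) `*` ball (ratr q.1.2 : R) (ratr q.2 : R).
pose F q := if `[< box q `<=` U >] then box q else set0.
have -> : U = \bigcup_q F q.
  apply/seteqP; split => [x Ux|x [q _]]; last first.
    by rewrite /F; case: asboolP => // qU; exact: qU.
  move: (oU); rewrite openE => /(_ x Ux); rewrite /interior /= -nbhs_ballE => -[e /= e0 xeU].
  (* A radius below [e / 2] and a centre within that radius of [x] place the box inside the ball of
     radius [e]. *)
  have [r] : exists r : rat, ratr r \in `]0, (e / 2)[ by apply: rat_in_itvoo; rewrite divr_gt0.
  rewrite in_itv/= => /andP[r0 re].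
  have [a] : exists a : rat, ratr a \in `](x.1 - ratr r), (x.1 + ratr r)[.
    by apply: rat_in_itvoo; lra.
  have [b] : exists b : rat, ratr b \in `](x.2 - ratr r), (x.2 + ratr r)[.
    by apply: rat_in_itvoo; lra.
  rewrite !in_itv/= => /andP[b1 b2] /andP[a1 a2].
  exists (a, b, r) => //; rewrite /F; case: asboolP => [_|].
    by split => /=; rewrite /ball/= ltr_norml; apply/andP; split; lra.
  case=> y [/=]; rewrite /ball/= !ltr_norml => /andP[? ?] /andP[? ?]; apply: xeU.
  by split; rewrite /ball/= ltr_norml; apply/andP; split; lra.
apply: countable_bigcupT_measurable; first exact: countableP.
move=> q; rewrite /F; case: asboolP => // _.
by apply: measurableX; apply: open_measurable; exact: ball_open.
Qed.

Lemma continuous_measurable_plane f (D : set (R * R)) : continuous f -> measurable_fun D f.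
Proof.
move=> cf; apply: (@measurable_funS _ _ _ _ setT) => //.
apply: (measurability (@RGenOpens.G R)); first exact: RGenOpens.measurableE.
move=> _ [_ [a [b ->] <-]]; rewrite setTI; apply: open_measurable_plane.
by apply: open_comp => //; move=> + _; exact: cf.
Qed.

Variable rad : R.
Hypothesis rad0 : 0 < rad.

Lemma sqr_normE (x : R) : `|x| ^+ 2 = x ^+ 2.
Proof. by rewrite real_normK// num_real. Qed.

Lemma disk_bound (x : R * R) : x.1 ^+ 2 + x.2 ^+ 2 <= rad ^+ 2 -> `|x.1| <= rad /\ `|x.2| <= rad.
Proof.
move=> xr; split; rewrite -(@ler_pXn2r _ 2)// ?nnegrE// ?(ltW rad0)// sqr_normE.
  by apply: le_trans xr; rewrite lerDl sqr_ge0.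
by apply: le_trans xr; rewrite lerDr sqr_ge0.
Qed.

Lemma continuous_disk_quad : continuous (fun x : R * R => x.1 ^+ 2 + x.2 ^+ 2).
Proof.
have -> : (fun x : R * R => x.1 ^+ 2 + x.2 ^+ 2) = (fun x => x.1 * x.1 + x.2 * x.2).
  by apply/funext => x; rewrite !expr2.
have c1 := continuous_fst; have c2 := continuous_snd.
exact: (continuous_add (continuous_mul c1 c1) (continuous_mul c2 c2)).
Qed.

Lemma open_disk : open (disk rad).
Proof.
rewrite (_ : disk rad = (fun x => x.1 ^+ 2 + x.2 ^+ 2) @^-1` [set y | y < rad ^+ 2])//.
apply: open_comp; last exact: open_lt.
by move=> x _; exact: continuous_disk_quad.
Qed.

Lemma measurable_disk : measurable (disk rad).
Proof. by apply: open_measurable_plane; exact: open_disk. Qed.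

Lemma measurable_area_disk :
  measurable (disk rad : set (measurableTypeR R * measurableTypeR R)).
Proof. exact: measurable_disk. Qed.

(** A compact set of finite area around the disk: continuous functions are bounded on it, hence
    integrable over the open disk. *)
Definition square : set (R * R) := `[- rad, rad] `*` `[- rad, rad].

Lemma disk_sub_square : disk rad `<=` square.
Proof.
move=> x /ltW /disk_bound[h1 h2]; rewrite /square /= !in_itv/=.
by rewrite !ler_norml in h1 h2.
Qed.

Lemma area_square_fin : (area R square < +oo)%E.
Proof.
have -> : area R square = (lebesgue_measure `[(- rad)%R, rad] * lebesgue_measure `[(- rad)%R,
  rad])%E.
  exact: product_measure1E.
rewrite lebesgue_measure_itv/=.
by case: ifP => _; rewrite ?mul0e ?mule0// -EFinM ltry.
Qed.

Lemma continuous_bounded_square f : continuous f ->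
  exists M, forall x, square x -> `|f x| <= M.
Proof.
move=> cf.
have : compact (f @` square).
  apply: continuous_compact; first by apply: continuous_subspaceT.
  by apply: compact_setX; exact: segment_compact.
move=> /compact_bounded[M [_ hM]]; exists (M + 1) => x xD.
by apply: (hM (M + 1)); [rewrite ltrDl|exists x].
Qed.

Lemma continuous_integrable_square f : continuous f ->
  (area R).-integrable square (EFin \o f).
Proof.
move=> cf; apply: measurable_bounded_integrable.
- exact: measurableX.
- exact: area_square_fin.
- exact: continuous_measurable_plane.
- have [M hM] := continuous_bounded_square cf.
  exists M; split; first exact: num_real.
  by move=> y My x xD; apply: le_trans (hM _ xD) (ltW My).
Qed.

Lemma continuous_integrable_disk f : continuous f ->
  (area R).-integrable (disk rad) (EFin \o f).
Proof.
move=> cf; apply: integrableS (continuous_integrable_square cf).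
- exact: measurableX.
- exact: measurable_disk.
- exact: disk_sub_square.
Qed.

End PlaneMeasure.

(** * Stability of smoothness and rules for partial derivatives *)

Section SmoothFunctions.
Variable R : realType.
Implicit Types (f g : R * R -> R) (i : 'I_2) (x : R * R).

Lemma CkS k f : Ck k.+1 f -> Ck k f.
Proof.
elim: k f => [|k IH] f [cf hf]; first by split.
by split => // i; have [df cdf] := hf i; split => //; exact: IH.
Qed.

Lemma smooth_continuous f : smooth f -> continuous f.
Proof. by move=> /(_ 0%N) []. Qed.

Lemma smooth_derivable f : smooth f -> forall i x, derivable f x (axis R i).
Proof. by move=> /(_ 1%N) [_ h] i; have [] := h i. Qed.

Lemma smooth_partial f : smooth f -> forall i, smooth (partial i f).
Proof. by move=> sf i k; have [_ /(_ i) []] := sf k.+1. Qed.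

Lemma partial_cst c i : partial i (fun=> c : R) = fun=> 0.
Proof. by apply/funext => x; rewrite /partial derive_cst. Qed.

Lemma Ck_cst k (c : R) : Ck k (fun=> c).
Proof.
elim: k c => [|k IH] c; first by split => // x; exact: cvg_cst.
split; first by move=> x; exact: cvg_cst.
by move=> i; split => [x|]; [exact: derivable_cst|rewrite partial_cst].
Qed.

Lemma is_derive_line f x v l :
  (forall h : R, f (h *: v + x) = f x + h * l) -> is_derive x v f l.
Proof.
move=> hf.
have hc : h^-1 *: ((f \o shift x) (h *: v) - f x) @[h --> 0^'] --> l.
  apply: cvg_trans (@cvg_cst _ l _ (0^') _); apply: near_eq_cvg; near=> h.
  by rewrite /= hf addrAC subrr add0r /GRing.scale/= mulKf//; near: h; exact: nbhs_dnbhs_neq.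
by apply: DeriveDef; [apply/cvg_ex; exists l|rewrite /derive; exact/cvg_lim].
Unshelve. all: by end_near. Qed.

Lemma is_derive_coord1 x v : is_derive x v (fun y : R * R => y.1) v.1.
Proof. by apply: is_derive_line => h /=; rewrite addrC. Qed.

Lemma is_derive_coord2 x v : is_derive x v (fun y : R * R => y.2) v.2.
Proof. by apply: is_derive_line => h /=; rewrite addrC. Qed.

Lemma partial_coord1 i : partial i (fun y : R * R => y.1) = fun=> (i == ord0)%:R.
Proof.
apply/funext => x; rewrite /partial; have [_ ->] := is_derive_coord1 x (axis R i).
by rewrite /axis; case: eqP.
Qed.

Lemma partial_coord2 i : partial i (fun y : R * R => y.2) = fun=> (i != ord0)%:R.
Proof.
apply/funext => x; rewrite /partial; have [_ ->] := is_derive_coord2 x (axis R i).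
by rewrite /axis; case: eqP.
Qed.

Lemma smooth_cst (c : R) : smooth (fun=> c). Proof. by move=> k; exact: Ck_cst. Qed.

Lemma smooth_coord1 : smooth (fun y : R * R => y.1).
Proof.
case=> [|k]; split => //; try exact: continuous_fst.
by move=> i; split => [x|]; [have [] := is_derive_coord1 x (axis R i)|rewrite partial_coord1;
  exact: Ck_cst].
Qed.

Lemma smooth_coord2 : smooth (fun y : R * R => y.2).
Proof.
case=> [|k]; split => //; try exact: continuous_snd.
by move=> i; split => [x|]; [have [] := is_derive_coord2 x (axis R i)|rewrite partial_coord2;
  exact: Ck_cst].
Qed.

Lemma partial_add f g i : (forall x, derivable f x (axis R i)) ->
  (forall x, derivable g x (axis R i)) ->
  partial i (fun x => f x + g x) = fun x => partial i f x + partial i g x.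
Proof. by move=> df dg; apply/funext => x; rewrite /partial deriveD. Qed.

Lemma partial_mul f g i : (forall x, derivable f x (axis R i)) ->
  (forall x, derivable g x (axis R i)) ->
  partial i (fun x => f x * g x) = fun x => partial i f x * g x + f x * partial i g x.
Proof.
move=> df dg; apply/funext => x; rewrite /partial deriveM//.
by rewrite addrC /GRing.scale/= [g x * _]mulrC.
Qed.

Lemma Ck_add k f g : Ck k f -> Ck k g -> Ck k (fun x => f x + g x).
Proof.
elim: k f g => [|k IH] f g [cf hf] [cg hg]; split => //; try exact: continuous_add.
move=> i; have [df cdf] := hf i; have [dg cdg] := hg i; split.
  by move=> x; exact: derivableD.
by rewrite partial_add//; exact: IH.
Qed.

Lemma Ck_mul k f g : Ck k f -> Ck k g -> Ck k (fun x => f x * g x).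
Proof.
elim: k f g => [|k IH] f g hf hg.
  by split => //; apply: continuous_mul; [case: hf|case: hg].
have [cf {}hf'] := hf; have [cg hg'] := hg.
split; first exact: continuous_mul.
move=> i; have [df cdf] := hf' i; have [dg cdg] := hg' i; split.
  by move=> x; exact: derivableM.
by rewrite partial_mul//; apply: Ck_add; apply: IH => //; exact: CkS.
Qed.

Lemma smooth_add f g : smooth f -> smooth g -> smooth (fun x => f x + g x).
Proof. by move=> sf sg k; exact: Ck_add. Qed.

Lemma smooth_mul f g : smooth f -> smooth g -> smooth (fun x => f x * g x).
Proof. by move=> sf sg k; exact: Ck_mul. Qed.

Lemma smooth_scale (c : R) f : smooth f -> smooth (fun x => c * f x).
Proof. by move=> sf; apply: smooth_mul => //; exact: smooth_cst. Qed.

Lemma smooth_opp f : smooth f -> smooth (fun x => - f x).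
Proof.
move=> sf; have -> : (fun x => - f x) = (fun x => (-1) * f x).
  by apply/funext => x; rewrite mulN1r.
exact: smooth_scale.
Qed.

Lemma smooth_sub f g : smooth f -> smooth g -> smooth (fun x => f x - g x).
Proof. by move=> sf sg; apply: smooth_add => //; exact: smooth_opp. Qed.

Lemma partial_scale (c : R) f i : smooth f ->
  partial i (fun x => c * f x) = fun x => c * partial i f x.
Proof.
move=> sf; rewrite partial_mul//; last exact: smooth_derivable.
by rewrite partial_cst; apply/funext => x; rewrite mul0r add0r.
Qed.

Lemma partial_opp f i : smooth f ->
  partial i (fun x => - f x) = fun x => - partial i f x.
Proof.
move=> sf; have -> : (fun x => - f x) = (fun x => (-1) * f x).
  by apply/funext => x; rewrite mulN1r.
by rewrite partial_scale//; apply/funext => x; rewrite mulN1r.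
Qed.

Lemma is_derive_section1 f (y t : R) : (forall x, derivable f x (axis R ord0)) ->
  is_derive t (1 : R) (fun s => f (s, y)) (partial ord0 f (t, y)).
Proof.
move=> df.
have e : (fun h : R => h^-1 *: (((fun s => f (s, y)) \o shift t) (h *: (1:R)) - f (t, y))) =
         (fun h : R => h^-1 *: ((f \o shift (t, y)) (h *: axis R ord0) - f (t, y))).
  apply/funext => h; rewrite /axis/=; congr (_ *: (f _ - _)).
  by congr pair; rewrite /= scaler0 add0r.
by apply: DeriveDef; [rewrite /derivable e; exact: df|rewrite /derive e].
Qed.

Lemma is_derive_section2 f (y t : R) : (forall x, derivable f x (axis R ord_max)) ->
  is_derive t (1 : R) (fun s => f (y, s)) (partial ord_max f (y, t)).
Proof.
move=> df.
have e : (fun h : R => h^-1 *: (((fun s => f (y, s)) \o shift t) (h *: (1:R)) - f (y, t))) =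
         (fun h : R => h^-1 *: ((f \o shift (y, t)) (h *: axis R ord_max) - f (y, t))).
  apply/funext => h; rewrite /axis/=; congr (_ *: (f _ - _)).
  by congr pair; rewrite /= scaler0 add0r.
by apply: DeriveDef; [rewrite /derivable e; exact: df|rewrite /derive e].
Qed.

End SmoothFunctions.

(** * The divergence theorem on the disk *)

Section OneVariable.
Variable R : realType.
Implicit Types (f F G : R -> R) (a b c : R).
Local Notation leb := (@lebesgue_measure R).

Lemma continuous_integrable_itv f a b : continuous f ->
  leb.-integrable `[a, b] (EFin \o f).
Proof.
by move=> cf; apply: continuous_compact_integrable;
  [exact: segment_compact|exact: continuous_subspaceT].
Qed.

Lemma integral_is_derive f F a b : a <= b -> continuous f ->
  (forall x, a <= x <= b -> is_derive x (1 : R) F (f x)) ->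
  \int[leb]_(x in `[a, b]) f x = F b - F a.
Proof.
rewrite le_eqVlt => /predU1P[<-|ab] cf dF.
  by rewrite set_itv1 /Rintegral integral_set1 subrr.
have cF x : a <= x <= b -> {for x, continuous F}.
  by move=> /dF [dFx _]; apply: differentiable_continuous; exact/derivable1_diffP.
rewrite /Rintegral (@continuous_FTC2 _ _ F)//.
- exact: continuous_subspaceT.
- split.
  + by move=> x; rewrite in_itv/= => /andP[ax xb];
      have [] : is_derive x (1:R) F (f x) by apply: dF; rewrite !ltW.
  + by apply: cvg_at_right_filter; apply: cF; rewrite lexx ltW.
  + by apply: cvg_at_left_filter; apply: cF; rewrite lexx ltW.
- move=> x; rewrite in_itv/= => /andP[ax xb]; rewrite derive1E.
  by have [_ ->] : is_derive x (1:R) F (f x) by apply: dF; rewrite !ltW.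
Qed.

(** The integral starts at [a], so differentiability is available only strictly to the right;
    applications place [a] one unit to the left of the range in play. *)
Lemma exists_antiderivative f a : continuous f ->
  exists F, forall x, a < x -> is_derive x (1 : R) F (f x).
Proof.
move=> cf; exists (fun x => \int[leb]_(t in `[a, x]) f t) => x ax.
have [] := @continuous_FTC1 R f (BLeft a) x (x + 1) _ _ _ (cf x).
- by rewrite ltrDl.
- exact: continuous_integrable_itv.
- by rewrite lte_fin.
- by move=> dF e; apply: (DeriveDef dF); rewrite -derive1E; exact: e.
Qed.

(** Slices of the open disk are open intervals, whereas the fundamental theorem of calculus is used
    on closed ones. *)
Lemma integral_itv_oo f a b : continuous f ->
  (\int[leb]_(x in `]a, b[) (f x)%:E = \int[leb]_(x in `[a, b]) (f x)%:E)%E.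
Proof.
move=> cf; rewrite (@integral_itv_bndoo _ a b _ true false)//.
by apply/measurable_EFinP; apply: measurable_funTS; exact: continuous_measurable_fun.
Qed.

Lemma integral_itv_split f a b c : a <= b -> b <= c -> continuous f ->
  \int[leb]_(x in `[a, c]) f x = \int[leb]_(x in `[a, b]) f x + \int[leb]_(x in `[b, c]) f x.
Proof.
move=> ab bc cf.
have [F dF] := @exists_antiderivative f (a - 1) cf.
have dF' x : a <= x -> is_derive x (1 : R) F (f x) by move=> ax; apply: dF; lra.
have E x y : a <= x -> x <= y -> \int[leb]_(x in `[x, y]) f x = F y - F x.
  move=> ax xy; apply: integral_is_derive => // z /andP[xz _].
  by apply: dF'; exact: le_trans xz.
rewrite !E ?(le_trans ab bc)//; ring.
Qed.

End OneVariable.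

(** * Integration over the disk by chords *)

Section Divergence.
Variable R : realType.
Variable rad : R.
Hypothesis rad0 : 0 < rad.
Local Notation leb := (@lebesgue_measure R).
Implicit Types (f : R * R -> R).

(* Half the length of the slice of the disk at height [y]. Since [Num.sqrt] vanishes on
   negative numbers, the slice and Fubini identities below hold for every real [y]. *)
Definition chord (y : R) : R := Num.sqrt (rad ^+ 2 - y ^+ 2).

Lemma chord_ge0 y : 0 <= chord y. Proof. exact: sqrtr_ge0. Qed.

Lemma continuous_chord : continuous chord.
Proof.
have h : continuous (fun y : R => rad ^+ 2 - y ^+ 2).
  by move=> y; apply: cvgB; [exact: cvg_cst|rewrite expr2; apply: cvgM; exact: cvg_id].
by move=> y; apply: continuous_cvg; [exact: sqrt_continuous|exact: h].
Qed.

Lemma chord_slice y : [set x | x ^+ 2 + y ^+ 2 < rad ^+ 2] = `]- chord y, chord y[%classic.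
Proof.
apply/seteqP; split => x /=; rewrite in_itv/= -ltr_norml.
  move=> xy; rewrite /chord -sqrtr_sqr ltr_sqrt; first by rewrite ltrBrDr.
  by rewrite subr_gt0; apply: le_lt_trans xy; rewrite lerDr sqr_ge0.
move=> xs; have s0 : 0 < rad ^+ 2 - y ^+ 2.
  by rewrite -sqrtr_gt0; apply: le_lt_trans xs.
rewrite -ltrBrDr -[X in _ < X]sqr_sqrtr ?ltW// -[X in X < _]sqr_normE.
by rewrite ltr_pXn2r// nnegrE ?chord_ge0.
Qed.

Lemma continuous_pairl f (s : R -> R) : continuous f -> continuous s ->
  continuous (fun t => f (s t, t)).
Proof.
move=> cf cs t; have h : (s u, u) @[u --> t] --> (s t, t).
  by apply: (@cvg_pair _ _ _ (nbhs t) (nbhs (s t)) (nbhs t) _ _ _ s id); [exact: cs|exact: cvg_id].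
by apply: (@continuous_cvg _ _ _ _ _ (fun u => (s u, u)) f (s t, t)); [exact: cf|exact: h].
Qed.

Lemma continuous_pairr f (s : R -> R) : continuous f -> continuous s ->
  continuous (fun t => f (t, s t)).
Proof.
move=> cf cs t; have h : (u, s u) @[u --> t] --> (t, s t).
  by apply: (@cvg_pair _ _ _ (nbhs t) (nbhs t) (nbhs (s t)) _ _ _ id s); [exact: cvg_id|exact: cs].
by apply: (@continuous_cvg _ _ _ _ _ (fun u => (u, s u)) f (t, s t)); [exact: cf|exact: h].
Qed.

Lemma chord_eq0 y : y \notin `[- rad, rad] -> chord y = 0.
Proof.
rewrite in_itv/= -ler_norml -ltNge => yr; apply: ler0_sqrtr.
by rewrite subr_le0 -[leRHS]sqr_normE ler_pXn2r ?nnegrE ?(ltW rad0)// ltW.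
Qed.

(** Fubini for [f] extended by zero to the plane: each slice of the extension lives on an open
    chord, which may be closed at no cost. *)
Lemma integral_disk_dxdy f : continuous f ->
  (\int[area R]_(x in disk rad) (f x)%:E =
   \int[leb]_y \int[leb]_(x in `[(- chord y)%R, chord y]) (f (x, y))%:E)%E.
Proof.
move=> cf; rewrite integral_mkcond.
have hi := continuous_integrable_disk rad0 cf.
rewrite /area -integral21_prod_meas1; last first.
  exact: (proj1 (integrable_mkcond _ (measurable_area_disk rad)) hi).
apply: eq_integral => y _; rewrite /fubini_G -integral_itv_oo; last first.
  by apply: continuous_pairr => // t; exact: cvg_cst.
rewrite [RHS]integral_mkcond; apply: eq_integral => x _.
by rewrite /patch -chord_slice.
Qed.

Lemma integral_disk_dydx f : continuous f ->
  (\int[area R]_(x in disk rad) (f x)%:E =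
   \int[leb]_x \int[leb]_(y in `[(- chord x)%R, chord x]) (f (x, y))%:E)%E.
Proof.
move=> cf; rewrite integral_mkcond.
have hi := continuous_integrable_disk rad0 cf.
rewrite /area -integral12_prod_meas1; last first.
  exact: (proj1 (integrable_mkcond _ (measurable_area_disk rad)) hi).
apply: eq_integral => x _; rewrite /fubini_F -integral_itv_oo; last first.
  by apply: continuous_pairl => // t; exact: cvg_cst.
rewrite [RHS]integral_mkcond; apply: eq_integral => y _.
rewrite /patch -chord_slice; congr (if _ then _ else _).
by apply/idP/idP; rewrite !inE /disk /= addrC.
Qed.

(** Meant for differences of values at the two ends of a chord; these cancel outside [[- rad, rad]],
    where [chord] is 0. *)
Lemma integral_diff_chord (F : R -> R) : (forall y, y \notin `[- rad, rad] -> F y = 0) ->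
  (\int[leb]_y (F y)%:E = \int[leb]_(y in `[(- rad)%R, rad]) (F y)%:E)%E.
Proof.
move=> F0; rewrite [RHS]integral_mkcond; apply: eq_integral => y _.
rewrite /patch; case: ifPn => // yr; rewrite F0//.
by apply: contra yr => yr; rewrite inE.
Qed.

Lemma integral_partial1 f : smooth f ->
  \int[area R]_(x in disk rad) partial ord0 f x =
  \int[leb]_(y in `[- rad, rad]) (f (chord y, y) - f (- chord y, y)).
Proof.
move=> sf; rewrite /Rintegral integral_disk_dxdy; last exact/smooth_continuous/smooth_partial.
rewrite -integral_diff_chord; last by move=> y yr; rewrite chord_eq0// oppr0 subrr.
congr fine; apply: eq_integral => y _.
have cp : continuous (fun x => partial ord0 f (x, y)).
  by apply: continuous_pairr; [exact/smooth_continuous/smooth_partial|move=> t; exact: cvg_cst].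
have <- : \int[leb]_(x in `[- chord y, chord y]) partial ord0 f (x, y) =
  f (chord y, y) - f (- chord y, y).
  apply: (@integral_is_derive _ _ (fun x => f (x, y))) => //.
    by have := chord_ge0 y; lra.
  by move=> x _; apply: is_derive_section1; exact: smooth_derivable.
by rewrite /Rintegral fineK//; apply: integrable_fin_num => //; exact: continuous_integrable_itv.
Qed.

Lemma integral_partial2 f : smooth f ->
  \int[area R]_(x in disk rad) partial ord_max f x =
  \int[leb]_(x in `[- rad, rad]) (f (x, chord x) - f (x, - chord x)).
Proof.
move=> sf; rewrite /Rintegral integral_disk_dydx; last exact/smooth_continuous/smooth_partial.
rewrite -integral_diff_chord; last by move=> y yr; rewrite chord_eq0// oppr0 subrr.
congr fine; apply: eq_integral => x _.
have cp : continuous (fun y => partial ord_max f (x, y)).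
  by apply: continuous_pairl; [exact/smooth_continuous/smooth_partial|move=> t; exact: cvg_cst].
have <- : \int[leb]_(y in `[- chord x, chord x]) partial ord_max f (x, y) =
  f (x, chord x) - f (x, - chord x).
  apply: (@integral_is_derive _ _ (fun y => f (x, y))) => //.
    by have := chord_ge0 x; lra.
  by move=> y _; apply: is_derive_section2; exact: smooth_derivable.
by rewrite /Rintegral fineK//; apply: integrable_fin_num => //; exact: continuous_integrable_itv.
Qed.

End Divergence.

(** * From chord endpoints to the angular parametrization of the circle *)

Section CircleIntegral.
Variable R : realType.
Variable rad : R.
Hypothesis rad0 : 0 < rad.
Local Notation leb := (@lebesgue_measure R).
Implicit Types (f : R * R -> R).

Lemma chord_sin t : chord rad (rad * sin t) = rad * `|cos t|.
Proof.
rewrite /chord (_ : _ - _ = (rad * cos t) ^+ 2).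
  by rewrite sqrtr_sqr normrM gtr0_norm.
by rewrite !exprMn -{1}[rad ^+ 2]mulr1 -(cos2Dsin2 t); ring.
Qed.

Lemma chord_cos t : chord rad (rad * cos t) = rad * `|sin t|.
Proof.
rewrite /chord (_ : _ - _ = (rad * sin t) ^+ 2).
  by rewrite sqrtr_sqr normrM gtr0_norm.
by rewrite !exprMn -{1}[rad ^+ 2]mulr1 -(cos2Dsin2 t); ring.
Qed.

Lemma cos_le0_middle (t : R) : pi / 2 <= t <= 3 / 2 * pi -> cos t <= 0.
Proof.
move=> /andP[t1 t2]; have -> : t = (t - pi) + pi by ring.
by rewrite cosDpi oppr_le0; apply: cos_ge0_pihalf; apply/andP; split; lra.
Qed.

Lemma cos_ge0_last (t : R) : 3 / 2 * pi <= t <= 2 * pi -> 0 <= cos t.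
Proof.
move=> /andP[t1 t2]; have -> : cos t = cos (t - pi *+ 2) by rewrite -[RHS]cosD2pi subrK.
have p0 := @pi_gt0 R.
by apply: cos_ge0_pihalf; rewrite -mulr_natl; apply/andP; split; lra.
Qed.

Lemma sin_le0_last (t : R) : pi <= t <= 2 * pi -> sin t <= 0.
Proof.
move=> /andP[t1 t2]; have -> : t = (t - pi) + pi by ring.
by rewrite sinDpi oppr_le0; apply: sin_ge0_pi; apply/andP; split; lra.
Qed.

(* Passing through an antiderivative [H] avoids any monotonicity assumption on [phi]. *)
Lemma integral_subst (G H phi dphi : R -> R) (a c d : R) : c <= d ->
  continuous G -> (forall x : R, a < x -> is_derive x (1 : R) H (G x)) ->
  (forall t : R, is_derive t (1 : R) phi (dphi t)) -> continuous dphi ->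
  (forall t : R, a < phi t) ->
  \int[leb]_(t in `[c, d]) (G (phi t) * dphi t) = H (phi d) - H (phi c).
Proof.
move=> cd cG dH dp cdp hp.
have cp : continuous phi.
  by move=> t; have [h _] := dp t; apply: differentiable_continuous; exact/derivable1_diffP.
apply: (@integral_is_derive _ _ (H \o phi)) => //.
  move=> t; apply: cvgM; last exact: cdp.
  by apply: continuous_cvg; [exact: cG|exact: cp].
move=> t _; apply: is_derive1_comp; exact: dH.
Qed.

Lemma sin_cos_bound (t : R) : - rad - 1 < rad * sin t /\ - rad - 1 < rad * cos t.
Proof.
have h1 := sin_geN1 t; have h2 := cos_geN1 t.
have e1 : - rad <= rad * sin t by rewrite -mulrN1 ler_pM2l.
have e2 : - rad <= rad * cos t by rewrite -mulrN1 ler_pM2l.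
by split; lra.
Qed.

Lemma continuous_circle f : continuous f -> continuous (fun t => f (circle_point rad t)).
Proof.
move=> cf t; have h : (rad * cos u, rad * sin u) @[u --> t] --> (rad * cos t, rad * sin t).
  apply: (@cvg_pair _ _ _ (nbhs t) (nbhs (rad * cos t)) (nbhs (rad * sin t))
    _ _ _ (fun u => rad * cos u) (fun u => rad * sin u)).
    by apply: cvgM; [exact: cvg_cst|exact: continuous_cos].
  by apply: cvgM; [exact: cvg_cst|exact: continuous_sin].
by apply: (@continuous_cvg _ _ _ _ _ (fun u => (rad * cos u, rad * sin u)) f
  (rad * cos t, rad * sin t)); [exact: cf|exact: h].
Qed.

Lemma is_derive_scale_sin (t : R) : is_derive t (1 : R) (fun t => rad * sin t) (rad * cos t).
Proof. exact: (@is_deriveZ _ _ _ sin rad t 1 _ (is_derive_sin t)). Qed.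

Lemma is_derive_scale_cos (t : R) : is_derive t (1 : R) (fun t => rad * cos t) (rad * - sin t).
Proof. exact: (@is_deriveZ _ _ _ cos rad t 1 _ (is_derive_cos t)). Qed.

Lemma eq_Rintegral_itv (f g : R -> R) (a b : R) :
  (forall t, a <= t <= b -> f t = g t) ->
  \int[leb]_(t in `[a, b]) f t = \int[leb]_(t in `[a, b]) g t.
Proof. by move=> fg; apply: eq_Rintegral => t; rewrite inE/= in_itv/=; exact: fg. Qed.

Lemma integral_scale (h : R -> R) (a b c : R) : continuous h ->
  c * \int[leb]_(t in `[a, b]) h t = \int[leb]_(t in `[a, b]) (c * h t).
Proof. by move=> ch; rewrite RintegralZl//; exact: continuous_integrable_itv. Qed.

(** On the circle put [y = rad * sin t]; then the abscissa is [chord rad y] or its opposite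
    according to the sign of [cos t]. The circle is cut where this sign changes, [y] is substituted
    on each arc, and the values of the antiderivatives recombine. *)
Lemma divergence1 f : smooth f ->
  \int[area R]_(x in disk rad) partial ord0 f x =
  rad * \int[leb]_(t in `[0, 2 * pi]) (f (circle_point rad t) * cos t).
Proof.
move=> sf; have cf := smooth_continuous sf.
have p0 := @pi_gt0 R.
rewrite integral_partial1//.
(* The function on the right and on the left half circle, in terms of the height. *)
pose Gp y := f (chord rad y, y); pose Gn y := f (- chord rad y, y).
have cGp : continuous Gp by apply: continuous_pairl => //; exact: continuous_chord.
have cGn : continuous Gn.
  by apply: continuous_pairl => // y; apply: cvgN; exact: continuous_chord.
have [Hp dHp] := exists_antiderivative (- rad - 1) cGp.
have [Hn dHn] := exists_antiderivative (- rad - 1) cGn.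
have cc : continuous (fun t : R => rad * cos t).
  by move=> t; apply: cvgM; [exact: cvg_cst|exact: continuous_cos].
have ch : continuous (fun t => rad * (f (circle_point rad t) * cos t)).
  move=> t; apply: cvgM; first exact: cvg_cst.
  by apply: cvgM; [exact: (continuous_circle cf)|exact: continuous_cos].
have sb t := (sin_cos_bound t).1.
rewrite integral_scale; last first.
  by move=> t; apply: cvgM; [exact: (continuous_circle cf)|exact: continuous_cos].
rewrite (@integral_itv_split _ _ 0 (pi / 2))//; [|lra|lra].
rewrite (@integral_itv_split _ _ (pi / 2) (3 / 2 * pi))//; [|lra|lra].
have -> : \int[leb]_(t in `[0, pi / 2]) (rad * (f (circle_point rad t) * cos t)) =
          Hp rad - Hp 0.
  rewrite (@eq_Rintegral_itv _ (fun t => Gp (rad * sin t) * (rad * cos t))).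
    rewrite (integral_subst _ cGp dHp is_derive_scale_sin cc sb)//.
      by rewrite sin_pihalf sin0 mulr0 mulr1.
    by lra.
  move=> t /andP[t1 t2]; rewrite /Gp chord_sin ger0_norm; first by rewrite mulrCA.
  by apply: cos_ge0_pihalf; apply/andP; split; lra.
have -> : \int[leb]_(t in `[(pi / 2), (3 / 2 * pi)]) (rad * (f (circle_point rad t) * cos t)) =
          Hn (- rad) - Hn rad.
  rewrite (@eq_Rintegral_itv _ (fun t => Gn (rad * sin t) * (rad * cos t))).
    rewrite (integral_subst _ cGn dHn is_derive_scale_sin cc sb)//.
      rewrite sin_pihalf mulr1 (_ : 3 / 2 * pi = pi / 2 + pi); last by field.
      by rewrite sinDpi sin_pihalf mulrN1.
    by lra.
  move=> t /cos_le0_middle t1; rewrite /Gn chord_sin ler0_norm//.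
  by rewrite mulrN opprK mulrCA.
have -> : \int[leb]_(t in `[(3 / 2 * pi), (2 * pi)]) (rad * (f (circle_point rad t) * cos t)) =
          Hp 0 - Hp (- rad).
  rewrite (@eq_Rintegral_itv _ (fun t => Gp (rad * sin t) * (rad * cos t))).
    rewrite (integral_subst _ cGp dHp is_derive_scale_sin cc sb)//.
      rewrite (_ : 3 / 2 * pi = pi / 2 + pi); last by field.
      by rewrite sinDpi sin_pihalf mulrN1 -[2 * pi]/(2%:R * pi) mulr_natl sin2pi mulr0.
    by lra.
  by move=> t /cos_ge0_last t1; rewrite /Gp chord_sin ger0_norm// mulrCA.
have -> : \int[leb]_(y in `[- rad, rad]) (f (chord rad y, y) - f (- chord rad y, y)) =
          (Hp rad - Hn rad) - (Hp (- rad) - Hn (- rad)).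
  apply: (@integral_is_derive _ _ (fun y => Hp y - Hn y)).
  - by rewrite (le_trans _ (ltW rad0))// oppr_le0 ltW.
  - by move=> y; apply: cvgB; [exact: cGp|exact: cGn].
  - by move=> y /andP[y1 y2]; apply: is_deriveB; [apply: dHp|apply: dHn]; lra.
ring.
Qed.

(** The substitution is now [x = rad * cos t] on the upper and lower half circles, so the single cut
    at [pi] suffices. *)
Lemma divergence2 f : smooth f ->
  \int[area R]_(x in disk rad) partial ord_max f x =
  rad * \int[leb]_(t in `[0, 2 * pi]) (f (circle_point rad t) * sin t).
Proof.
move=> sf; have cf := smooth_continuous sf.
have p0 := @pi_gt0 R.
rewrite integral_partial2//.
pose Gp y := f (y, chord rad y); pose Gn y := f (y, - chord rad y).
have cGp : continuous Gp by apply: continuous_pairr => //; exact: continuous_chord.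
have cGn : continuous Gn.
  by apply: continuous_pairr => // y; apply: cvgN; exact: continuous_chord.
have [Hp dHp] := exists_antiderivative (- rad - 1) cGp.
have [Hn dHn] := exists_antiderivative (- rad - 1) cGn.
have cc : continuous (fun t : R => rad * - sin t).
  by move=> t; apply: cvgM; [exact: cvg_cst|apply: cvgN; exact: continuous_sin].
have ch0 : continuous (fun t => f (circle_point rad t) * sin t).
  by move=> t; apply: cvgM; [exact: (continuous_circle cf)|exact: continuous_sin].
have ch : continuous (fun t => - rad * (f (circle_point rad t) * sin t)).
  by move=> t; apply: cvgM; [exact: cvg_cst|exact: ch0].
have sb t := (sin_cos_bound t).2.
(* Both sides are negated because the derivative of [rad * cos t] is [rad * - sin t]. *)
apply: oppr_inj; rewrite -[RHS]mulNr integral_scale//.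
rewrite (@integral_itv_split _ _ 0 pi)//; [|lra|lra].
have -> : \int[leb]_(t in `[0, pi]) (- rad * (f (circle_point rad t) * sin t)) =
          Hp (- rad) - Hp rad.
  rewrite (@eq_Rintegral_itv _ (fun t => Gp (rad * cos t) * (rad * - sin t))).
    rewrite (integral_subst _ cGp dHp is_derive_scale_cos cc sb)//.
      by rewrite cospi cos0 mulrN1 mulr1.
    by lra.
  move=> t /sin_ge0_pi t1; rewrite /Gp chord_cos ger0_norm// /circle_point; ring.
have -> : \int[leb]_(t in `[pi, (2 * pi)]) (- rad * (f (circle_point rad t) * sin t)) =
          Hn rad - Hn (- rad).
  rewrite (@eq_Rintegral_itv _ (fun t => Gn (rad * cos t) * (rad * - sin t))).
    rewrite (integral_subst _ cGn dHn is_derive_scale_cos cc sb)//.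
      by rewrite cospi mulrN1 -[2 * pi]/(2%:R * pi) mulr_natl cos2pi mulr1.
    by lra.
  move=> t /sin_le0_last t1; rewrite /Gn chord_cos ler0_norm// /circle_point mulrN opprK; ring.
have -> : \int[leb]_(y in `[- rad, rad]) (f (y, chord rad y) - f (y, - chord rad y)) =
          (Hp rad - Hn rad) - (Hp (- rad) - Hn (- rad)).
  apply: (@integral_is_derive _ _ (fun y => Hp y - Hn y)).
  - by rewrite (le_trans _ (ltW rad0))// oppr_le0 ltW.
  - by move=> y; apply: cvgB; [exact: cGp|exact: cGn].
  - by move=> y /andP[y1 y2]; apply: is_deriveB; [apply: dHp|apply: dHn]; lra.
ring.
Qed.

End CircleIntegral.

(** * Trigonometric series on the circle *)

Section CircleOrthogonality.
Variable R : realType.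
Local Notation leb := (@lebesgue_measure R).
Implicit Types (k l : int) (t : R).

Lemma cos_sin_2pi_nat (n : nat) : cos (n%:R * (2 * pi)) = 1 :> R /\ sin (n%:R * (2 * pi)) = 0 :> R.
Proof.
elim: n => [|n [c s]]; first by rewrite mul0r cos0 sin0.
rewrite -natr1 mulrDl mul1r cosD sinD c s.
by rewrite !mul0r subr0 add0r !mul1r -[2 * pi]/(2%:R * pi) mulr_natl cos2pi sin2pi.
Qed.

Lemma cos_sin_2pi_int k : cos (k%:~R * (2 * pi)) = 1 :> R /\ sin (k%:~R * (2 * pi)) = 0 :> R.
Proof.
case: (intP k) => [|n|n]; first by rewrite mul0r cos0 sin0.
  exact: cos_sin_2pi_nat.
rewrite intrN mulNr cosN sinN; have [-> ->] := cos_sin_2pi_nat n.+1.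
by rewrite oppr0.
Qed.

Lemma is_derive_sink (c t : R) : is_derive t (1 : R) (fun t => sin (c * t)) (cos (c * t) * c).
Proof.
apply: (@is_derive1_comp _ sin (fun t => c * t)).
have := @is_deriveZ _ _ _ (@id R) c t 1 _ (is_derive_id t 1).
by rewrite /GRing.scale/= mulr1.
Qed.

Lemma is_derive_cosk (c t : R) : is_derive t (1 : R) (fun t => cos (c * t)) (- sin (c * t) * c).
Proof.
apply: (@is_derive1_comp _ cos (fun t => c * t)).
have := @is_deriveZ _ _ _ (@id R) c t 1 _ (is_derive_id t 1).
by rewrite /GRing.scale/= mulr1.
Qed.

Lemma continuous_cosk (c : R) : continuous (fun t : R => cos (c * t)).
Proof.
move=> t; have [h _] := is_derive_cosk c t.
by apply: differentiable_continuous; exact/derivable1_diffP.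
Qed.

Lemma continuous_sink (c : R) : continuous (fun t : R => sin (c * t)).
Proof.
move=> t; have [h _] := is_derive_sink c t.
by apply: differentiable_continuous; exact/derivable1_diffP.
Qed.

Lemma integral_cosk k : k != 0 -> \int[leb]_(t in `[0, 2 * pi]) cos (k%:~R * t) = 0.
Proof.
move=> k0; have kR : k%:~R != 0 :> R by rewrite intr_eq0.
have h : k%:~R * \int[leb]_(t in `[0, 2 * pi]) cos (k%:~R * t) = 0.
  rewrite -RintegralZl//; last by apply: continuous_integrable_itv; exact: continuous_cosk.
  have -> : \int[leb]_(t in `[0, 2 * pi]) (k%:~R * cos (k%:~R * t)) =
            sin (k%:~R * (2 * pi)) - sin (k%:~R * 0).
    apply: (@integral_is_derive _ _ (fun t => sin (k%:~R * t))).
    - by rewrite mulr_ge0 ?pi_ge0.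
    - by move=> t; apply: cvgM; [exact: cvg_cst|exact: continuous_cosk].
    - by move=> t _; rewrite mulrC; exact: is_derive_sink.
  by have [_ ->] := cos_sin_2pi_int k; rewrite mulr0 sin0 subrr.
by move/eqP : h; rewrite mulf_eq0 (negbTE kR) => /eqP.
Qed.

Lemma integral_sink k : \int[leb]_(t in `[0, 2 * pi]) sin (k%:~R * t) = 0.
Proof.
have [->|k0] := eqVneq k 0.
  under eq_Rintegral do rewrite mul0r sin0.
  by rewrite Rintegral_cst ?mul0r.
have kR : - k%:~R != 0 :> R by rewrite oppr_eq0 intr_eq0.
have h : - k%:~R * \int[leb]_(t in `[0, 2 * pi]) sin (k%:~R * t) = 0.
  rewrite -RintegralZl//; last by apply: continuous_integrable_itv; exact: continuous_sink.
  have -> : \int[leb]_(t in `[0, 2 * pi]) (- k%:~R * sin (k%:~R * t)) =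
            cos (k%:~R * (2 * pi)) - cos (k%:~R * 0).
    apply: (@integral_is_derive _ _ (fun t => cos (k%:~R * t))).
    - by rewrite mulr_ge0 ?pi_ge0.
    - by move=> t; apply: cvgM; [exact: cvg_cst|exact: continuous_sink].
    - by move=> t _; rewrite mulNr mulrC -mulNr; exact: is_derive_cosk.
  by have [-> _] := cos_sin_2pi_int k; rewrite mulr0 cos0 subrr.
by move/eqP : h; rewrite mulf_eq0 (negbTE kR) => /eqP.
Qed.

(* [e^(ikt)] and [i e^(ikt)], with R^2 identified with C *)
Definition profile k (b : bool) t : R * R :=
  if b then (- sin (k%:~R * t), cos (k%:~R * t))
  else (cos (k%:~R * t), sin (k%:~R * t)).

Definition pdot (x y : R * R) : R := x.1 * y.1 + x.2 * y.2.

Lemma continuous_profile k b :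
  continuous (fun t => (profile k b t).1) /\ continuous (fun t => (profile k b t).2).
Proof.
by case: b; split => /=; try exact: continuous_cosk; try exact: continuous_sink;
  move=> t; apply: cvgN; exact: continuous_sink.
Qed.

Lemma pdot_profile_diag k b t : pdot (profile k b t) (profile k b t) = 1.
Proof. by rewrite -(cos2Dsin2 (k%:~R * t)) /pdot; case: b => /=; ring. Qed.

(** [pdot] is the real part of x times the conjugate of y. For equal phases this gives the cosine of
    [(k - l) t], where [k] and [l] differ; for different phases the additional factor i gives a
    sine, whose integral vanishes even when [k = l]. *)
Lemma integral_pdot_profile k l b c : (k, b) != (l, c) ->
  \int[leb]_(t in `[0, 2 * pi]) pdot (profile k b t) (profile l c t) = 0.
Proof.
move=> kl.
have eC t : cos ((k - l)%:~R * t) =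
  cos (k%:~R * t) * cos (l%:~R * t) + sin (k%:~R * t) * sin (l%:~R * t).
  by rewrite intrB mulrBl cosB.
have eS t : sin ((k - l)%:~R * t) =
  sin (k%:~R * t) * cos (l%:~R * t) - cos (k%:~R * t) * sin (l%:~R * t).
  by rewrite intrB mulrBl sinB.
have [bc|bc] := eqVneq b c.
  have kl0 : k - l != 0 by apply: contra kl; rewrite subr_eq0 bc => /eqP ->.
  apply: etrans (integral_cosk kl0).
  by apply: eq_Rintegral => t _; rewrite -bc eC /pdot; case: (b) => /=; ring.
have -> : c = ~~ b by move: bc; case: (b); case: (c).
case: (b) => /=.
  apply: etrans (integral_sink (l - k)); apply: eq_Rintegral => t _.
  by rewrite -opprB intrN mulNr sinN eS /pdot/=; ring.
by apply: etrans (integral_sink (k - l)); apply: eq_Rintegral => t _; rewrite eS /pdot/=; ring.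
Qed.

End CircleOrthogonality.

(** * Polynomials approximating a step function *)

Section KuhnSequence.
Variable R : realType.
Implicit Types (x y : R) (m n : nat).

Lemma bernoulli_ineq y m : -1 <= y -> 1 + m%:R * y <= (1 + y) ^+ m.
Proof.
move=> y1; elim: m => [|m IH]; first by rewrite mul0r addr0.
rewrite exprS; apply: (@le_trans _ _ ((1 + y) * (1 + m%:R * y))).
  rewrite -subr_ge0 (_ : _ - _ = m%:R * y ^+ 2); first by rewrite mulr_ge0// sqr_ge0.
  by rewrite -natr1; ring.
by apply: ler_wpM2l => //; lra.
Qed.

(* These polynomials tend boundedly to the indicator of [x < 1 / 2] on [0, 1], except
   at [1 / 2] (H. Kuhn's proof of the Weierstrass theorem). *)
Definition kuhn n x : R := (1 - x ^+ n) ^+ (2 ^ n).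

Lemma kuhn_bounds n x : 0 <= x <= 1 -> 0 <= kuhn n x <= 1.
Proof.
move=> /andP[x0 x1]; have y0 : 0 <= x ^+ n by exact: exprn_ge0.
have y1 : x ^+ n <= 1 by exact: exprn_ile1.
by rewrite /kuhn exprn_ge0 ?subr_ge0//= exprn_ile1 ?subr_ge0// gerBl.
Qed.

(** Bernoulli's inequality gives the lower bound [1 - (2 * x) ^+ n], which tends to 1. *)
Lemma cvg_kuhn1 x : 0 <= x -> x < 1 / 2 -> (fun n => kuhn n x) @ \oo --> (1 : R).
Proof.
move=> x0 x2.
have h : (fun n => 1 - (2 * x) ^+ n) @ \oo --> (1 : R).
  rewrite -[X in _ --> X]subr0; apply: cvgB; first exact: cvg_cst.
  by apply: cvg_expr; rewrite ger0_norm; lra.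
apply: (@squeeze_cvgr _ _ _ _ (fun n => 1 - (2 * x) ^+ n) (fun=> 1));
  [near=> n|exact: h|exact: cvg_cst].
have x01 : 0 <= x <= 1 by apply/andP; split; lra.
have /andP[_ ->] := kuhn_bounds n x01; rewrite andbT.
have /andP[x0' x1'] := x01.
have := @bernoulli_ineq (- x ^+ n) (2 ^ n); rewrite mulrN natrX -exprMn; apply.
by rewrite lerN2 exprn_ile1.
Unshelve. all: by end_near. Qed.

(** The product of [kuhn n x] and [(1 + x ^+ n) ^+ (2 ^ n)] is a power of [1 - x ^+ n ^+ 2], hence
    at most 1, while by Bernoulli the second factor is at least [(2 * x) ^+ n]. *)
Lemma cvg_kuhn0 x : 1 / 2 < x -> x <= 1 -> (fun n => kuhn n x) @ \oo --> (0 : R).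
Proof.
move=> x2 x1.
have x0 : 0 < 2 * x by lra.
have h : (fun n => ((2 * x)^-1) ^+ n) @ \oo --> (0 : R).
  apply: cvg_expr; rewrite ger0_norm ?invr_ge0 ?ltW// invf_lt1//; lra.
apply: (@squeeze_cvgr _ _ _ _ (fun=> 0) (fun n => ((2 * x)^-1) ^+ n));
  [near=> n|exact: cvg_cst|exact: h].
have x01 : 0 <= x <= 1 by apply/andP; split; lra.
have /andP[k0 k1] := kuhn_bounds n x01; rewrite k0/=.
have /andP[x0' x1'] := x01.
rewrite exprVn -[leRHS]mul1r ler_pdivlMr ?exprn_gt0//.
have y0 : 0 <= x ^+ n by exact: exprn_ge0.
have y1 : x ^+ n <= 1 by exact: exprn_ile1.
apply: (@le_trans _ _ (kuhn n x * (1 + x ^+ n) ^+ (2 ^ n))).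
  apply: ler_wpM2l => //; apply: (@le_trans _ _ (1 + (2 ^ n)%:R * x ^+ n)).
    by rewrite natrX -exprMn lerDr.
  by apply: bernoulli_ineq; rewrite (le_trans _ y0)// lerN10.
rewrite /kuhn -exprMn; apply: exprn_ile1.
  by rewrite mulr_ge0 ?subr_ge0 ?addr_ge0.
by rewrite -subr_sqr expr1n gerBl sqr_ge0.
Unshelve. all: by end_near. Qed.

End KuhnSequence.

(** * Completeness of the trigonometric system in L2 of the circle *)

Section FourierCompleteness.
Variable R : realType.
Local Notation leb := (@lebesgue_measure R).
Local Notation D := (`[0, 2 * pi]%classic : set (measurableTypeR R)).
Implicit Types (f g h : R -> R).

Lemma continuous_sqint_itv (a b : R) g : continuous g -> sqint leb `[a, b] g.
Proof.
move=> cg; split.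
  by apply: measurable_funTS; exact: continuous_measurable_fun.
have cg2 : continuous (fun x => g x ^+ 2).
  have -> : (fun x => g x ^+ 2) = (fun x => g x * g x) by apply/funext => x; rewrite expr2.
  by move=> x; apply: cvgM; exact: cg.
have /integrableP[_] := @continuous_integrable_itv _ (fun x => g x ^+ 2) a b cg2.
apply: le_lt_trans; rewrite le_eqVlt; apply/orP; left; apply/eqP.
by apply: eq_integral => x _; rewrite /= ger0_norm// sqr_ge0.
Qed.

Variable f : R -> R.
Hypothesis sf : sqint leb D f.
Hypothesis fcos : forall k : nat, inner leb D f (fun t => cos (k%:R * t)) = 0.
Hypothesis fsin : forall k : nat, inner leb D f (fun t => sin (k%:R * t)) = 0.

Let mD : measurable D. Proof. exact: measurable_itv. Qed.

(* [annih] collects the multiples of [f] that are still orthogonal to all trigonometric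
   monomials; [stab] is then an algebra of functions containing cos and sin. *)
Let annih g := continuous g /\ forall k : nat,
  inner leb D f (fun t => g t * cos (k%:R * t)) = 0 /\
  inner leb D f (fun t => g t * sin (k%:R * t)) = 0.
Let stab h := continuous h /\ forall g, annih g -> annih (fun t => h t * g t).

Let continuous_mulR g h : continuous g -> continuous h -> continuous (fun t => g t * h t).
Proof. by move=> cg ch t; apply: cvgM; [exact: cg|exact: ch]. Qed.

Let inner_lin a b g h : continuous g -> continuous h ->
  inner leb D f g = 0 -> inner leb D f h = 0 ->
  inner leb D f (fun t => a * g t + b * h t) = 0.
Proof.
move=> cg ch g0 h0; have sg := continuous_sqint_itv 0 (2 * pi) cg.
have sh := continuous_sqint_itv 0 (2 * pi) ch.
rewrite innerC innerDl//; try exact: sqintZ.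
by rewrite !innerZl// !(innerC leb D _ f) g0 h0 !mulr0 addr0.
Qed.

Let annih1 : annih (fun=> 1).
Proof.
split; first by move=> t; exact: cvg_cst.
move=> k; split; [apply: etrans (fcos k)|apply: etrans (fsin k)];
  by congr inner; apply/funext => t; rewrite mul1r.
Qed.

Let annih_lin a b g h : annih g -> annih h -> annih (fun t => a * g t + b * h t).
Proof.
move=> [cg hg] [ch hh]; split.
  by move=> t; apply: cvgD; apply: cvgM; (exact: cvg_cst || exact: cg || exact: ch).
move=> k; have [g1 g2] := hg k; have [h1 h2] := hh k; split.
  rewrite (_ : (fun t => _) = fun t => a * (g t * cos (k%:R * t)) + b * (h t * cos (k%:R * t))).
    by apply: inner_lin => //; apply: continuous_mulR => //; exact: continuous_cosk.
  by apply/funext => t; ring.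
rewrite (_ : (fun t => _) = fun t => a * (g t * sin (k%:R * t)) + b * (h t * sin (k%:R * t))).
  by apply: inner_lin => //; apply: continuous_mulR => //; exact: continuous_sink.
by apply/funext => t; ring.
Qed.

Let stab_lin a b g h : stab g -> stab h -> stab (fun t => a * g t + b * h t).
Proof.
move=> [cg hg] [ch hh]; split.
  by move=> t; apply: cvgD; apply: cvgM; (exact: cvg_cst || exact: cg || exact: ch).
move=> u au; rewrite (_ : (fun t => _) = fun t => a * (g t * u t) + b * (h t * u t)).
  by apply: annih_lin; [exact: hg|exact: hh].
by apply/funext => t; ring.
Qed.

Let stab_mul g h : stab g -> stab h -> stab (fun t => g t * h t).
Proof.
move=> [cg hg] [ch hh]; split; first exact: continuous_mulR.
move=> u au; rewrite (_ : (fun t => _) = fun t => g t * (h t * u t)).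
  by apply: hg; exact: hh.
by apply/funext => t; ring.
Qed.

Let stab1 : stab (fun=> 1).
Proof.
split; first by move=> t; exact: cvg_cst.
by move=> u; rewrite (_ : (fun t => 1 * u t) = u)//; apply/funext => t; rewrite mul1r.
Qed.

Let stab_exp g n : stab g -> stab (fun t => g t ^+ n).
Proof.
move=> sg; elim: n => [|n IH]; first exact: stab1.
rewrite (_ : (fun t => _) = fun t => g t * g t ^+ n); first exact: stab_mul.
by apply/funext => t; rewrite exprS.
Qed.

(** Product-to-sum formulas express the products through the frequencies [k - 1] and [k + 1]. The
    frequency 0 is separate, since its lower neighbour is not a natural number. *)
Let stab_cos : stab (@cos R).
Proof.
split; first exact: continuous_cos.
move=> g [cg hg]; split; first by apply: continuous_mulR => //; exact: continuous_cos.
case=> [|k].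
  have [h1 h2] := hg 1%N; split.
    apply: etrans h1; congr inner; apply/funext => t.
    by rewrite mul0r cos0 mulr1 mul1r mulrC.
  rewrite (_ : (fun t => _) = fun t => g t * sin (0%:R * t)); first by have [] := hg 0%N.
  by apply/funext => t; rewrite mul0r sin0 !mulr0.
have [a1 a2] := hg k; have [b1 b2] := hg k.+2; split.
  rewrite (_ : (fun t => _) = fun t => 2^-1 * (g t * cos (k%:R * t)) + 2^-1 * (g t * cos (k.+2%:R *
    t))).
    by apply: inner_lin => //; apply: continuous_mulR => //; exact: continuous_cosk.
  apply/funext => t.
  have -> : k%:R * t = k.+1%:R * t - t by rewrite -natr1; ring.
  have -> : k.+2%:R * t = k.+1%:R * t + t by rewrite -[k.+2%:R]natr1; ring.
  by rewrite cosB cosD; field.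
rewrite (_ : (fun t => _) = fun t => 2^-1 * (g t * sin (k%:R * t)) + 2^-1 * (g t * sin (k.+2%:R *
  t))).
  by apply: inner_lin => //; apply: continuous_mulR => //; exact: continuous_sink.
apply/funext => t.
have -> : k%:R * t = k.+1%:R * t - t by rewrite -natr1; ring.
have -> : k.+2%:R * t = k.+1%:R * t + t by rewrite -[k.+2%:R]natr1; ring.
by rewrite sinB sinD; field.
Qed.

Let stab_sin : stab (@sin R).
Proof.
split; first exact: continuous_sin.
move=> g [cg hg]; split; first by apply: continuous_mulR => //; exact: continuous_sin.
case=> [|k].
  have [h1 h2] := hg 1%N; split.
    apply: etrans h2; congr inner; apply/funext => t.
    by rewrite mul0r cos0 mulr1 mul1r mulrC.
  rewrite (_ : (fun t => _) = fun t => g t * sin (0%:R * t)); first by have [] := hg 0%N.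
  by apply/funext => t; rewrite mul0r sin0 !mulr0.
have [a1 a2] := hg k; have [b1 b2] := hg k.+2; split.
  rewrite (_ : (fun t => _) = fun t => - 2^-1 * (g t * sin (k%:R * t)) + 2^-1 * (g t * sin (k.+2%:R
    * t))).
    by apply: inner_lin => //; apply: continuous_mulR => //; exact: continuous_sink.
  apply/funext => t.
  have -> : k%:R * t = k.+1%:R * t - t by rewrite -natr1; ring.
  have -> : k.+2%:R * t = k.+1%:R * t + t by rewrite -[k.+2%:R]natr1; ring.
  by rewrite sinB sinD; field.
rewrite (_ : (fun t => _) = fun t => 2^-1 * (g t * cos (k%:R * t)) + - 2^-1 * (g t * cos (k.+2%:R *
  t))).
  by apply: inner_lin => //; apply: continuous_mulR => //; exact: continuous_cosk.
apply/funext => t.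
have -> : k%:R * t = k.+1%:R * t - t by rewrite -natr1; ring.
have -> : k.+2%:R * t = k.+1%:R * t + t by rewrite -[k.+2%:R]natr1; ring.
by rewrite cosB cosD; field.
Qed.

(* For [0 < t < 2 * pi] this is less than 1 / 2 exactly when [t < b]. *)
Let bump (b t : R) : R := 1 / 2 + (cos (b / 2) - cos (t - b / 2)) / 4.

(** By the addition formula [bump b] is a combination of 1, cos and sin, and [kuhn n] is a
    polynomial; so the composite lies in the algebra [stab]. *)
Let stab_kuhn b n : stab (fun t => kuhn n (bump b t)).
Proof.
apply: stab_exp.
have sb : stab (bump b).
  rewrite (_ : bump b = fun t => 1 * (1 * ((1 / 2 + cos (b / 2) / 4) * 1 + 0 * 1) +
     (- (cos (b / 2) / 4)) * cos t) + (- (sin (b / 2) / 4)) * sin t).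
    do 2 apply: stab_lin => //.
    exact: (@stab_lin _ _ (fun=> 1) (fun=> 1)).
  by apply/funext => t; rewrite /bump cosB; field.
rewrite (_ : (fun t => _) = fun t => 1 * 1 + (-1) * (bump b t ^+ n)).
  by apply: (@stab_lin _ _ (fun=> 1)) => //; exact: stab_exp.
by apply/funext => t; ring.
Qed.

Let inner_kuhn b n : inner leb D f (fun t => kuhn n (bump b t)) = 0.
Proof.
have [_ /(_ _ annih1) [_ /(_ 0%N) [e _]]] := stab_kuhn b n.
rewrite -[RHS]e; congr inner.
by apply/funext => t; rewrite mul0r cos0 !mulr1.
Qed.

(** In this factorized form the sign of [bump b t - 1 / 2] is visible: for [0 < t < 2 * pi] and
    [0 < b < 2 * pi] it is that of [t - b]. *)
Let bumpE b t : bump b t = 1 / 2 + sin (t / 2) * sin ((t - b) / 2) / 2.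
Proof.
rewrite /bump; have e1 : b / 2 = t / 2 - (t - b) / 2 by field.
have e2 : t - b / 2 = t / 2 + (t - b) / 2 by field.
by rewrite {1}e1 e2 cosB cosD; field.
Qed.

Let bump_bounds b t : 0 <= bump b t <= 1.
Proof.
have := cos_max (b / 2); have := cos_max (t - b / 2).
by rewrite !ler_norml /bump => /andP[? ?] /andP[? ?]; apply/andP; split; lra.
Qed.

(** The functions [kuhn n (bump b t)] tend boundedly to the indicator of [[0, b]], and [f] is
    orthogonal to each of them; dominated convergence with majorant [|f|] concludes. *)
Let integral_initial b : 0 < b < 2 * pi ->
  \int[leb]_(t in D) (f t * \1_(`[0, b]) t) = 0.
Proof.
move=> /andP[b0 b2].
have sk n : sqint leb D (fun t => kuhn n (bump b t)).
  by apply: continuous_sqint_itv; have [] := stab_kuhn b n.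
have hi : leb.-integrable D (EFin \o f).
  have c1 : continuous (fun _ : R => 1 : R) by move=> t; exact: cvg_cst.
  have := sqint_integrable_mul mD sf (continuous_sqint_itv 0 (2 * pi) c1).
  by rewrite (_ : (fun x => f x * 1) = f)//; apply/funext => x; rewrite mulr1.
have [] := @dominated_convergence _ _ _ leb D mD
  (fun n t => (f t * kuhn n (bump b t))%:E) (fun t => (f t * \1_(`[0, b]) t)%:E)
  (fun t => `|(f t)%:E|)%E.
- by move=> n; have := measurable_int _ (sqint_integrable_mul mD sf (sk n)).
- apply/measurable_EFinP; apply: measurable_funM; first by case: sf.
  exact: measurable_indic.
(* At these three points [bump b] equals 1 / 2, where the limit of the Kuhn polynomials is not
   controlled. *)
- exists [set 0; b; 2 * pi]; split.
  + by apply: measurableU; [apply: measurableU|]; exact: measurable_set1.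
  + by apply: countable_lebesgue_measure0; exact: finite_set_countable.
  + move=> t /= /not_implyP[]; rewrite in_itv/= => /andP[t0 t2]; apply: contra_notP.
    move=> /not_orP[/not_orP[tn0 tnb] tn2].
    have {}t0 : 0 < t by rewrite lt_neqAle t0 andbT eq_sym; exact/eqP.
    have {}t2 : t < 2 * pi by rewrite lt_neqAle t2 andbT; exact/eqP.
    apply: cvg_EFin; first by near=> n.
    apply: cvgM; first exact: cvg_cst.
    have /andP[bu0 bu1] := bump_bounds b t.
    have s1 : 0 < sin (t / 2) by apply: sin_gt0_pi; apply/andP; split; lra.
    have [tb|tb|tb] := ltgtP t b; last by case: tnb.
      have s2 : 0 < sin (- ((t - b) / 2)) by apply: sin_gt0_pi; apply/andP; split; lra.
      rewrite indicE mem_set/=; last by rewrite in_itv/= !ltW.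
      apply: cvg_kuhn1 => //; rewrite bumpE; move: s2; rewrite sinN; nra.
    have s2 : 0 < sin ((t - b) / 2) by apply: sin_gt0_pi; apply/andP; split; lra.
    rewrite indicE memNset/=; last by rewrite in_itv/= => /andP[_ tb']; lra.
    apply: cvg_kuhn0 => //; rewrite bumpE; nra.
- by have := integrable_abse hi.
- apply: aeW => t n _; rewrite lee_fin normrM ler_piMr//.
  by have /andP[k0 k1] := kuhn_bounds n (bump_bounds b t); rewrite ger0_norm.
move=> _ _; rewrite (_ : [sequence _]_n = fun=> 0%E).
  by move/cvg_lim => /(_ (@ereal_hausdorff R)); rewrite lim_cst// /Rintegral => <-.
apply/funext => n /=; rewrite sqint_integral_mulE//.
by rewrite inner_kuhn.
Unshelve. all: by end_near. Qed.

(** The primitive of [f] from 0 vanishes on the open interval by [integral_initial], and its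
    derivative is [f] almost everywhere by Lebesgue differentiation. *)
Lemma fourier_complete : ae_eq leb D f (cst 0).
Proof.
have p0 := @pi_gt0 R.
have hi : leb.-integrable D (EFin \o f).
  have c1 : continuous (fun _ : R => 1 : R) by move=> t; exact: cvg_cst.
  have := sqint_integrable_mul mD sf (continuous_sqint_itv 0 (2 * pi) c1).
  by rewrite (_ : (fun x => f x * 1) = f)//; apply/funext => x; rewrite mulr1.
pose fD := f \_ D.
have hiD : leb.-integrable setT (EFin \o fD).
  by rewrite /fD -restrict_EFin; exact: (proj1 (integrable_mkcond _ mD) hi).
have locf : locally_integrable [set: R] fD by exact: integrable_locally.
have hiy (y : R) : leb.-integrable [set` Interval (BLeft 0) (BRight y)] (EFin \o fD).
  by apply: integrableS hiD => //; exact: measurable_itv.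
pose F (x : R) := \int[leb]_(t in `[0, x]) fD t.
have F0 x : 0 < x < 2 * pi -> F x = 0.
  move=> x02; have /andP[x0 x2] := x02; rewrite -(integral_initial x02).
  rewrite /F Rintegral_mkcond [RHS]Rintegral_mkcond; apply: eq_Rintegral => t _.
  rewrite /fD /patch indicE !mem_setE /= !in_itv/=; case: ifPn => t1; case: ifPn => t2 //.
  - by rewrite mulr1.
  - by rewrite mulr0.
have ends : {ae leb, forall x, x <> 0 /\ x <> 2 * pi}.
  exists [set 0; 2 * pi]; split.
  - by apply: measurableU; exact: measurable_set1.
  - by apply: countable_lebesgue_measure0; exact: finite_set_countable.
  - by move=> x /= /not_andP[] /contrapT ->; [left|right].
have := @FTC1 _ _ _ hiy locf; move: ends; rewrite /ae_eq /=.
apply: filterS2; first exact: (ae_filter_ringOfSetsType leb).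
move=> x [xn0 xn2] h; rewrite in_itv/= => /andP[x0 x2].
have {}x0 : 0 < x by rewrite lt_neqAle x0 andbT eq_sym; exact/eqP.
have {}x2 : x < 2 * pi by rewrite lt_neqAle x2 andbT; exact/eqP.
have [|_] := h; first by rewrite lte_fin.
have -> : f x = fD x by rewrite /fD patchE mem_set//= in_itv/= !ltW.
move=> <-; rewrite derive1E (@near_eq_derive _ _ _ _ (cst 0)) ?derive_cst//.
near=> y; apply: F0; apply/andP; split; near: y.
  exact: lt_nbhsr.
exact: lt_nbhsl.
Unshelve. all: by end_near. Qed.

End FourierCompleteness.

(** * Modes as polynomial solutions of the equilibrium equations *)

Section Gradients.
Variable R : realType.
Implicit Types (f g : R * R -> R) (x : R * R).

(** Smoothness travels with the two partial derivatives, so that gradients of polynomials are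
    assembled by applying rules to terms, and [has_gradient_eq] tidies the result. *)
Definition has_gradient f f1 f2 : Prop :=
  [/\ smooth f, partial ord0 f = f1 & partial ord_max f = f2].

Lemma has_gradient_eq f f1 f2 g1 g2 : has_gradient f f1 f2 ->
  (forall x, f1 x = g1 x) -> (forall x, f2 x = g2 x) -> has_gradient f g1 g2.
Proof. by move=> [sf <- <-] /funext <- /funext <-. Qed.

Lemma has_gradient_cst (c : R) : has_gradient (fun=> c) (fun=> 0) (fun=> 0).
Proof. by split; [exact: smooth_cst|exact: partial_cst|exact: partial_cst]. Qed.

Lemma has_gradient1 : has_gradient (fun x => x.1) (fun=> 1) (fun=> 0).
Proof. by split; [exact: smooth_coord1|exact: partial_coord1|exact: partial_coord1]. Qed.

Lemma has_gradient2 : has_gradient (fun x => x.2) (fun=> 0) (fun=> 1).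
Proof. by split; [exact: smooth_coord2|exact: partial_coord2|exact: partial_coord2]. Qed.

Lemma has_gradientD f f1 f2 g g1 g2 : has_gradient f f1 f2 -> has_gradient g g1 g2 ->
  has_gradient (fun x => f x + g x) (fun x => f1 x + g1 x) (fun x => f2 x + g2 x).
Proof.
move=> [sf <- <-] [sg <- <-]; split; first exact: smooth_add.
  by rewrite partial_add//; exact: smooth_derivable.
by rewrite partial_add//; exact: smooth_derivable.
Qed.

Lemma has_gradientM f f1 f2 g g1 g2 : has_gradient f f1 f2 -> has_gradient g g1 g2 ->
  has_gradient (fun x => f x * g x) (fun x => f1 x * g x + f x * g1 x)
    (fun x => f2 x * g x + f x * g2 x).
Proof.
move=> [sf <- <-] [sg <- <-]; split; first exact: smooth_mul.
  by rewrite partial_mul//; exact: smooth_derivable.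
by rewrite partial_mul//; exact: smooth_derivable.
Qed.

Lemma has_gradientZ (c : R) f f1 f2 : has_gradient f f1 f2 ->
  has_gradient (fun x => c * f x) (fun x => c * f1 x) (fun x => c * f2 x).
Proof.
move=> [sf <- <-]; split; first exact: smooth_scale.
  by rewrite partial_scale.
by rewrite partial_scale.
Qed.

Lemma has_gradientN f f1 f2 : has_gradient f f1 f2 ->
  has_gradient (fun x => - f x) (fun x => - f1 x) (fun x => - f2 x).
Proof.
move=> [sf <- <-]; split; first exact: smooth_opp.
  by rewrite partial_opp.
by rewrite partial_opp.
Qed.

Lemma has_gradientB f f1 f2 g g1 g2 : has_gradient f f1 f2 -> has_gradient g g1 g2 ->
  has_gradient (fun x => f x - g x) (fun x => f1 x - g1 x) (fun x => f2 x - g2 x).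
Proof. by move=> hf hg; apply: has_gradientD => //; exact: has_gradientN. Qed.

(* [(re n x, im n x)] is the complex power [(x.1 + i x.2) ^ n] *)
Fixpoint cpower (n : nat) x : R * R :=
  if n is m.+1 then
    (x.1 * (cpower m x).1 - x.2 * (cpower m x).2,
     x.1 * (cpower m x).2 + x.2 * (cpower m x).1)
  else (1, 0).

Definition re n x := (cpower n x).1.
Definition im n x := (cpower n x).2.

Lemma reS n x : re n.+1 x = x.1 * re n x - x.2 * im n x. Proof. by []. Qed.
Lemma imS n x : im n.+1 x = x.1 * im n x + x.2 * re n x. Proof. by []. Qed.

Lemma cpower_circle n r (t : R) :
  re n (circle_point r t) = r ^+ n * cos (n%:R * t) /\
  im n (circle_point r t) = r ^+ n * sin (n%:R * t).
Proof.
elim: n => [|n [IHr IHi]]; first by rewrite mul0r cos0 sin0 expr0 mul1r mulr0.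
rewrite reS imS IHr IHi -natr1 mulrDl mul1r cosD sinD exprS /circle_point/=.
by split; ring.
Qed.

(** The Cauchy-Riemann equations with (z^n)' = n z^(n-1). For [n = 0] the truncated index [n.-1] is
    multiplied by 0. *)
Lemma has_gradient_re_im n :
  has_gradient (re n) (fun x => n%:R * re n.-1 x) (fun x => - (n%:R * im n.-1 x)) /\
  has_gradient (im n) (fun x => n%:R * im n.-1 x) (fun x => n%:R * re n.-1 x).
Proof.
elim: n => [|n [IHr IHi]].
  split; [apply: has_gradient_eq (has_gradient_cst 1) _ _|
          apply: has_gradient_eq (has_gradient_cst 0) _ _] => x; by rewrite mul0r ?oppr0.
have h1 := has_gradient1; have h2 := has_gradient2.
split.
  apply: has_gradient_eq (has_gradientB (has_gradientM h1 IHr) (has_gradientM h2 IHi)) _ _ => x /=.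
    by case: n {IHr IHi} => [|n] /=; rewrite -?[n.+2%:R]natr1 ?reS; ring.
  by case: n {IHr IHi} => [|n] /=; rewrite -?[n.+2%:R]natr1 ?imS; ring.
apply: has_gradient_eq (has_gradientD (has_gradientM h1 IHi) (has_gradientM h2 IHr)) _ _ => x /=.
  by case: n {IHr IHi} => [|n] /=; rewrite -?[n.+2%:R]natr1 ?imS; ring.
by case: n {IHr IHi} => [|n] /=; rewrite -?[n.+2%:R]natr1 ?reS; ring.
Qed.

Definition has_gradient_re n := (has_gradient_re_im n).1.
Definition has_gradient_im n := (has_gradient_re_im n).2.

End Gradients.

(** * The eigenvalue problem in strong form *)

Section Equilibrium.
Variables (R : realType) (lam mu rad : R).
Implicit Types (x : R * R).

Definition stress11 (u1 u2 : R * R -> R) x : R :=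
  (2 * mu + lam) * partial ord0 u1 x + lam * partial ord_max u2 x.
Definition stress22 (u1 u2 : R * R -> R) x : R :=
  lam * partial ord0 u1 x + (2 * mu + lam) * partial ord_max u2 x.
Definition stress12 (u1 u2 : R * R -> R) x : R := mu * (partial ord_max u1 x + partial ord0 u2 x).

(** The traction condition is multiplied by [rad]: on the circle the point [x] itself replaces the
    unit normal [x / rad]. *)
Definition strong_eigen (L : R) (u1 u2 : R * R -> R) : Prop :=
  [/\ smooth u1, smooth u2,
      (forall x, partial ord0 (stress11 u1 u2) x + partial ord_max (stress12 u1 u2) x = 0),
      (forall x, partial ord0 (stress12 u1 u2) x + partial ord_max (stress22 u1 u2) x = 0) &
      forall x, x.1 ^+ 2 + x.2 ^+ 2 = rad ^+ 2 ->
        stress11 u1 u2 x * x.1 + stress12 u1 u2 x * x.2 = L * rad * u1 x /\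
        stress12 u1 u2 x * x.1 + stress22 u1 u2 x * x.2 = L * rad * u2 x].

(** A certificate form of [strong_eigen]: once the stresses are supplied explicitly with their
    gradients, what remains are pointwise polynomial identities. *)
Lemma strong_eigenI L u1 u2 d11 d12 d21 d22 s11 s111 s112 s12 s121 s122 s22 s221 s222 :
  has_gradient u1 d11 d12 -> has_gradient u2 d21 d22 ->
  has_gradient s11 s111 s112 -> has_gradient s12 s121 s122 -> has_gradient s22 s221 s222 ->
  (forall x, (2 * mu + lam) * d11 x + lam * d22 x = s11 x) ->
  (forall x, mu * (d12 x + d21 x) = s12 x) ->
  (forall x, lam * d11 x + (2 * mu + lam) * d22 x = s22 x) ->
  (forall x, s111 x + s122 x = 0) -> (forall x, s121 x + s222 x = 0) ->
  (forall x, x.1 ^+ 2 + x.2 ^+ 2 = rad ^+ 2 ->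
        s11 x * x.1 + s12 x * x.2 = L * rad * u1 x /\
        s12 x * x.1 + s22 x * x.2 = L * rad * u2 x) ->
  strong_eigen L u1 u2.
Proof.
move=> [su1 e11 e12] [su2 e21 e22] [_ f1 f2] [_ g1 g2] [_ h1 h2] E11 E12 E22 d1 d2 tr.
have H11 : stress11 u1 u2 = s11 by apply/funext => x; rewrite /stress11 e11 e22.
have H12 : stress12 u1 u2 = s12 by apply/funext => x; rewrite /stress12 e12 e21.
have H22 : stress22 u1 u2 = s22 by apply/funext => x; rewrite /stress22 e11 e22.
by split => //; rewrite ?H11 ?H12 ?H22 ?f1 ?g2 ?g1 ?h2.
Qed.

Lemma smooth_stress (u1 u2 : R * R -> R) : smooth u1 -> smooth u2 ->
  [/\ smooth (stress11 u1 u2), smooth (stress12 u1 u2) & smooth (stress22 u1 u2)].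
Proof.
move=> s1 s2; split; rewrite /stress11 /stress12 /stress22.
- by apply: smooth_add; apply: smooth_scale; exact: smooth_partial.
- by apply: smooth_scale; apply: smooth_add; exact: smooth_partial.
- by apply: smooth_add; apply: smooth_scale; exact: smooth_partial.
Qed.

Lemma strong_eigen_lin L a u1 u2 v1 v2 : strong_eigen L u1 u2 -> strong_eigen L v1 v2 ->
  strong_eigen L (fun x => a * u1 x + v1 x) (fun x => a * u2 x + v2 x).
Proof.
move=> [su1 su2 eu1 eu2 tu] [sv1 sv2 ev1 ev2 tv].
have hg (f : R * R -> R) : smooth f -> has_gradient f (partial ord0 f) (partial ord_max f) by [].
have regroup (p q r s : R) : p + r = 0 -> q + s = 0 -> a * p + q + (a * r + s) = 0.
  by move=> pr qs; rewrite addrACA -mulrDr pr qs mulr0 addr0.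
have [p1 p2 p3] := smooth_stress su1 su2; have [q1 q2 q3] := smooth_stress sv1 sv2.
apply: (@strong_eigenI L _ _ _ _ _ _
  (fun x => a * stress11 u1 u2 x + stress11 v1 v2 x) _ _
  (fun x => a * stress12 u1 u2 x + stress12 v1 v2 x) _ _
  (fun x => a * stress22 u1 u2 x + stress22 v1 v2 x) _ _
  (has_gradientD (has_gradientZ a (hg _ su1)) (hg _ sv1))
  (has_gradientD (has_gradientZ a (hg _ su2)) (hg _ sv2))
  (has_gradientD (has_gradientZ a (hg _ p1)) (hg _ q1))
  (has_gradientD (has_gradientZ a (hg _ p2)) (hg _ q2))
  (has_gradientD (has_gradientZ a (hg _ p3)) (hg _ q3))) => x.
- by rewrite /stress11; ring.
- by rewrite /stress12; ring.
- by rewrite /stress22; ring.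
- exact: regroup (eu1 x) (ev1 x).
- exact: regroup (eu2 x) (ev2 x).
- move=> xr; have [t1 t2] := tu _ xr; have [t3 t4] := tv _ xr.
  have e p q : L * rad * (a * p + q) = a * (L * rad * p) + L * rad * q by ring.
  by rewrite !e -t1 -t2 -t3 -t4; split; ring.
Qed.

Lemma strong_eigen0 L : strong_eigen L (fun=> 0) (fun=> 0).
Proof.
have h := @has_gradient_cst R 0.
apply: (strong_eigenI h h h h h) => x; rewrite ?mulr0 ?addr0 ?mulr0//.
by rewrite !mul0r addr0.
Qed.

Lemma strong_eigen_scale L a u1 u2 : strong_eigen L u1 u2 ->
  strong_eigen L (fun x => a * u1 x) (fun x => a * u2 x).
Proof.
move=> /(@strong_eigen_lin L a) /(_ (strong_eigen0 L)).
by under eq_fun do rewrite addr0; under [X in strong_eigen _ _ X]eq_fun do rewrite addr0.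
Qed.

End Equilibrium.

(** * Verification of the equilibrium equations for the listed fields *)

Section StrongModes.
Variables (R : realType) (lam mu rad : R).
Hypotheses (hmu : 0 < mu) (hlammu : 0 < lam + mu) (hrad : 0 < rad).
Implicit Types (x : R * R).

Let lammu0 : lam + mu != 0. Proof. by rewrite gt_eqF. Qed.
Let lam3mu0 : lam + 3 * mu != 0. Proof. by rewrite gt_eqF//; move: hmu hlammu; lra. Qed.
Let rad_neq0 : rad != 0. Proof. by rewrite gt_eqF. Qed.

(** It vanishes on the circle; a multiple of it contributes to the traction but not to the boundary
    values. *)
Definition bubble x : R := rad ^+ 2 - (x.1 ^+ 2 + x.2 ^+ 2).

Lemma has_gradient_bubble : has_gradient bubble (fun x => - (2 * x.1)) (fun x => - (2 * x.2)).
Proof.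
have h1 := has_gradient1 R; have h2 := has_gradient2 R.
have -> : bubble = (fun x => rad ^+ 2 - (x.1 * x.1 + x.2 * x.2)).
  by apply/funext => x; rewrite /bubble !expr2.
apply: has_gradient_eq (has_gradientB (has_gradient_cst (rad ^+ 2))
  (has_gradientD (has_gradientM h1 h1) (has_gradientM h2 h2))) _ _ => x /=; ring.
Qed.

(* Shifted by one with respect to the paper: [modeV1 n] and [modeV2 n] are the components
   of the fields of case (v) for [n + 1], and for [n = 0] those of case (iii), up to sign. *)
Definition modeV1 (n : nat) (b : bool) x : R :=
  let A := (n.+2)%:R / (n.+1)%:R in
  let B := (lam + 3 * mu) / ((lam + mu) * (n.+1)%:R) in
  if b then - (A * (bubble x * im n x)) - B * im n.+2 x
  else A * (bubble x * re n x) + B * re n.+2 x.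

Definition modeV2 (n : nat) (b : bool) x : R :=
  let A := (n.+2)%:R / (n.+1)%:R in
  let B := (lam + 3 * mu) / ((lam + mu) * (n.+1)%:R) in
  if b then - (A * (bubble x * re n x)) + B * re n.+2 x
  else - (A * (bubble x * im n x)) + B * im n.+2 x.

Definition modeV_value (n : nat) : R := 2 * n.+2%:R * mu * (lam + mu) / ((lam + 3 * mu) * rad).

(** For [b = false] the field is A q conj(z)^n + B z^(n+2) with q the [bubble]; for [b = true] it is
    -i A q conj(z)^n + i B z^(n+2). The ratio of [A] and [B] fixed by [hAB] gives equilibrium, and
    [hL] matches traction and value. *)
Lemma strong_modeV n b : strong_eigen lam mu rad (modeV_value n) (modeV1 n b) (modeV2 n b).
Proof.
rewrite /modeV1 /modeV2; set A := _ / _; set B := (_ + _) / _.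
have n0 : n.+1%:R != 0 :> R by rewrite pnatr_eq0.
have hAB : (lam + mu) * (B * n.+2%:R) = (lam + 3 * mu) * A.
  rewrite /A /B; move: n0; rewrite -[n.+2%:R]natr1; move: (n.+1%:R) => N n0.
  by field; rewrite n0.
have hL : modeV_value n * rad * B = 2 * mu * A.
  rewrite /modeV_value /A /B; move: n0; rewrite -[n.+2%:R]natr1; move: (n.+1%:R) => N n0.
  by field; rewrite n0 lam3mu0 lammu0 rad_neq0.
(* The divergence of the field is [dv] times the real part of z^(n+1), or minus [dv] times its
   imaginary part. Here conj(z)^n is divergence free, so only the gradient of the bubble and z^(n+2)
   contribute. *)
pose dv := 2 * (B * n.+2%:R) - 2 * A.
(* This is [hAB] solved for [lam * dv]; rewriting with it removes [lam] from the equilibrium and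
   traction identities, which [ring] can then close. *)
have hC : lam * dv = 4 * mu * A - 2 * mu * (B * n.+2%:R) + 2 * mu * A.
  apply/eqP; rewrite -subr_eq0 (_ : _ - _ = 2 * ((lam + mu) * (B * n.+2%:R) - (lam + 3 * mu) * A)).
    by rewrite hAB subrr mulr0.
  by rewrite /dv; ring.
have h1 := has_gradient1 R; have h2 := has_gradient2 R.
have hq := has_gradient_bubble.
have ha := has_gradient_re R n; have hb := has_gradient_im R n.
have hn := has_gradient_re R n.+1; have hin := has_gradient_im R n.+1.
have hnn := has_gradient_re R n.+2; have hinn := has_gradient_im R n.+2.
have ha' := has_gradient_re R n.-1; have hb' := has_gradient_im R n.-1.
case: b.
- apply: (@strong_eigenI _ lam mu rad (modeV_value n) _ _ _ _ _ _
  (fun x => 2 * mu * (2 * A * (x.1 * im n x) - A * n%:R * (bubble x * im n.-1 x) - B * n.+2%:R * im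
    n.+1 x) - lam * dv * im n.+1 x) _ _
  (fun x => 2 * mu * (A * (x.1 * re n x) + A * (x.2 * im n x) - A * n%:R * (bubble x * re n.-1 x)))
    _ _
  (fun x => 2 * mu * (2 * A * (x.2 * re n x) + A * n%:R * (bubble x * im n.-1 x) - B * n.+2%:R * im
    n.+1 x) - lam * dv * im n.+1 x) _ _
  (has_gradientB (has_gradientN (has_gradientZ A (has_gradientM hq hb))) (has_gradientZ B hinn))
  (has_gradientD (has_gradientN (has_gradientZ A (has_gradientM hq ha))) (has_gradientZ B hnn))
  (has_gradientB (has_gradientZ (2 * mu) (has_gradientB (has_gradientB (has_gradientZ (2 * A)
    (has_gradientM h1 hb)) (has_gradientZ (A * n%:R) (has_gradientM hq hb')))
    (has_gradientZ (B * n.+2%:R) hin))) (has_gradientZ (lam * dv) hin))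
  (has_gradientZ (2 * mu) (has_gradientB (has_gradientD (has_gradientZ A (has_gradientM h1 ha))
    (has_gradientZ A (has_gradientM h2 hb))) (has_gradientZ (A * n%:R) (has_gradientM hq ha'))))
  (has_gradientB (has_gradientZ (2 * mu) (has_gradientB (has_gradientD (has_gradientZ (2 * A)
    (has_gradientM h2 ha)) (has_gradientZ (A * n%:R) (has_gradientM hq hb')))
    (has_gradientZ (B * n.+2%:R) hin))) (has_gradientZ (lam * dv) hin))) => x /=.
  + rewrite /dv imS; ring.
  + rewrite ?(imS, reS); ring.
  + rewrite /dv imS; ring.
  + rewrite hC -[n.+2%:R]natr1 -[n.+1%:R]natr1 ?(imS, reS).
    (* Second derivatives involve twice truncated indices, so [n = 0] and [n = 1] are checked
       apart. *)
    by case: (n) => [|[|k]]; rewrite /= ?(imS, reS) -?[k.+2%:R]natr1 -?[k.+1%:R]natr1; ring.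
  + rewrite hC -[n.+2%:R]natr1 -[n.+1%:R]natr1 ?(imS, reS).
    by case: (n) => [|[|k]]; rewrite /= ?(imS, reS) -?[k.+2%:R]natr1 -?[k.+1%:R]natr1; ring.
  + move=> xr; have q0 : bubble x = 0 by rewrite /bubble xr subrr.
    have e p : modeV_value n * rad * (B * p) = 2 * mu * A * p by rewrite mulrA hL.
    by rewrite q0 !mul0r !mulr0 !oppr0 !add0r mulrN !e hC !(imS, reS); split; ring.
- apply: (@strong_eigenI _ lam mu rad (modeV_value n) _ _ _ _ _ _
  (fun x => 2 * mu * (- (2 * A * (x.1 * re n x)) + A * n%:R * (bubble x * re n.-1 x) + B * n.+2%:R
    * re n.+1 x) + lam * dv * re n.+1 x) _ _
  (fun x => 2 * mu * (A * (x.1 * im n x) - A * (x.2 * re n x) - A * n%:R * (bubble x * im n.-1 x)))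
    _ _
  (fun x => 2 * mu * (2 * A * (x.2 * im n x) - A * n%:R * (bubble x * re n.-1 x) + B * n.+2%:R * re
    n.+1 x) + lam * dv * re n.+1 x) _ _
  (has_gradientD (has_gradientZ A (has_gradientM hq ha)) (has_gradientZ B hnn))
  (has_gradientD (has_gradientN (has_gradientZ A (has_gradientM hq hb))) (has_gradientZ B hinn))
  (has_gradientD (has_gradientZ (2 * mu)
    (has_gradientD (has_gradientD (has_gradientN (has_gradientZ (2 * A) (has_gradientM h1 ha)))
    (has_gradientZ (A * n%:R) (has_gradientM hq ha'))) (has_gradientZ (B * n.+2%:R) hn)))
    (has_gradientZ (lam * dv) hn))
  (has_gradientZ (2 * mu) (has_gradientB (has_gradientB (has_gradientZ A (has_gradientM h1 hb))
    (has_gradientZ A (has_gradientM h2 ha))) (has_gradientZ (A * n%:R) (has_gradientM hq hb'))))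
  (has_gradientD (has_gradientZ (2 * mu) (has_gradientD (has_gradientB (has_gradientZ (2 * A)
    (has_gradientM h2 hb)) (has_gradientZ (A * n%:R) (has_gradientM hq ha')))
    (has_gradientZ (B * n.+2%:R) hn))) (has_gradientZ (lam * dv) hn))) => x /=.
  + by rewrite /dv reS; ring.
  + by rewrite imS; ring.
  + by rewrite /dv reS; ring.
  + rewrite hC -[n.+2%:R]natr1 -[n.+1%:R]natr1 ?(imS, reS).
    by case: (n) => [|[|k]]; rewrite /= ?(imS, reS) -?[k.+2%:R]natr1 -?[k.+1%:R]natr1; ring.
  + rewrite hC -[n.+2%:R]natr1 -[n.+1%:R]natr1 ?(imS, reS).
    by case: (n) => [|[|k]]; rewrite /= ?(imS, reS) -?[k.+2%:R]natr1 -?[k.+1%:R]natr1; ring.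
  + move=> xr; have q0 : bubble x = 0 by rewrite /bubble xr subrr.
    have e p : modeV_value n * rad * (B * p) = 2 * mu * A * p by rewrite mulrA hL.
    by rewrite q0 !mul0r !mulr0 ?oppr0 !add0r !e hC !(imS, reS); split; ring.
Qed.

(* likewise shifted; [n = 0] gives the translations *)
Definition modeIV1 (n : nat) (b : bool) : R * R -> R := if b then im n else re n.
Definition modeIV2 (n : nat) (b : bool) x : R := if b then re n x else - im n x.

(** The field is the conjugate of z^n, or i times it: divergence and curl vanish, so the stress is
    [2 * mu] times the gradient. Euler's identity for homogeneous functions of degree [n] gives the
    traction. *)
Lemma strong_modeIV n b :
  strong_eigen lam mu rad (2 * mu * n%:R / rad) (modeIV1 n b) (modeIV2 n b).
Proof.
have ha := has_gradient_re R n; have hb := has_gradient_im R n.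
have ha' := has_gradient_re R n.-1; have hb' := has_gradient_im R n.-1.
case: b.
- apply: (@strong_eigenI _ lam mu rad _ _ _ _ _ _ _
  (fun x => (2 * mu * n%:R) * im n.-1 x) _ _ (fun x => (2 * mu * n%:R) * re n.-1 x) _ _
  (fun x => - ((2 * mu * n%:R) * im n.-1 x)) _ _ hb ha
  (has_gradientZ (2 * mu * n%:R) hb') (has_gradientZ (2 * mu * n%:R) ha')
  (has_gradientN (has_gradientZ (2 * mu * n%:R) hb'))) => x /=.
  1-5: by ring.
  by move=> _; rewrite divfK//; split; case: (n) => [|k]; rewrite /= ?(imS, reS); ring.
- apply: (@strong_eigenI _ lam mu rad _ _ _ _ _ _ _
  (fun x => (2 * mu * n%:R) * re n.-1 x) _ _ (fun x => - ((2 * mu * n%:R) * im n.-1 x)) _ _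
  (fun x => - ((2 * mu * n%:R) * re n.-1 x)) _ _ ha (has_gradientN hb)
  (has_gradientZ (2 * mu * n%:R) ha') (has_gradientN (has_gradientZ (2 * mu * n%:R) hb'))
  (has_gradientN (has_gradientZ (2 * mu * n%:R) ha'))) => x /=.
  1-5: by ring.
  by move=> _; rewrite divfK//; split; case: (n) => [|k]; rewrite /= ?(imS, reS); ring.
Qed.

Lemma strong_dilation :
  strong_eigen lam mu rad (2 * (lam + mu) / rad) (fun x => x.1) (fun x => x.2).
Proof.
have h1 := has_gradient1 R; have h2 := has_gradient2 R.
apply: (@strong_eigenI _ lam mu rad _ _ _ _ _ _ _
  (fun=> 2 * (lam + mu)) _ _ (fun=> 0) _ _ (fun=> 2 * (lam + mu)) _ _ h1 h2
  (has_gradient_cst _) (has_gradient_cst _) (has_gradient_cst _)) => x /=; try by ring.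
by move=> _; rewrite divfK//; split; ring.
Qed.

Lemma strong_rotation : strong_eigen lam mu rad 0 (fun x => - x.2) (fun x => x.1).
Proof.
have h1 := has_gradient1 R; have h2 := has_gradient2 R.
apply: (@strong_eigenI _ lam mu rad _ _ _ _ _ _ _
  (fun=> 0) _ _ (fun=> 0) _ _ (fun=> 0) _ _ (has_gradientN h2) h1
  (has_gradient_cst _) (has_gradient_cst _) (has_gradient_cst _)) => x /=; try by ring.
by move=> _; split; ring.
Qed.

Lemma strong_translation a b : strong_eigen lam mu rad 0 (fun=> a) (fun=> b).
Proof.
have h := @has_gradient_cst R 0.
apply: (strong_eigenI (has_gradient_cst a) (has_gradient_cst b) h h h) => x /=; try by ring.
by move=> _; split; ring.
Qed.

End StrongModes.

(** * The bijection between modes and Fourier profiles *)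

Section ModeFrequencies.
Implicit Types (m : mode).

(** Translations, rotation with dilation, and (iii) account for 0, 1 and 2; (iv) supplies the
    negative frequencies and (v) those from 3 on. Dilation and rotation share frequency 1, with
    profiles e^(it) and i e^(it), although their values differ. *)
Definition frequency m : int :=
  match m with
  | TranslationX | TranslationY => 0
  | Rotation | Dilation => 1
  | ModeIII _ => 2
  | ModeIV n _ => 1 - n%:Z
  | ModeV n _ => n%:Z + 1
  end.

Definition phase m : bool :=
  match m with
  | TranslationX | Dilation => false
  | TranslationY | Rotation => true
  | ModeIII b | ModeIV _ b | ModeV _ b => b
  end.

Lemma mode_of_frequency k b : exists m, [/\ admissible m, frequency m = k & phase m = b].
Proof.
case: k => [[|[|[|n]]]|n].
- by case: b; [exists TranslationY|exists TranslationX].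
- by case: b; [exists Rotation|exists Dilation].
- by exists (ModeIII b).
- by exists (ModeV n.+2 b); split => //=; rewrite -PoszD addn1.
- by exists (ModeIV n.+2 b); split => //=;
    rewrite NegzE -[n.+2]addn1 PoszD opprD addrCA subrr addr0.
Qed.

Lemma frequency_inj m m' : admissible m -> admissible m' ->
  frequency m = frequency m' -> phase m = phase m' -> m = m'.
Proof.
case: m => [| | | |b|n b|n b]; case: m' => [| | | |b'|n' b'|n' b'] //= a a'; try lia.
all: try by move=> _ ->.
- by move=> e ->; congr ModeIV; lia.
- by move=> e ->; congr ModeV; lia.
Qed.

End ModeFrequencies.

(** * Polynomial expressions and boundary values of the modes *)

Section CartesianModes.
Variables (R : realType) (lam mu rad : R).
Hypotheses (hmu : 0 < mu) (hlammu : 0 < lam + mu) (hrad : 0 < rad).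
Implicit Types (x : R * R) (m : mode).

(** The angle is the arc cosine of [x.1 / r] in the closed upper half plane, and [2 * pi] minus it
    below. *)
Lemma polar_coordinates x : exists2 t : R, 0 <= t < 2 * pi &
  x = circle_point (polar_radius x) t.
Proof.
have p0 := @pi_gt0 R.
set r := polar_radius x; have r0 : 0 <= r by exact: sqrtr_ge0.
have rE : r ^+ 2 = x.1 ^+ 2 + x.2 ^+ 2 by rewrite sqr_sqrtr// addr_ge0// sqr_ge0.
have [r00|rN0] := eqVneq r 0.
  exists 0; first by rewrite lexx/= mulr_gt0.
  move/eqP: rE; rewrite r00 expr0n/= eq_sym paddr_eq0 ?sqr_ge0// !sqrf_eq0 => /andP[/eqP x1 /eqP
    x2].
  by rewrite /circle_point !mul0r -{1}x1 -{1}x2 -surjective_pairing.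
have {}r0 : 0 < r by rewrite lt_neqAle eq_sym rN0.
pose c := x.1 / r.
have e1 : (x.1 / r) ^+ 2 + (x.2 / r) ^+ 2 = 1.
  by rewrite !expr_div_n -mulrDl -rE divff// expf_neq0.
have c1 : -1 <= c <= 1.
  rewrite -ler_norml -(@ler_pXn2r _ 2)// ?nnegrE//= expr1n real_normK ?num_real// -e1.
  by rewrite lerDl sqr_ge0.
have sq : Num.sqrt (1 - c ^+ 2) = `|x.2| / r.
  rewrite -e1 /c [X in Num.sqrt (X - _)]addrC addrK sqrtr_sqr normrM normfV.
  by rewrite (gtr0_norm r0).
have [x2|x2] := leP 0 x.2.
  exists (acos c).
    rewrite acos_ge0//=; apply: le_lt_trans (acos_lepi c1) _; lra.
  rewrite /circle_point acosK// sin_acos// sq ger0_norm// /c.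
  by rewrite ![r * (_ / r)]mulrC !divfK// -surjective_pairing.
exists (2 * pi - acos c).
  (* The angle must stay strictly below [2 * pi]; a zero arc cosine would force [x.2 = 0]. *)
  have a0 : 0 < acos c.
    rewrite lt_neqAle acos_ge0// andbT; apply/eqP => a0.
    have := @sin_acos _ _ c1; rewrite -a0 sin0 sq => /eqP.
    by rewrite eq_sym mulf_eq0 invr_eq0 (negbTE rN0) orbF normr_eq0 (lt_eqF x2).
  by have := acos_lepi c1; move=> ?; apply/andP; split; lra.
have -> : 2 * pi - acos c = - acos c + pi *+ 2 by rewrite -mulr_natl; ring.
rewrite /circle_point cosD2pi sinD2pi cosN sinN acosK// sin_acos// sq ltr0_norm// /c.
by rewrite mulNr opprK ![r * (_ / r)]mulrC !divfK// -surjective_pairing.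
Qed.

Lemma polar_angleE x : x = circle_point (polar_radius x) (polar_angle x).
Proof.
have [t /andP[t0 t2] xt] := polar_coordinates x; rewrite /polar_angle.
by case: xgetP => [s _ []//|/(_ t) []].
Qed.

(** Case (iii) is the case [n = 0] of [modeV1]; the sign is there because its second function is the
    opposite of the field with [b = true]. *)
Definition mode_x m : R * R -> R :=
  match m with
  | TranslationX => fun=> 1
  | TranslationY => fun=> 0
  | Rotation => fun x => - x.2
  | Dilation => fun x => x.1
  | ModeIII b => fun x => (-1) ^+ b * modeV1 lam mu rad 0 b x
  | ModeIV n b => modeIV1 n.-1 b
  | ModeV n b => modeV1 lam mu rad n.-1 b
  end.

Definition mode_y m : R * R -> R :=
  match m with
  | TranslationX => fun=> 0
  | TranslationY => fun=> 1
  | Rotation => fun x => x.1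
  | Dilation => fun x => x.2
  | ModeIII b => fun x => (-1) ^+ b * modeV2 lam mu rad 0 b x
  | ModeIV n b => modeIV2 n.-1 b
  | ModeV n b => modeV2 lam mu rad n.-1 b
  end.

Lemma bubble_circle r t : bubble rad (circle_point r t) = rad ^+ 2 - r ^+ 2.
Proof. by rewrite /bubble /circle_point/= !exprMn -mulrDr cos2Dsin2 mulr1. Qed.

(** It holds for every pair [(r, t)], so the angle picked by [polar_angle] at the origin is
    harmless. *)
Lemma mode_polarE m r t : admissible m -> mode_polar lam mu rad m r t =
  vec2 (mode_x m (circle_point r t)) (mode_y m (circle_point r t)).
Proof.
have vscale (c a b : R) : c *: vec2 a b = vec2 (c * a) (c * b).
  by apply/matrixP => i j; rewrite !mxE; case: ifP.
have lm0 : lam + mu != 0 by rewrite gt_eqF.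
case: m => [| | | |b|n b|n b] //=; rewrite ?vscale.
- by move=> _; congr vec2; ring.
- move=> _; rewrite /modeV1 /modeV2 !bubble_circle.
  have [r0 i0] := cpower_circle 0 r t; have [r2 i2] := cpower_circle 2 r t.
  rewrite r0 i0 r2 i2 mul0r cos0 sin0 expr0.
  by case: b => /=; congr vec2; rewrite ?expr0 ?expr1; field.
- case: n => [//|n] n2.
  rewrite /modeIV1 /modeIV2 subSS subn0/= -[n.+1%:R]natr1 addrK.
  by case: b; have [-> ->] := cpower_circle n r t => //; congr vec2; ring.
- case: n => [//|n] n2 /=.
  rewrite /modeV1 /modeV2 !bubble_circle subSS subn0.
  have [-> ->] := cpower_circle n r t; have [-> ->] := cpower_circle n.+2 r t.
  have n0 : n.+1%:R != 0 :> R by rewrite pnatr_eq0.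
  rewrite (_ : n.+1%:R - 1 = n%:R :> R); last by rewrite -natr1 addrK.
  rewrite natr1 !exprS -[n.+2%:R]natr1; move: (n.+1%:R) n0 => N n0.
  by case: b => /=; congr vec2; field; rewrite n0 lm0.
Qed.

Lemma mode_fieldE m : admissible m ->
  mode_field lam mu rad m = fun x => vec2 (mode_x m x) (mode_y m x).
Proof.
by move=> am; apply/funext => x; rewrite /mode_field mode_polarE// -polar_angleE.
Qed.

Lemma strong_mode m : admissible m ->
  strong_eigen lam mu rad (mode_value lam mu rad m) (mode_x m) (mode_y m).
Proof.
case: m => [| | | |b|n b|n b] am /=.
- exact: strong_translation.
- exact: strong_translation.
- exact: strong_rotation.
- exact: strong_dilation.
- apply: strong_eigen_scale.
  rewrite (_ : _ / _ = modeV_value lam mu rad 0); first exact: strong_modeV.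
  by rewrite /modeV_value; congr (_ / _); ring.
- case: n am => [//|n] _.
  by rewrite -[n.+1%:R]natr1 addrK/=; exact: strong_modeIV.
- case: n am => [//|n] _.
  rewrite (_ : _ / _ = modeV_value lam mu rad n); first exact: strong_modeV.
  by rewrite /modeV_value natr1.
Qed.

Definition amplitude m : R :=
  match m with
  | TranslationX | TranslationY => 1
  | Rotation | Dilation => rad
  | ModeIII b => (-1) ^+ b * ((lam + 3 * mu) * rad ^+ 2 / (lam + mu))
  | ModeIV n _ => rad ^+ n.-1
  | ModeV n _ => (lam + 3 * mu) / ((lam + mu) * n%:R) * rad ^+ n.+1
  end.

Lemma amplitude_neq0 m : admissible m -> amplitude m != 0.
Proof.
have h0 : rad != 0 by rewrite gt_eqF.
have h1 : lam + mu != 0 by rewrite gt_eqF.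
have h2 : lam + 3 * mu != 0 by rewrite gt_eqF//; move: hmu hlammu; lra.
case: m => [| | | |b|n b|n b] /= am; rewrite ?oner_neq0// ?expf_neq0//.
  by rewrite !mulf_neq0 ?invr_eq0 ?expf_neq0// signr_eq0.
case: n am => // n _; have n0 : n.+1%:R != 0 :> R by rewrite pnatr_eq0.
by rewrite mulf_neq0 ?expf_neq0// mulf_neq0// invr_eq0 mulf_neq0.
Qed.

Lemma mode_boundary m t : admissible m ->
  mode_x m (circle_point rad t) = amplitude m * (profile (frequency m) (phase m) t).1 /\
  mode_y m (circle_point rad t) = amplitude m * (profile (frequency m) (phase m) t).2.
Proof.
case: m => [| | | |b|n b|n b] am /=; rewrite /profile/=.
- by rewrite mul0r cos0 sin0 mulr1 mulr0.
- by rewrite mul0r cos0 sin0 oppr0 mulr1 mulr0.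
- by rewrite mul1r mulrN.
- by rewrite mul1r.
- rewrite {am} /modeV1 /modeV2 !bubble_circle subrr !mul0r mulr0 oppr0 !add0r.
  have lm0 : lam + mu != 0 by rewrite gt_eqF.
  by case: b; have [-> ->] := cpower_circle 2 rad t; split; rewrite /= ?expr0 ?expr1; field.
- case: n am => [//|n] _; rewrite /modeIV1 /modeIV2/=.
  rewrite (_ : 1 - n.+1%:Z = - n%:Z); last by rewrite -addn1 PoszD opprD addrCA subrr addr0.
  rewrite intrN mulNr cosN sinN.
  by case: b; have [-> ->] := cpower_circle n rad t; rewrite /= ?opprK ?mulrN.
- case: n am => [//|n] _; rewrite /modeV1 /modeV2 !bubble_circle/= subrr !mul0r mulr0 oppr0 !add0r.
  rewrite (_ : n.+1%:Z + 1 = n.+2%:Z); last by rewrite -PoszD addn1.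
  by case: b => /=; have [-> ->] := cpower_circle n.+2 rad t; split; ring.
Qed.

End CartesianModes.

(** * Green's formula and the Poincare inequality *)

Section DiskCircle.
Variable R : realType.
Variable rad : R.
Hypothesis rad0 : 0 < rad.
Local Notation leb := (@lebesgue_measure R).
Local Notation D := (`[0, 2 * pi]%classic : set (measurableTypeR R)).
Implicit Types (f g h T : R * R -> R).

Definition disk_inner f g : R := inner (area R) (disk rad) f g.
(** The measure is the angle and not the arc length; this is why a factor [rad] accompanies it in
    the weak equation. *)
Definition circle_inner f g : R :=
  inner leb D (f \o circle_point rad) (g \o circle_point rad).
Definition disk_sqint f := sqint (area R) (disk rad) f.
Definition circle_sqint f := sqint leb D (f \o circle_point rad).

Let mdisk := @measurable_area_disk R rad.
Let mD : measurable D. Proof. exact: measurable_itv. Qed.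

Lemma L2_circleE f : L2_circle rad f <-> circle_sqint f.
Proof.
rewrite /L2_circle /circle_sqint /sqint /boundary_integral; split => -[mf fi]; split => //.
  have K (I : \bar R) : (0 <= I -> rad%:E * I < +oo -> I < +oo)%E.
    by case: I => [r| |] // _; rewrite ?ltry// gt0_muley ?lte_fin.
  by apply: K fi; apply: integral_ge0 => t _; rewrite lee_fin sqr_ge0.
apply: lte_mul_pinfty.
- by rewrite lee_fin ltW.
- by [].
- exact: fi.
Qed.

Lemma smooth_disk_sqint f : smooth f -> disk_sqint f.
Proof.
move=> sf; split; first exact: (continuous_measurable_plane (smooth_continuous sf)).
have sf2 : smooth (fun x => f x * f x) by exact: smooth_mul.
have := integrable_fin_num mdisk (continuous_integrable_disk rad0 (smooth_continuous sf2)).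
by rewrite fin_numElt => /andP[_].
Qed.

Lemma smooth_circle_sqint f : smooth f -> circle_sqint f.
Proof. by move=> /smooth_continuous cf; apply: continuous_sqint_itv; exact: continuous_circle. Qed.

Lemma smooth_Rintegral_disk_add f g : smooth f -> smooth g ->
  \int[area R]_(x in disk rad) (f x + g x) =
  \int[area R]_(x in disk rad) f x + \int[area R]_(x in disk rad) g x.
Proof.
by move=> sf sg; rewrite RintegralD//; apply: continuous_integrable_disk => //;
  exact: smooth_continuous.
Qed.

Lemma green1 f g : smooth f -> smooth g ->
  disk_inner (partial ord0 f) g + disk_inner f (partial ord0 g) =
  rad * \int[leb]_(t in D) (f (circle_point rad t) * g (circle_point rad t) * cos t).
Proof.
move=> sf sg; have <- := divergence1 rad0 (smooth_mul sf sg).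
rewrite partial_mul; try exact: smooth_derivable.
by rewrite smooth_Rintegral_disk_add//; apply: smooth_mul => //; exact: smooth_partial.
Qed.

Lemma green2 f g : smooth f -> smooth g ->
  disk_inner (partial ord_max f) g + disk_inner f (partial ord_max g) =
  rad * \int[leb]_(t in D) (f (circle_point rad t) * g (circle_point rad t) * sin t).
Proof.
move=> sf sg; have <- := divergence2 rad0 (smooth_mul sf sg).
rewrite partial_mul; try exact: smooth_derivable.
by rewrite smooth_Rintegral_disk_add//; apply: smooth_mul => //; exact: smooth_partial.
Qed.

Lemma circle_not_in_disk t : ~ disk rad (circle_point rad t).
Proof. by rewrite /disk/= !exprMn -mulrDr cos2Dsin2 mulr1 ltxx. Qed.

(** The boundary term of Green's formula vanishes because the support of a test function is
    contained in the open disk. *)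
Lemma smooth_weak_partial f i : smooth f -> weak_partial rad i f (partial i f).
Proof.
move=> sf phi [sp [K [cK KD phi0]]].
have p0 t : phi (circle_point rad t) = 0.
  by apply: phi0 => /KD; exact: circle_not_in_disk.
have h1 := smooth_disk_sqint sf; have h2 := smooth_disk_sqint (smooth_partial sp i).
have h3 := smooth_disk_sqint sp; have h4 := smooth_disk_sqint (smooth_partial sf i).
rewrite (sqint_integral_mulE mdisk h1 h2) (sqint_integral_mulE mdisk h4 h3) -EFinN.
congr EFin; apply/eqP; rewrite -addr_eq0 addrC; apply/eqP.
have [->|->] : i = ord0 \/ i = ord_max.
  by case: i {h2 h4} => -[|[|//]] ?; [left|right]; exact: val_inj.
  rewrite [LHS]green1//.
  under eq_Rintegral do rewrite p0 mulr0 mul0r.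
  by rewrite Rintegral_cst// mul0r mulr0.
rewrite [LHS]green2//.
under eq_Rintegral do rewrite p0 mulr0 mul0r.
by rewrite Rintegral_cst// mul0r mulr0.
Qed.

(* Apply the divergence theorem to [x_1 f^2]. *)
Lemma divergence_scaled1 f : smooth f ->
  disk_inner f f + 2 * disk_inner f (fun x => x.1 * partial ord0 f x) =
  rad ^+ 2 * \int[leb]_(t in D) (f (circle_point rad t) ^+ 2 * cos t ^+ 2).
Proof.
move=> sf; have s1 := smooth_coord1 R; have spf := smooth_partial sf ord0.
have sff := smooth_mul sf sf.
have := divergence1 rad0 (smooth_mul s1 sff).
have -> : partial ord0 (fun x : R * R => x.1 * (f x * f x)) =
    fun x => f x * f x + 2 * (f x * (x.1 * partial ord0 f x)).
  rewrite !partial_mul; try exact: smooth_derivable.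
  by rewrite partial_coord1; apply/funext => x /=; ring.
have s2 := smooth_mul sf (smooth_mul s1 spf).
rewrite smooth_Rintegral_disk_add//; last exact: smooth_scale.
rewrite RintegralZl//; last exact/continuous_integrable_disk/smooth_continuous.
move=> ->; rewrite expr2 -mulrA [X in _ = _ * X]integral_scale.
  by congr (_ * _); apply: eq_Rintegral => t _; rewrite /circle_point/=; ring.
have cf := continuous_circle (rad := rad) (smooth_continuous sf).
by move=> t; apply: cvgM; apply: cvgM; (exact: cf || exact: continuous_cos).
Qed.

Lemma divergence_scaled2 f : smooth f ->
  disk_inner f f + 2 * disk_inner f (fun x => x.2 * partial ord_max f x) =
  rad ^+ 2 * \int[leb]_(t in D) (f (circle_point rad t) ^+ 2 * sin t ^+ 2).
Proof.
move=> sf; have s1 := smooth_coord2 R; have spf := smooth_partial sf ord_max.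
have sff := smooth_mul sf sf.
have := divergence2 rad0 (smooth_mul s1 sff).
have -> : partial ord_max (fun x : R * R => x.2 * (f x * f x)) =
    fun x => f x * f x + 2 * (f x * (x.2 * partial ord_max f x)).
  rewrite !partial_mul; try exact: smooth_derivable.
  by rewrite partial_coord2; apply/funext => x /=; ring.
have s2 := smooth_mul sf (smooth_mul s1 spf).
rewrite smooth_Rintegral_disk_add//; last exact: smooth_scale.
rewrite RintegralZl//; last exact/continuous_integrable_disk/smooth_continuous.
move=> ->; rewrite expr2 -mulrA [X in _ = _ * X]integral_scale.
  by congr (_ * _); apply: eq_Rintegral => t _; rewrite /circle_point/=; ring.
have cf := continuous_circle (rad := rad) (smooth_continuous sf).
by move=> t; apply: cvgM; apply: cvgM; (exact: cf || exact: continuous_sin).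
Qed.

(** In [divergence_scaled1] and [divergence_scaled2] the disk terms vanish; adding the remaining
    boundary terms gives the full circle norm, as [cos ^+ 2] and [sin ^+ 2] sum to 1. Linear
    independence of the modes rests on this. *)
Lemma smooth_ae0_circle f : smooth f -> disk_inner f f = 0 -> circle_inner f f = 0.
Proof.
move=> sf f0; have h := smooth_disk_sqint sf.
have h1 := smooth_disk_sqint (smooth_mul (smooth_coord1 R) (smooth_partial sf ord0)).
have h2 := smooth_disk_sqint (smooth_mul (smooth_coord2 R) (smooth_partial sf ord_max)).
have e1 := divergence_scaled1 sf; have e2 := divergence_scaled2 sf.
have z1 := inner_eq0l mdisk h h1 f0; rewrite f0 [X in _ + 2 * X]z1 mulr0 addr0 in e1.
have z2 := inner_eq0l mdisk h h2 f0; rewrite f0 [X in _ + 2 * X]z2 mulr0 addr0 in e2.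
have r2 : rad ^+ 2 != 0 by rewrite expf_neq0// gt_eqF.
move/esym/eqP : e1; rewrite mulf_eq0 (negbTE r2) => /eqP e1.
move/esym/eqP : e2; rewrite mulf_eq0 (negbTE r2) => /eqP e2.
have cf := continuous_circle (rad := rad) (smooth_continuous sf).
have c2 : continuous (fun t => f (circle_point rad t) ^+ 2).
  by move=> t; apply: cvgM; exact: cf.
have -> : circle_inner f f = \int[leb]_(t in D) (f (circle_point rad t) ^+ 2 * cos t ^+ 2) +
                             \int[leb]_(t in D) (f (circle_point rad t) ^+ 2 * sin t ^+ 2).
  rewrite -RintegralD//; try apply: continuous_integrable_itv.
  - by apply: eq_Rintegral => t _; rewrite -mulrDr cos2Dsin2 mulr1 expr2.
  - by move=> t; apply: cvgM; [exact: c2|apply: cvgM; exact: continuous_cos].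
  - by move=> t; apply: cvgM; [exact: c2|apply: cvgM; exact: continuous_sin].
by rewrite e1 e2 addr0.
Qed.

(** Shared by both directions: [g] stands for [x_i] times the i-th derivative of [f], and [b] for
    cos or sin. *)
Lemma poincare_aux f g (b : R -> R) : smooth f -> smooth g -> continuous b ->
  (forall t, `|b t| <= 1) ->
  disk_inner f f + 2 * disk_inner f g =
  rad ^+ 2 * \int[leb]_(t in D) (f (circle_point rad t) ^+ 2 * b t ^+ 2) ->
  disk_inner f f <= 16 * disk_inner g g + 2 * rad ^+ 2 * circle_inner f f.
Proof.
move=> sf sg cb b1 e.
have hf := smooth_disk_sqint sf; have hg := smooth_disk_sqint sg.
have : \int[leb]_(t in D) (f (circle_point rad t) ^+ 2 * b t ^+ 2) <= circle_inner f f.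
  have cf := continuous_circle (rad := rad) (smooth_continuous sf).
  have c2 : continuous (fun t => f (circle_point rad t) ^+ 2).
    by move=> t; apply: cvgM; exact: cf.
  apply: le_Rintegral => //; try apply: continuous_integrable_itv.
  - by move=> t; apply: cvgM; [exact: c2|apply: cvgM; exact: cb].
  - exact: c2.
  - move=> t _; rewrite /comp -expr2 ler_piMr ?sqr_ge0//.
    by rewrite -[leLHS]sqr_normE exprn_ile1.
move=> h; have := ler_wpM2l (sqr_ge0 rad) h; rewrite -e.
(* With weight 4 the cross term is at most [8 * disk_inner g g] plus half of [disk_inner f f];
   absorbing that half and doubling produces the constants 16 and 2. *)
have e0 : 0 < 4 :> R by [].
have := inner_le_AMGM mdisk hf hg e0;
  rewrite -/(disk_inner f g) -/(disk_inner f f) -/(disk_inner g g).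
by rewrite ler_norml => /andP[h1 h2] h3; lra.
Qed.

(** Apply [poincare_aux] with [x.1 * partial ord0 f x] for [g] and bound [x.1] by [rad]. Only one
    derivative enters, which is what makes Korn's inequality dispensable. *)
Lemma poincare1 f : smooth f ->
  disk_inner f f <= 16 * rad ^+ 2 * disk_inner (partial ord0 f) (partial ord0 f) +
    2 * rad ^+ 2 * circle_inner f f.
Proof.
move=> sf; have spf := smooth_partial sf ord0.
have := poincare_aux sf (smooth_mul (smooth_coord1 R) spf) (@continuous_cos R) (@cos_max R)
  (divergence_scaled1 sf).
move=> h; apply: le_trans h _; rewrite lerD2r -mulrA ler_pM2l//.
have ci g : smooth g -> (area R).-integrable (disk rad) (EFin \o g).
  by move=> sg; apply: continuous_integrable_disk => //; exact: smooth_continuous.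
rewrite /disk_inner /inner -RintegralZl//; last by apply: ci; exact: smooth_mul.
apply: le_Rintegral => //.
- by apply: ci; apply: smooth_mul; apply: smooth_mul => //; exact: smooth_coord1.
- by apply: ci; apply: smooth_scale; exact: smooth_mul.
move=> x /ltW /(disk_bound rad0)[x1 _].
rewrite mulrACA ler_wpM2r ?sqr_ge0// -?expr2 ?sqr_ge0//.
by rewrite -[leLHS]sqr_normE ler_pXn2r// nnegrE ltW.
Qed.

Lemma poincare2 f : smooth f ->
  disk_inner f f <= 16 * rad ^+ 2 * disk_inner (partial ord_max f) (partial ord_max f) +
    2 * rad ^+ 2 * circle_inner f f.
Proof.
move=> sf; have spf := smooth_partial sf ord_max.
have := poincare_aux sf (smooth_mul (smooth_coord2 R) spf) (@continuous_sin R) (@sin_max R)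
  (divergence_scaled2 sf).
move=> h; apply: le_trans h _; rewrite lerD2r -mulrA ler_pM2l//.
have ci g : smooth g -> (area R).-integrable (disk rad) (EFin \o g).
  by move=> sg; apply: continuous_integrable_disk => //; exact: smooth_continuous.
rewrite /disk_inner /inner -RintegralZl//; last by apply: ci; exact: smooth_mul.
apply: le_Rintegral => //.
- by apply: ci; apply: smooth_mul; apply: smooth_mul => //; exact: smooth_coord2.
- by apply: ci; apply: smooth_scale; exact: smooth_mul.
move=> x /ltW /(disk_bound rad0)[_ x1].
rewrite mulrACA ler_wpM2r ?sqr_ge0// -?expr2 ?sqr_ge0//.
by rewrite -[leLHS]sqr_normE ler_pXn2r// nnegrE ltW.
Qed.

End DiskCircle.

Lemma cvg_null_comb (R : realType) (p q : R) (a b c : nat -> R) :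
  a @ \oo --> (0 : R) -> b @ \oo --> (0 : R) -> c @ \oo --> (0 : R) ->
  (fun k => 2 * a k + 2 * (p * (2 * b k) + q * (2 * c k))) @ \oo --> (0 : R).
Proof.
move=> ha hb hc.
rewrite [X in _ --> X](_ : 0 = 2 * 0 + 2 * (p * (2 * 0) + q * (2 * 0))); last by ring.
apply: cvgD; first by apply: cvgMr.
by apply: cvgMr; apply: cvgD; do 2 apply: cvgMr.
Qed.

(** * Functions with zero trace and one vanishing derivative *)

Section Traces.
Variable R : realType.
Variable rad : R.
Hypothesis rad0 : 0 < rad.
Local Notation leb := (@lebesgue_measure R).
Local Notation D := (`[0, 2 * pi]%classic : set (measurableTypeR R)).
Local Notation disk_inner := (disk_inner rad).
Local Notation circle_inner := (circle_inner rad).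
Local Notation disk_sqint := (disk_sqint rad).
Local Notation circle_sqint := (circle_sqint rad).

Let mdisk := @measurable_area_disk R rad.
Let mD : measurable D. Proof. exact: measurable_itv. Qed.

Lemma L2_circle_cvgE (f_ : nat -> R * R -> R) f : L2_circle_cvg rad f_ f ->
  (fun k => \int[leb]_(t in D) (((f_ k \o circle_point rad) t - (f \o circle_point rad) t) ^+
    2)%:E)%E @ \oo --> 0%E.
Proof.
move=> /(cvgeZl (y := rad^-1%:E)) => /(_ isT); rewrite mule0.
by under eq_fun do rewrite /boundary_integral muleA -EFinM mulVf ?gt_eqF// mul1e.
Qed.

Lemma ord2_cases (i : 'I_2) : i = ord0 \/ i = ord_max.
Proof. by case: i => -[|[|//]] ?; [left|right]; exact: val_inj. Qed.

Lemma poincare (i : 'I_2) (f : R * R -> R) : smooth f ->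
  disk_inner f f <= 16 * rad ^+ 2 * disk_inner (partial i f) (partial i f) +
    2 * rad ^+ 2 * circle_inner f f.
Proof. by case: (ord2_cases i) => ->; [exact: poincare1|exact: poincare2]. Qed.

(** The Poincare inequality holds along the approximating sequence; splitting each norm into its
    limit, which is zero, and the error leaves a bound by a null sequence, that of
    [cvg_null_comb]. *)
Lemma zero_trace_eq0 (i : 'I_2) (w_ : nat -> R * R -> R) f h T :
  (forall k, smooth (w_ k)) -> disk_sqint f -> disk_sqint h -> circle_sqint T ->
  disk_inner h h = 0 -> circle_inner T T = 0 ->
  L2_disk_cvg rad w_ f -> L2_disk_cvg rad (fun k => partial i (w_ k)) h ->
  L2_circle_cvg rad w_ T -> disk_inner f f = 0.
Proof.
move=> sw hf hh hT h0 T0 cf ch /L2_circle_cvgE cT.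
have sd k := smooth_disk_sqint rad0 (sw k).
have sp k := smooth_disk_sqint rad0 (smooth_partial (sw k) i).
have sc k := smooth_circle_sqint rad (sw k).
have a0 := cvg_inner_sub mdisk sd hf cf.
have b0 := cvg_inner_sub mdisk sp hh ch.
have c0 := cvg_inner_sub mD sc hT cT.
apply/eqP; rewrite eq_le; apply/andP; split; last exact: inner_ge0.
apply: (cvgr_to_ge (cvg_null_comb (16 * rad ^+ 2) (2 * rad ^+ 2) a0 b0 c0)).
apply: nearW => k /=.
have e1 := inner_le_split mdisk hf (sd k).
have e2 := inner_le_split mdisk (sp k) hh.
have e3 := inner_le_split mD (sc k) hT.
have e4 := poincare i (sw k).
rewrite (inner_subC (area R) (disk rad)) in e2; rewrite (inner_subC leb D) in e3.
rewrite [X in _ + 2 * X]h0 mulr0 addr0 in e2; rewrite [X in _ + 2 * X]T0 mulr0 addr0 in e3.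
apply: (le_trans e1); rewrite lerD2l ler_pM2l//; apply: (le_trans e4); apply: lerD.
  by apply: ler_wpM2l => //; rewrite mulr_ge0// sqr_ge0.
by apply: ler_wpM2l => //; rewrite mulr_ge0// sqr_ge0.
Qed.

End Traces.

(** * The weak eigenvalue problem *)

Section WeakForm.
Variables (R : realType) (lam mu rad : R).
Hypothesis rad0 : 0 < rad.
Local Notation leb := (@lebesgue_measure R).
Local Notation D := (`[0, 2 * pi]%classic : set (measurableTypeR R)).
Local Notation disk_inner := (disk_inner rad).
Local Notation circle_inner := (circle_inner rad).
Local Notation disk_sqint := (disk_sqint rad).
Local Notation circle_sqint := (circle_sqint rad).
Implicit Types (G H : R * R -> 'M[R]_2) (u v w S T : vfield R).

Let mdisk := @measurable_area_disk R rad.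
Let mD : measurable D. Proof. exact: measurable_itv. Qed.

Lemma sum_ord2 (V : nmodType) (F : 'I_2 -> V) : \sum_(i < 2) F i = F ord0 + F ord_max.
Proof. by rewrite !big_ord_recl big_ord0 addr0; congr (_ + F _); exact: val_inj. Qed.

Definition sigma11 G x : R := (2 * mu + lam) * G x ord0 ord0 + lam * G x ord_max ord_max.
Definition sigma22 G x : R := lam * G x ord0 ord0 + (2 * mu + lam) * G x ord_max ord_max.
Definition sigma12 G x : R := mu * (G x ord0 ord_max + G x ord_max ord0).

(** Since the stress is symmetric, contraction with the strain equals contraction with the whole
    gradient. The two off-diagonal terms stay separate, so that each stress row meets the gradient
    of one component. *)
Lemma ddot_elastic_strain (X Y : 'M[R]_2) :
  ddot (elastic lam mu (strain X)) (strain Y) =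
  ((2 * mu + lam) * X ord0 ord0 + lam * X ord_max ord_max) * Y ord0 ord0 +
  mu * (X ord0 ord_max + X ord_max ord0) * Y ord0 ord_max +
  mu * (X ord0 ord_max + X ord_max ord0) * Y ord_max ord0 +
  (lam * X ord0 ord0 + (2 * mu + lam) * X ord_max ord_max) * Y ord_max ord_max.
Proof.
rewrite /ddot !sum_ord2 /elastic /strain /mxtrace !sum_ord2 !mxE /= !mulr1n !mulr0n.
by field.
Qed.

Definition grad_sqint G := forall i j, disk_sqint (fun x => G x i j).

Definition energy G H : R :=
  disk_inner (sigma11 G) (fun x => H x ord0 ord0) +
  disk_inner (sigma12 G) (fun x => H x ord0 ord_max) +
  disk_inner (sigma12 G) (fun x => H x ord_max ord0) +
  disk_inner (sigma22 G) (fun x => H x ord_max ord_max).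

Lemma sigma_sqint G : grad_sqint G ->
  [/\ disk_sqint (sigma11 G), disk_sqint (sigma12 G) & disk_sqint (sigma22 G)].
Proof.
move=> hG; split.
- exact: (sqintD mdisk (sqintZ mdisk _ (hG _ _)) (sqintZ mdisk _ (hG _ _))).
- exact: (sqintZ mdisk _ (sqintD mdisk (hG _ _) (hG _ _))).
- exact: (sqintD mdisk (sqintZ mdisk _ (hG _ _)) (sqintZ mdisk _ (hG _ _))).
Qed.

Lemma integral_energy G H : grad_sqint G -> grad_sqint H ->
  (\int[area R]_(x in disk rad)
    (ddot (elastic lam mu (strain (G x))) (strain (H x)))%:E = (energy G H)%:E)%E.
Proof.
move=> hG hH; have [s11 s12 s22] := sigma_sqint hG.
have h00 := hH ord0 ord0; have h01 := hH ord0 ord_max.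
have h10 := hH ord_max ord0; have h11 := hH ord_max ord_max.
have i1 := sqint_integrable_mul mdisk s11 h00.
have i2 := sqint_integrable_mul mdisk s12 h01.
have i3 := sqint_integrable_mul mdisk s12 h10.
have i4 := sqint_integrable_mul mdisk s22 h11.
rewrite /energy !EFinD -!sqint_integral_mulE//.
have i12 := integrableD mdisk i1 i2.
have i123 := integrableD mdisk i12 i3.
rewrite -(integralD mdisk i1 i2) -(integralD mdisk i12 i3) -(integralD mdisk i123 i4).
by apply: eq_integral => x _; rewrite ddot_elastic_strain.
Qed.

(** Symmetry of the elasticity tensor, pointwise. It is what makes the trace of an eigenfunction
    orthogonal to the modes of a different value. *)
Lemma energyC G H : grad_sqint G -> grad_sqint H -> energy G H = energy H G.
Proof.
move=> hG hH; apply: EFin_inj; rewrite -!integral_energy//.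
by apply: eq_integral => x _; congr EFin; rewrite !ddot_elastic_strain; ring.
Qed.

Lemma energyBl G G' H : grad_sqint G -> grad_sqint G' -> grad_sqint H ->
  energy (fun x => G x - G' x) H = energy G H - energy G' H.
Proof.
move=> hG hG' hH; have [a1 a2 a3] := sigma_sqint hG; have [b1 b2 b3] := sigma_sqint hG'.
have h00 := hH ord0 ord0; have h01 := hH ord0 ord_max.
have h10 := hH ord_max ord0; have h11 := hH ord_max ord_max.
rewrite /energy.
have -> : sigma11 (fun x => G x - G' x) = fun x => sigma11 G x - sigma11 G' x.
  by apply/funext => x; rewrite /sigma11 !mxE; ring.
have -> : sigma12 (fun x => G x - G' x) = fun x => sigma12 G x - sigma12 G' x.
  by apply/funext => x; rewrite /sigma12 !mxE; ring.
have -> : sigma22 (fun x => G x - G' x) = fun x => sigma22 G x - sigma22 G' x.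
  by apply/funext => x; rewrite /sigma22 !mxE; ring.
by rewrite /disk_inner !innerBl//; ring.
Qed.

Definition boundary_inner S T : R :=
  circle_inner (component S ord0) (component T ord0) +
  circle_inner (component S ord_max) (component T ord_max).

Lemma integral_boundary_dot S T :
  (forall i, circle_sqint (component S i)) -> (forall i, circle_sqint (component T i)) ->
  boundary_integral rad (fun x => (dot2 (S x) (T x))%:E) = (rad * boundary_inner S T)%:E.
Proof.
move=> hS hT; rewrite /boundary_integral EFinM; congr (_ * _)%E.
have i0 := sqint_integrable_mul mD (hS ord0) (hT ord0).
have i1 := sqint_integrable_mul mD (hS ord_max) (hT ord_max).
rewrite /boundary_inner EFinD /circle_inner.
rewrite -(sqint_integral_mulE mD (hS ord0) (hT ord0)).
rewrite -(sqint_integral_mulE mD (hS ord_max) (hT ord_max)) -(integralD mD i0 i1).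
by apply: eq_integral => t _; rewrite /dot2 sum_ord2.
Qed.

Definition gradient u : R * R -> 'M[R]_2 := fun x => \matrix_(i, j) partial j (component u i) x.

Definition smooth_field u := forall i, smooth (component u i).

Lemma gradientE u i j : (fun x => gradient u x i j) = partial j (component u i).
Proof. by apply/funext => x; rewrite mxE. Qed.

Lemma smooth_grad_sqint u : smooth_field u -> grad_sqint (gradient u).
Proof. by move=> su i j; rewrite gradientE; apply: smooth_disk_sqint => //;
  exact: smooth_partial. Qed.

Lemma smooth_H1 u : smooth_field u -> H1 rad u (gradient u).
Proof.
move=> su i; split; first exact: smooth_disk_sqint.
move=> j; split; first exact: (smooth_grad_sqint su).
by rewrite gradientE; exact: smooth_weak_partial.
Qed.

Lemma L2_disk_cvg_cst (f : R * R -> R) : L2_disk_cvg rad (fun=> f) f.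
Proof.
rewrite /L2_disk_cvg (_ : (fun _ => _) = fun=> 0%E); first exact: cvg_cst.
by apply/funext => _; apply: integral0_eq => x _; rewrite subrr expr0n.
Qed.

Lemma L2_circle_cvg_cst (f : R * R -> R) : L2_circle_cvg rad (fun=> f) f.
Proof.
rewrite /L2_circle_cvg (_ : (fun _ => _) = fun=> 0%E); first exact: cvg_cst.
apply/funext => _; rewrite /boundary_integral integral0_eq ?mule0//.
by move=> x _; rewrite subrr expr0n.
Qed.

Lemma smooth_trace u : smooth_field u -> is_trace rad u (gradient u) u.
Proof.
move=> su; split; first by move=> i; apply/L2_circleE => //; exact: smooth_circle_sqint.
exists (fun=> u); split => // i; split; first exact: L2_disk_cvg_cst.
  by move=> j; rewrite gradientE; exact: L2_disk_cvg_cst.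
exact: L2_circle_cvg_cst.
Qed.

Lemma H1_grad_sqint u G : H1 rad u G -> grad_sqint G.
Proof. by move=> h i j; have [_ /(_ j) []] := h i. Qed.

Lemma H1_sqint u G : H1 rad u G -> forall i, disk_sqint (component u i).
Proof. by move=> h i; have [] := h i. Qed.

Lemma trace_sqint u G T : is_trace rad u G T -> forall i, circle_sqint (component T i).
Proof. by move=> [h _] i; apply/L2_circleE. Qed.

Lemma component_vec2 (a b : R * R -> R) :
  component (fun x => vec2 (a x) (b x)) ord0 = a /\
  component (fun x => vec2 (a x) (b x)) ord_max = b.
Proof. by split; apply/funext => x; rewrite /component mxE. Qed.

Lemma smooth_vec2 (a b : R * R -> R) : smooth a -> smooth b ->
  smooth_field (fun x => vec2 (a x) (b x)).
Proof.
move=> sa sb i; have [e0 e1] := component_vec2 a b.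
by case: (ord2_cases i) => ->; rewrite ?e0 ?e1.
Qed.

(* A row (s1, s2) of a divergence-free stress with traction [c * u] on the circle. *)
Lemma green_row (s1 s2 f w : R * R -> R) (c : R) :
  smooth s1 -> smooth s2 -> smooth f -> smooth w ->
  (forall x, partial ord0 s1 x + partial ord_max s2 x = 0) ->
  (forall x, x.1 ^+ 2 + x.2 ^+ 2 = rad ^+ 2 -> s1 x * x.1 + s2 x * x.2 = c * f x) ->
  disk_inner s1 (partial ord0 w) + disk_inner s2 (partial ord_max w) = c * circle_inner f w.
Proof.
move=> ss1 ss2 sf sw div0 tr.
have g1 := green1 rad0 ss1 sw; have g2 := green2 rad0 ss2 sw.
have q f' : smooth f' -> disk_sqint f' by exact: smooth_disk_sqint.
have z : disk_inner (partial ord0 s1) w + disk_inner (partial ord_max s2) w = 0.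
  rewrite -[LHS]innerDl//; try by apply: q => //; exact: smooth_partial.
  rewrite /inner (@eq_Rintegral _ _ _ _ _ (fun=> 0)) ?Rintegral_cst ?mul0r//.
  by move=> x _; rewrite div0 mul0r.
transitivity (rad * \int[leb]_(t in D) (s1 (circle_point rad t) * w (circle_point rad t) * cos t) +
  rad * \int[leb]_(t in D) (s2 (circle_point rad t) * w (circle_point rad t) * sin t)).
  by rewrite -g1 -g2 addrACA z add0r.
have c1 := continuous_circle (rad := rad) (smooth_continuous (smooth_mul ss1 sw)).
have c2 := continuous_circle (rad := rad) (smooth_continuous (smooth_mul ss2 sw)).
have c3 := continuous_circle (rad := rad) (smooth_continuous (smooth_mul sf sw)).
have d1 : continuous (fun t => s1 (circle_point rad t) * w (circle_point rad t) * cos t).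
  by move=> t; apply: cvgM; [exact: c1|exact: continuous_cos].
have d2 : continuous (fun t => s2 (circle_point rad t) * w (circle_point rad t) * sin t).
  by move=> t; apply: cvgM; [exact: c2|exact: continuous_sin].
have iq (g : R -> R) : continuous g -> leb.-integrable D (EFin \o (fun t => rad * g t)).
  by move=> cq; apply: continuous_integrable_itv => t; apply: cvgM; [exact: cvg_cst|exact: cq].
rewrite !integral_scale// -(RintegralD mD (iq _ d1) (iq _ d2)).
apply: eq_Rintegral => t _; rewrite /comp.
(* The unit normal is [(cos t, sin t)]; the factor [rad] turns it into the point, as the traction
   hypothesis requires. *)
have := tr (circle_point rad t); rewrite /= !exprMn -mulrDr cos2Dsin2 mulr1 => /(_ erefl) h.
by rewrite [RHS]mulrA -h; ring.
Qed.

(** Both sides are L2-continuous in the test function, so [green_row] passes to the limit along the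
    smooth sequence that defines the trace [h]. *)
Lemma green_row_weak (s1 s2 f g1 g2 h : R * R -> R) (w_ : nat -> R * R -> R) (c : R) :
  smooth s1 -> smooth s2 -> smooth f -> (forall k, smooth (w_ k)) ->
  (forall x, partial ord0 s1 x + partial ord_max s2 x = 0) ->
  (forall x, x.1 ^+ 2 + x.2 ^+ 2 = rad ^+ 2 -> s1 x * x.1 + s2 x * x.2 = c * f x) ->
  disk_sqint g1 -> disk_sqint g2 -> circle_sqint h ->
  L2_disk_cvg rad (fun k => partial ord0 (w_ k)) g1 ->
  L2_disk_cvg rad (fun k => partial ord_max (w_ k)) g2 ->
  L2_circle_cvg rad w_ h ->
  disk_inner s1 g1 + disk_inner s2 g2 = c * circle_inner f h.
Proof.
move=> ss1 ss2 sf sw div0 tr hg1 hg2 hh c1 c2 /(L2_circle_cvgE rad0) c3.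
have q f' : smooth f' -> disk_sqint f' by exact: smooth_disk_sqint.
have l1 := cvg_inner mdisk (fun k => q _ (smooth_partial (sw k) ord0)) hg1 (q _ ss1) c1.
have l2 := cvg_inner mdisk (fun k => q _ (smooth_partial (sw k) ord_max)) hg2 (q _ ss2) c2.
have l3 := cvg_inner mD (fun k => smooth_circle_sqint rad (sw k)) hh (smooth_circle_sqint rad sf)
  c3.
have dC a b : disk_inner a b = disk_inner b a by exact: innerC.
have lhs : (fun k => disk_inner s1 (partial ord0 (w_ k)) + disk_inner s2 (partial ord_max (w_ k)))
  @ \oo -->
    disk_inner s1 g1 + disk_inner s2 g2.
  rewrite (dC s1) (dC s2); under eq_fun do rewrite (dC s1) (dC s2).
  by apply: cvgD; [exact: l1|exact: l2].
have rhs : (fun k => c * circle_inner f (w_ k)) @ \oo --> c * circle_inner f h.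
  have cC a b : circle_inner a b = circle_inner b a by exact: innerC.
  by apply: cvgMr; rewrite cC; under eq_fun do rewrite cC; exact: l3.
have E : (fun k => disk_inner s1 (partial ord0 (w_ k)) + disk_inner s2 (partial ord_max (w_ k))) =
    (fun k => c * circle_inner f (w_ k)).
  by apply/funext => k; exact: green_row.
by rewrite E in lhs; exact: (cvg_unique _ lhs rhs).
Qed.

Lemma strong_eigen_weak (L : R) (f1 f2 : R * R -> R) : strong_eigen lam mu rad L f1 f2 ->
  let u := fun x => vec2 (f1 x) (f2 x) in
  forall v Gv Tv, H1 rad v Gv -> is_trace rad v Gv Tv ->
  energy (gradient u) Gv = L * (rad * boundary_inner u Tv).
Proof.
move=> [s1 s2 d1 d2 tr] u v Gv Tv hv tv.
have [p11 p12 p22] := smooth_stress lam mu s1 s2.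
have [e1 e2] := component_vec2 f1 f2.
have hG := H1_grad_sqint hv; have hT := trace_sqint tv.
have [_ [w [sw cw]]] := tv.
have [_ c0 b0] := cw ord0; have [_ c1 b1] := cw ord_max.
have r1 := green_row_weak p11 p12 s1 (fun k => sw k ord0) d1 (fun x hx => (tr x hx).1)
  (hG _ _) (hG _ _) (hT _) (c0 ord0) (c0 ord_max) b0.
have r2 := green_row_weak p12 p22 s2 (fun k => sw k ord_max) d2 (fun x hx => (tr x hx).2)
  (hG _ _) (hG _ _) (hT _) (c1 ord0) (c1 ord_max) b1.
have E11 : sigma11 (gradient u) = stress11 lam mu f1 f2.
  by apply/funext => x; rewrite /sigma11 /stress11 !mxE e1 e2.
have E12 : sigma12 (gradient u) = stress12 mu f1 f2.
  by apply/funext => x; rewrite /sigma12 /stress12 !mxE e1 e2.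
have E22 : sigma22 (gradient u) = stress22 lam mu f1 f2.
  by apply/funext => x; rewrite /sigma22 /stress22 !mxE e1 e2.
by rewrite /energy E11 E12 E22 r1 -addrA r2 /boundary_inner e1 e2; ring.
Qed.

End WeakForm.

Lemma eq_cvgn (V : topologicalType) (a b : nat -> V) (l : V) :
  (forall k, a k = b k) -> a @ \oo --> l -> b @ \oo --> l.
Proof. by move=> /funext ->. Qed.

#[global] Instance ae_filter_area (R : realType) : Filter (almost_everywhere (area R)).
Proof. exact: (ae_filter_ringOfSetsType (area R)). Qed.

(** * Spanning and linear independence of the modes *)

Section Eigenspaces.
Variables (R : realType) (lam mu rad : R).
Hypotheses (hmu : 0 < mu) (hlammu : 0 < lam + mu) (rad0 : 0 < rad).
Local Notation leb := (@lebesgue_measure R).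
Local Notation D := (`[0, 2 * pi]%classic : set (measurableTypeR R)).
Local Notation disk_inner := (disk_inner rad).
Local Notation circle_inner := (circle_inner rad).
Local Notation disk_sqint := (disk_sqint rad).
Local Notation circle_sqint := (circle_sqint rad).
Local Notation boundary_inner := (boundary_inner rad).
Local Notation energy := (energy lam mu rad).
Implicit Types (G H : R * R -> 'M[R]_2) (u v w S T : vfield R).

Let mdisk := @measurable_area_disk R rad.
Let mD : measurable D. Proof. exact: measurable_itv. Qed.

(** Replaces the extended-real integrals of the definition by real bilinear forms, all integrands
    being integrable. *)
Lemma lame_eigenspaceP L u : lame_eigenspace lam mu rad L u <->
  exists G T, [/\ H1 rad u G, is_trace rad u G T &
    forall v Gv Tv, H1 rad v Gv -> is_trace rad v Gv Tv ->
      energy G Gv = L * (rad * boundary_inner T Tv)].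
Proof.
split=> -[G [T [hu tu h]]]; exists G, T; split => // v Gv Tv hv tv; have := h v Gv Tv hv tv;
  rewrite (integral_energy _ _ (H1_grad_sqint hu) (H1_grad_sqint hv));
  rewrite (integral_boundary_dot (trace_sqint rad0 tu) (trace_sqint rad0 tv)).
  by rewrite -EFinM => e; exact: EFin_inj.
by move=> ->; rewrite EFinM.
Qed.

Lemma ae_eq_disk_component u v i : ae_eq_disk rad u v ->
  ae_eq (area R) (disk rad) (component u i) (component v i).
Proof. by apply: filterS => x h /h; rewrite /component => ->. Qed.

Lemma sqint_ae (f g : R * R -> R) : measurable_fun (disk rad) f ->
  ae_eq (area R) (disk rad) f g -> disk_sqint g -> disk_sqint f.
Proof.
move=> mf e [mg gi]; split => //; move: gi; apply: le_lt_trans.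
rewrite (@ge0_ae_eq_integral _ _ _ (area R) (disk rad) _ (fun x => (g x ^+ 2)%:E))//.
- by apply/measurable_EFinP; exact: measurable_funX.
- by apply/measurable_EFinP; exact: measurable_funX.
- by move=> x _; rewrite lee_fin sqr_ge0.
- by move=> x _; rewrite lee_fin sqr_ge0.
- by apply: filterS e => x h /h ->.
Qed.

Lemma weak_partialE (f g : R * R -> R) i : disk_sqint f -> disk_sqint g ->
  weak_partial rad i f g <-> forall phi, test_function rad phi ->
    disk_inner f (partial i phi) = - disk_inner g phi.
Proof.
move=> hf hg; split=> h phi tphi; have := h phi tphi; have [sphi _] := tphi;
  have q1 := smooth_disk_sqint rad0 sphi;
  have q2 := smooth_disk_sqint rad0 (smooth_partial sphi i);
  rewrite (sqint_integral_mulE mdisk hf q2) (sqint_integral_mulE mdisk hg q1).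
  by rewrite -EFinN => e; exact: EFin_inj.
by move=> e; rewrite -EFinN; congr EFin; exact: e.
Qed.

Lemma H1_ae u v G : measurable_field rad u -> ae_eq_disk rad u v -> H1 rad v G -> H1 rad u G.
Proof.
move=> mu' e hv i; have [hvi hG] := hv i; have ei := ae_eq_disk_component i e.
have hui : disk_sqint (component u i) by exact: sqint_ae ei hvi.
split => // j; have [hGj wG] := hG j; split => //.
apply/(weak_partialE _ hui hGj) => phi tphi.
rewrite -((weak_partialE j hvi hGj).1 wG phi tphi); apply: inner_ae => //.
by apply: smooth_disk_sqint => //; apply: smooth_partial; case: tphi.
Qed.

Lemma trace_ae u v G T : measurable_field rad u -> ae_eq_disk rad u v ->
  is_trace rad v G T -> H1 rad v G -> is_trace rad u G T.
Proof.
move=> mu' e [hT [w [sw cw]]] hv; split => //; exists w; split => // i.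
have [c0 c1 c2] := cw i; split => //; have ei := ae_eq_disk_component i e.
have [hvi _] := hv i; have hui : disk_sqint (component u i) by exact: sqint_ae ei hvi.
apply: eq_cvgn c0 => k.
have hw := smooth_disk_sqint rad0 (sw k i).
apply: ae_eq_integral => //.
- by have [mf _] := sqintB mdisk hw hvi; apply/measurable_EFinP; exact: measurable_funX.
- by have [mf _] := sqintB mdisk hw hui; apply/measurable_EFinP; exact: measurable_funX.
- by apply: filterS ei => x h /h /= ->.
Qed.

Lemma strong_eigen_lame L f1 f2 u : strong_eigen lam mu rad L f1 f2 ->
  measurable_field rad u -> ae_eq_disk rad u (fun x => vec2 (f1 x) (f2 x)) ->
  lame_eigenspace lam mu rad L u.
Proof.
move=> sf mu' e; have [s1 s2 _ _ _] := sf; have sv := smooth_vec2 s1 s2.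
apply/lame_eigenspaceP; exists (gradient (fun x => vec2 (f1 x) (f2 x))), (fun x => vec2 (f1 x)
  (f2 x)).
have h1 := smooth_H1 rad0 sv; split.
- exact: H1_ae h1.
- by apply: trace_ae e _ h1 => //; exact: smooth_trace.
- exact: strong_eigen_weak.
Qed.

Lemma component_sub u v i : component (fun x => u x - v x) i =
  fun x => component u i x - component v i x.
Proof. by apply/funext => x; rewrite /component !mxE. Qed.

Lemma H1_sub u v G H : H1 rad u G -> H1 rad v H ->
  H1 rad (fun x => u x - v x) (fun x => G x - H x).
Proof.
move=> hu hv i; have [ui gi] := hu i; have [vi hi] := hv i.
have s := sqintB mdisk ui vi; rewrite component_sub; split => // j.
have [gij wg] := gi j; have [hij wh] := hi j.
have -> : (fun x => (G x - H x) i j) = fun x => G x i j - H x i j.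
  by apply/funext => x; rewrite !mxE.
have s' := sqintB mdisk gij hij; split => //; apply/(weak_partialE _ s s') => phi tphi.
have [sphi _] := tphi; have q1 := smooth_disk_sqint rad0 sphi.
have q2 := smooth_disk_sqint rad0 (smooth_partial sphi j).
rewrite /disk_inner !innerBl//.
have := (weak_partialE j ui gij).1 wg phi tphi; rewrite /disk_inner => ->.
have := (weak_partialE j vi hij).1 wh phi tphi; rewrite /disk_inner => ->.
by rewrite opprB opprK addrC.
Qed.

(** Subtracting the smooth field [v] from the approximating fields leaves all three errors
    unchanged. *)
Lemma trace_sub u v G T : is_trace rad u G T -> smooth_field v ->
  is_trace rad (fun x => u x - v x) (fun x => G x - gradient v x) (fun x => T x - v x).
Proof.
move=> [hT [w [sw cw]]] sv; split.
  move=> i; rewrite component_sub; apply/(L2_circleE rad0).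
  apply: (sqintB mD); first exact/(L2_circleE rad0).
  exact: smooth_circle_sqint.
exists (fun k x => w k x - v x); split.
  by move=> k i; rewrite component_sub; exact: smooth_sub.
move=> i; have [c0 c1 c2] := cw i.
have cE k : component (fun x => w k x - v x) i = fun x => component (w k) i x - component v i x.
  exact: component_sub.
split.
- apply: eq_cvgn c0 => k.
  by apply: eq_integral => x _; rewrite cE component_sub; congr (_ ^+ _)%:E; ring.
- move=> j; apply: eq_cvgn (c1 j) => k.
  apply: eq_integral => x _; congr (_ ^+ _)%:E.
  rewrite cE partial_add; [|exact: smooth_derivable|apply: smooth_derivable; exact: smooth_opp].
  by rewrite partial_opp// !mxE; ring.
- apply: eq_cvgn c2 => k; congr (_ * _)%E; apply: eq_integral => t _; rewrite cE component_sub;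
    congr (_ ^+ _)%:E; ring.
Qed.

(** The off-diagonal part is [mu] times the square norm of [b + c], hence nonnegative. The diagonal
    part is [2 * mu] times the sum of the square norms of [a] and [d], plus [lam] times that of
    [a + d]. *)
Lemma energy_coercive G : grad_sqint rad G -> exists2 c, 0 < c &
  c * (disk_inner (fun x => G x ord0 ord0) (fun x => G x ord0 ord0) +
       disk_inner (fun x => G x ord_max ord_max) (fun x => G x ord_max ord_max)) <= energy G G.
Proof.
move=> hG; set a := fun x => G x ord0 ord0; set d := fun x => G x ord_max ord_max.
set b := fun x => G x ord0 ord_max; set c := fun x => G x ord_max ord0.
have ha : disk_sqint a := hG _ _; have hb : disk_sqint b := hG _ _.
have hc : disk_sqint c := hG _ _; have hd : disk_sqint d := hG _ _.
have iC f g : disk_inner f g = disk_inner g f by exact: innerC.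
have e11 : disk_inner (sigma11 lam mu G) a = (2 * mu + lam) * disk_inner a a + lam * disk_inner a d.
  rewrite (_ : sigma11 lam mu G = fun x => (2 * mu + lam) * a x + lam * d x)//.
  by rewrite (iC a d) /disk_inner innerDl ?innerZl//; exact: sqintZ.
have e22 : disk_inner (sigma22 lam mu G) d = lam * disk_inner a d + (2 * mu + lam) * disk_inner d d.
  rewrite (_ : sigma22 lam mu G = fun x => lam * a x + (2 * mu + lam) * d x)//.
  by rewrite /disk_inner innerDl ?innerZl//; exact: sqintZ.
have e12 : disk_inner (sigma12 mu G) b = mu * (disk_inner b b + disk_inner b c).
  rewrite (_ : sigma12 mu G = fun x => mu * (b x + c x))//.
  by rewrite (iC b c) /disk_inner innerZl ?innerDl//; exact: sqintD.
have e21 : disk_inner (sigma12 mu G) c = mu * (disk_inner b c + disk_inner c c).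
  rewrite (_ : sigma12 mu G = fun x => mu * (b x + c x))//.
  by rewrite /disk_inner innerZl ?innerDl//; exact: sqintD.
rewrite /energy -/a -/b -/c -/d e11 e12 e21 e22.
have p1 : 0 <= disk_inner b b + 2 * disk_inner b c + disk_inner c c.
  by rewrite -inner_sqrD// inner_ge0.
have p2 : 0 <= disk_inner a a + 2 * disk_inner a d + disk_inner d d.
  by rewrite -inner_sqrD// inner_ge0.
have p3 : 0 <= disk_inner a a - 2 * disk_inner a d + disk_inner d d.
  by rewrite -inner_sqrB// inner_ge0.
have q1 := mulr_ge0 (ltW hmu) p1.
have pa : 0 <= disk_inner a a := inner_ge0 _ _ _.
have pd : 0 <= disk_inner d d := inner_ge0 _ _ _.
(* For negative [lam], the square norm of [a + d] is at most twice the sum of those of [a] and [d],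
   which leaves [2 * (lam + mu)]. *)
have [l0|l0] := leP 0 lam.
  by exists (2 * mu); [rewrite mulr_gt0|have := mulr_ge0 l0 p2; nra].
exists (2 * (lam + mu)); first by rewrite mulr_gt0.
have q2 : lam * (disk_inner a a - 2 * disk_inner a d + disk_inner d d) <= 0.
  by rewrite nmulr_rle0.
lra.
Qed.

(** The real Fourier coefficients of [T] as a complex function of the angle: up to normalization,
    real parts for [b = false] and imaginary parts for [b = true]. *)
Definition circle_pair T (k : int) (b : bool) : R :=
  inner leb D (component T ord0 \o circle_point rad) (fun t => (profile k b t).1) +
  inner leb D (component T ord_max \o circle_point rad) (fun t => (profile k b t).2).

(** For each [n] the frequencies [n] and [- n] in both phases give four equations in the cosine and
    sine integrals of the two components; their solution is zero, and completeness applies to each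
    component. *)
Lemma circle_pair_complete T : (forall i, circle_sqint (component T i)) ->
  (forall k b, circle_pair T k b = 0) -> forall i, circle_inner (component T i) (component T i) = 0.
Proof.
move=> hT h0 i.
pose f j := component T j \o circle_point rad.
have innN j (g : R -> R) : continuous g -> inner leb D (f j)
  (fun t => - g t) = - inner leb D (f j) g.
  move=> cg; have sg := continuous_sqint_itv 0 (2 * pi) cg.
  have -> : (fun t => - g t) = fun t => (-1) * g t by apply/funext => t; rewrite mulN1r.
  by rewrite innerC (innerZl mD _ sg (hT j)) mulN1r innerC.
have key (n : nat) j : inner leb D (f j) (fun t => cos (n%:R * t)) = 0 /\
    inner leb D (f j) (fun t => sin (n%:R * t)) = 0.
  have cs := @continuous_sink R n%:R.
  have e1 : inner leb D (f ord0) (fun t => cos (n%:R * t)) +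
            inner leb D (f ord_max) (fun t => sin (n%:R * t)) = 0 := h0 n false.
  have e2 : - inner leb D (f ord0) (fun t => sin (n%:R * t)) +
            inner leb D (f ord_max) (fun t => cos (n%:R * t)) = 0.
    by rewrite -innN//; exact: (h0 n true).
  have e3 := h0 (- n%:Z) false; have e4 := h0 (- n%:Z) true.
  rewrite /circle_pair /profile /= in e3 e4.
  have nE (t : R) : (- n%:Z)%:~R * t = - (n%:R * t) by rewrite intrN mulNr.
  have cE : (fun t : R => cos ((- n%:Z)%:~R * t)) = fun t => cos (n%:R * t).
    by apply/funext => t; rewrite nE cosN.
  have sE : (fun t : R => sin ((- n%:Z)%:~R * t)) = fun t => - sin (n%:R * t).
    by apply/funext => t; rewrite nE sinN.
  have sE' : (fun t : R => - sin ((- n%:Z)%:~R * t)) = fun t => sin (n%:R * t).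
    by apply/funext => t; rewrite nE sinN opprK.
  rewrite cE sE innN// in e3; rewrite cE sE' in e4.
  by have [->|->] := ord2_cases j; split; rewrite /f; lra.
have := fourier_complete (hT i) (fun n => (key n i).1) (fun n => (key n i).2).
move=> e; rewrite /circle_inner (inner_ae mD (hT i) (sqint0 leb D) (hT i) e).
rewrite /inner (@eq_Rintegral _ _ _ _ _ (fun=> 0)) ?Rintegral_cst ?mul0r//.
by move=> t _; rewrite mul0r.
Qed.

Definition cartesian_mode m : vfield R := fun x => vec2 (mode_x lam mu rad m x)
  (mode_y lam mu rad m x).

Lemma smooth_cartesian_mode m : admissible m -> smooth_field (cartesian_mode m).
Proof.
by move=> am; have [s1 s2 _ _ _] := strong_mode hmu hlammu rad0 am; exact: smooth_vec2.
Qed.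

Lemma boundary_inner_mode T m : (forall i, circle_sqint (component T i)) -> admissible m ->
  boundary_inner T (cartesian_mode m) = amplitude lam mu rad m * circle_pair T (frequency m)
    (phase m).
Proof.
move=> hT am; have [e0 e1] := component_vec2 (mode_x lam mu rad m) (mode_y lam mu rad m).
have [c0 c1] := continuous_profile R (frequency m) (phase m).
have s0 := continuous_sqint_itv 0 (2 * pi) c0; have s1 := continuous_sqint_itv 0 (2 * pi) c1.
have A j (p : R -> R) (q : R * R -> R) : sqint leb D p ->
    (forall t, q (circle_point rad t) = amplitude lam mu rad m * p t) ->
    circle_inner (component T j) q =
    amplitude lam mu rad m * inner leb D (component T j \o circle_point rad) p.
  move=> sp qE; rewrite [in RHS]innerC -(innerZl mD _ sp (hT j)) innerC.
  by apply: eq_Rintegral => t _; rewrite /= qE.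
rewrite /boundary_inner /cartesian_mode e0 e1 /circle_pair mulrDr.
congr (_ + _); apply: A => // t.
  exact: (mode_boundary rad hlammu t am).1.
exact: (mode_boundary rad hlammu t am).2.
Qed.

Lemma circle_pair_mode m k b : admissible m ->
  circle_pair (cartesian_mode m) k b =
  amplitude lam mu rad m * \int[leb]_(t in D) pdot (profile (frequency m) (phase m) t)
    (profile k b t).
Proof.
move=> am; have [e0 e1] := component_vec2 (mode_x lam mu rad m) (mode_y lam mu rad m).
have [c0 c1] := continuous_profile R (frequency m) (phase m).
have [d0 d1] := continuous_profile R k b.
have s0 := continuous_sqint_itv 0 (2 * pi) c0; have s1 := continuous_sqint_itv 0 (2 * pi) c1.
have r0 := continuous_sqint_itv 0 (2 * pi) d0; have r1 := continuous_sqint_itv 0 (2 * pi) d1.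
rewrite /pdot RintegralD//; try exact: (sqint_integrable_mul mD).
rewrite mulrDr /circle_pair /cartesian_mode e0 e1.
have A (p q : R -> R) (f : R * R -> R) : sqint leb D p -> sqint leb D q ->
    (forall t, f (circle_point rad t) = amplitude lam mu rad m * p t) ->
    inner leb D (f \o circle_point rad) q = amplitude lam mu rad m * inner leb D p q.
  move=> sp sq fE; rewrite -(innerZl mD _ sp sq).
  by apply: eq_Rintegral => t _; rewrite /= fE.
congr (_ + _); apply: A => // t.
  exact: (mode_boundary rad hlammu t am).1.
exact: (mode_boundary rad hlammu t am).2.
Qed.

Lemma circle_pair_mode_self m : admissible m ->
  circle_pair (cartesian_mode m) (frequency m) (phase m) = amplitude lam mu rad m * (2 * pi).
Proof.
move=> am; rewrite circle_pair_mode//; congr (_ * _).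
under eq_Rintegral do rewrite pdot_profile_diag.
rewrite -[RHS]subr0; apply: (@integral_is_derive _ _ id).
- by rewrite mulr_ge0// pi_ge0.
- by move=> t; exact: cvg_cst.
Qed.

Lemma circle_pair_mode_neq m m' : admissible m -> admissible m' -> m <> m' ->
  circle_pair (cartesian_mode m) (frequency m') (phase m') = 0.
Proof.
move=> am am' mm'; rewrite circle_pair_mode// integral_pdot_profile ?mulr0//.
by apply/eqP => -[e1 e2]; apply: mm'; exact: (frequency_inj am am' e1 e2).
Qed.

Lemma mode_neq0_pair m : admissible m -> circle_pair (cartesian_mode m) (frequency m)
  (phase m) != 0.
Proof.
move=> am; rewrite circle_pair_mode_self// mulf_neq0//; first exact: amplitude_neq0.
by rewrite mulf_neq0// gt_eqF// pi_gt0.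
Qed.

Lemma lin_comb_modes L k (c : 'I_k -> R) (M : 'I_k -> mode) :
  (forall i, admissible (M i) /\ mode_value lam mu rad (M i) = L) ->
  lin_comb c (fun i => mode_field lam mu rad (M i)) =
    (fun x => vec2 (\sum_(i < k) c i * mode_x lam mu rad (M i) x)
                   (\sum_(i < k) c i * mode_y lam mu rad (M i) x)) /\
  strong_eigen lam mu rad L (fun x => \sum_(i < k) c i * mode_x lam mu rad (M i) x)
                            (fun x => \sum_(i < k) c i * mode_y lam mu rad (M i) x).
Proof.
move=> hM; split.
  apply/funext => x; apply/matrixP => i j; rewrite /lin_comb summxE !mxE.
  case: ifP => i0; apply: eq_bigr => l _; rewrite (mode_fieldE rad hlammu (hM l).1) !mxE i0//.
elim: k c M hM => [|k IH] c M hM.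
  have -> : (fun x => \sum_(i < 0) c i * mode_x lam mu rad (M i) x) = fun=> 0.
    by apply/funext => x; rewrite big_ord0.
  have -> : (fun x => \sum_(i < 0) c i * mode_y lam mu rad (M i) x) = fun=> 0.
    by apply/funext => x; rewrite big_ord0.
  exact: strong_eigen0.
have [am vm] := hM ord0; have hs := strong_mode hmu hlammu rad0 am; rewrite vm in hs.
have := strong_eigen_lin (c ord0) hs (IH (fun i => c (lift ord0 i)) _ (fun i => hM (lift ord0 i))).
congr strong_eigen; apply/funext => x; by rewrite big_ord_recl.
Qed.

Lemma circle_pair_lin k (c : 'I_k -> R) (U : 'I_k -> vfield R) j b :
  (forall i, smooth_field (U i)) ->
  circle_pair (lin_comb c U) j b = \sum_(i < k) c i * circle_pair (U i) j b.
Proof.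
move=> sU; have [d0 d1] := continuous_profile R j b.
have r0 := continuous_sqint_itv 0 (2 * pi) d0; have r1 := continuous_sqint_itv 0 (2 * pi) d1.
have hU i l : circle_sqint (component (U i) l) := smooth_circle_sqint rad (sU i l).
have E l q : sqint leb D q -> inner leb D (component (lin_comb c U) l \o circle_point rad) q =
    \sum_(i < k) c i * inner leb D (component (U i) l \o circle_point rad) q.
  move=> sq; transitivity (inner leb D (fun t => \sum_(i < k) c i * component (U i) l (circle_point
    rad t)) q).
    apply: eq_Rintegral => t _; congr (_ * _); rewrite /component /lin_comb /= summxE.
    by apply: eq_bigr => i _; rewrite mxE.
  rewrite (inner_sum mD)//; last by move=> i; apply: (sqintZ mD); exact: hU.
  by apply: eq_bigr => i _; rewrite (innerZl mD _ (hU i l) sq).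
by rewrite /circle_pair !E// -big_split/=; apply: eq_bigr => i _; rewrite [RHS]mulrDr.
Qed.

Lemma circle_pair_sub S T j b : (forall i, circle_sqint (component S i)) ->
  (forall i, circle_sqint (component T i)) ->
  circle_pair (fun x => S x - T x) j b = circle_pair S j b - circle_pair T j b.
Proof.
move=> hS hT; have [d0 d1] := continuous_profile R j b.
have r0 := continuous_sqint_itv 0 (2 * pi) d0; have r1 := continuous_sqint_itv 0 (2 * pi) d1.
have E l q : sqint leb D q -> inner leb D (component (fun x => S x - T x) l \o circle_point rad) q =
    inner leb D (component S l \o circle_point rad) q - inner leb D (component T l \o circle_point
      rad) q.
  by move=> sq; rewrite component_sub -(innerBl mD (hS l) (hT l) sq).
by rewrite /circle_pair !E//; ring.
Qed.

(* Testing the eigenfunction with the mode and the mode with the eigenfunction gives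
   [(L - mode_value m) * boundary_inner T (cartesian_mode m) = 0]. *)
Lemma eigenfunction_pair0 L u G T m : H1 rad u G -> is_trace rad u G T ->
  (forall v Gv Tv, H1 rad v Gv -> is_trace rad v Gv Tv ->
    energy G Gv = L * (rad * boundary_inner T Tv)) ->
  admissible m -> mode_value lam mu rad m <> L -> circle_pair T (frequency m) (phase m) = 0.
Proof.
move=> hu tu h am /eqP mL; have sm := smooth_cartesian_mode am.
have hm := smooth_H1 rad0 sm; have tm := smooth_trace rad0 sm.
have e1 := h _ _ _ hm tm.
have e2 := strong_eigen_weak rad0 (strong_mode hmu hlammu rad0 am) hu tu.
rewrite -/(cartesian_mode m) in e2.
rewrite (energyC _ _ (H1_grad_sqint hu) (H1_grad_sqint hm)) e2 in e1.
have bC : boundary_inner (cartesian_mode m) T = boundary_inner T (cartesian_mode m).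
  by congr (_ + _); exact: innerC.
have a0 := amplitude_neq0 hmu hlammu rad0 am.
move: e1; rewrite bC (boundary_inner_mode (trace_sqint rad0 tu) am) => /eqP.
rewrite -subr_eq0 -mulrBl !mulf_eq0 subr_eq0 (negbTE mL) (negbTE a0) (gt_eqF rad0).
by move=> /eqP.
Qed.

(** [M] lists all modes of value [L] without repetition: a mode outside the list has another value
    and pairs to zero with the trace, while a listed one is matched by its coefficient. *)
Lemma eigen_span L k (M : 'I_k -> mode) u : injective M ->
  (forall i, admissible (M i) /\ mode_value lam mu rad (M i) = L) ->
  (forall m, admissible m -> mode_value lam mu rad m = L -> exists i, M i = m) ->
  lame_eigenspace lam mu rad L u ->
  exists c : 'I_k -> R, ae_eq_disk rad u (lin_comb c (fun i => mode_field lam mu rad (M i))).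
Proof.
move=> injM hM surjM /lame_eigenspaceP[G [T [hu tu h]]].
(* The Fourier coefficient of the trace divided by that of the mode itself, see
   [circle_pair_mode_self]. *)
pose c i := circle_pair T (frequency (M i)) (phase (M i)) / (amplitude lam mu rad (M i) * (2 * pi)).
exists c.
have [lE sV] := lin_comb_modes c hM; set V := (X in _ = X) in lE; rewrite lE.
have svV : smooth_field V by case: sV => s1 s2 _ _ _; exact: smooth_vec2.
have VE : V = lin_comb c (fun i => cartesian_mode (M i)).
  rewrite -lE /lin_comb; apply/funext => x; apply: eq_bigr => i _.
  by rewrite (mode_fieldE rad hlammu (hM i).1).
have hT := trace_sqint rad0 tu.
have hV i : circle_sqint (component V i) := smooth_circle_sqint rad (svV i).
have tw := trace_sub tu svV; have hw := H1_sub hu (smooth_H1 rad0 svV).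
have hTw := trace_sqint rad0 tw.
have p0 j b : circle_pair (fun x => T x - V x) j b = 0.
  rewrite circle_pair_sub// VE circle_pair_lin; last first.
    by move=> i; apply: smooth_cartesian_mode; case: (hM i).
  have [m [am <- <-]] := mode_of_frequency j b.
  have [mL|mL] := pselect (mode_value lam mu rad m = L); last first.
    rewrite (eigenfunction_pair0 hu tu h am mL) big1 ?subrr// => i _.
    have [ai vi] := hM i; rewrite circle_pair_mode_neq ?mulr0// => e.
    by apply: mL; rewrite -e.
  have [i im] := surjM _ am mL; rewrite (bigD1 i)//= big1 ?addr0; last first.
    move=> l li; have [al vl] := hM l; rewrite circle_pair_mode_neq ?mulr0// => e.
    by move/eqP : li; apply; apply: injM; rewrite im.
  rewrite im /c im circle_pair_mode_self// divfK ?subrr//.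
  have a0 := amplitude_neq0 hmu hlammu rad0 am.
  have pi0 : pi != 0 :> R by rewrite gt_eqF ?pi_gt0.
  by rewrite mulf_neq0// mulf_neq0.
have T0 := circle_pair_complete hTw p0.
have b0 S : (forall i, circle_sqint (component S i)) -> boundary_inner S (fun x => T x - V x) = 0.
  move=> hS; have zi i : circle_inner (component S i) (component (fun x => T x - V x) i) = 0.
    by rewrite /circle_inner innerC; exact: (inner_eq0l mD (hTw i) (hS i) (T0 i)).
  by rewrite /boundary_inner !zi addr0.
have gV := smooth_grad_sqint rad0 svV.
have gu := H1_grad_sqint hu; have gw := H1_grad_sqint hw.
(* The weak equations of [u] and of [V] are both tested with [u - V]; its trace is zero, so both
   boundary terms vanish. *)
have E0 : energy (fun x => G x - gradient V x) (fun x => G x - gradient V x) = 0.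
  rewrite energyBl// (h _ _ _ hw tw) (strong_eigen_weak rad0 sV hw tw) -/V.
  by rewrite !b0// !mulr0 subrr.
have [k0 k0gt0] := energy_coercive gw; rewrite E0.
set g0 := disk_inner _ _; set g1 := disk_inner _ _ => ge.
have g00 : 0 <= g0 by exact: inner_ge0. have g10 : 0 <= g1 by exact: inner_ge0.
have gsum : g0 + g1 <= 0 by rewrite -(pmulr_rle0 _ k0gt0).
have z0 : g0 = 0 by lra. have z1 : g1 = 0 by lra.
have [_ [w_ [sw cw]]] := tw.
(* Component [i] uses only its own derivative [d_i], one of the two diagonal entries just shown to
   vanish. *)
have w0 i : disk_inner (component (fun x => u x - V x) i) (component (fun x => u x - V x) i) = 0.
  have [c0 cp cc] := cw i.
  apply: (zero_trace_eq0 rad0 (fun k => sw k i) (H1_sqint hw i) (gw i i)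
    (hTw i) _ (T0 i) c0 (cp i) cc).
  by have [->|->] := ord2_cases i.
have ae0 := inner_eq0_ae mdisk (H1_sqint hw ord0) (w0 ord0).
have ae1 := inner_eq0_ae mdisk (H1_sqint hw ord_max) (w0 ord_max).
move: ae0 ae1; apply: filterS2 => x h0 h1 xd.
apply/eqP; rewrite -subr_eq0; apply/eqP/matrixP => i j.
rewrite (ord1 j) [RHS]mxE; have [->|->] := ord2_cases i; first exact: h0.
exact: h1.
Qed.

(** A smooth combination that is zero almost everywhere on the disk has zero boundary values by
    [smooth_ae0_circle]; pairing with the profile of [M i] isolates [c i], because distinct modes
    have distinct profiles. *)
Lemma modes_free L k (M : 'I_k -> mode) (c : 'I_k -> R) : injective M ->
  (forall i, admissible (M i) /\ mode_value lam mu rad (M i) = L) ->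
  ae_eq_disk rad (lin_comb c (fun i => mode_field lam mu rad (M i))) (fun=> 0) ->
  forall i, c i = 0.
Proof.
move=> injM hM.
have [lE sV] := lin_comb_modes c hM; set V := (X in _ = X) in lE; rewrite lE.
have svV : smooth_field V by case: sV => s1 s2 _ _ _; exact: smooth_vec2.
have VE : V = lin_comb c (fun i => cartesian_mode (M i)).
  rewrite -lE /lin_comb; apply/funext => x; apply: eq_bigr => i _.
  by rewrite (mode_fieldE rad hlammu (hM i).1).
move=> V0 i.
have z l : circle_inner (component V l) (component V l) = 0.
  apply: smooth_ae0_circle => //.
  have sl := smooth_disk_sqint rad0 (svV l).
  have e : ae_eq (area R) (disk rad) (component V l) (fun=> 0).
    by apply: filterS V0 => x h /h; rewrite /component => ->; rewrite mxE.
  have := inner_ae mdisk sl (sqint0 (area R) (disk rad)) sl e; rewrite /disk_inner => ->.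
  rewrite /inner (@eq_Rintegral _ _ _ _ _ (fun=> 0)) ?Rintegral_cst ?mul0r//.
  by move=> x _; rewrite mul0r.
have [ai vi] := hM i.
have [d0 d1] := continuous_profile R (frequency (M i)) (phase (M i)).
have r0 := continuous_sqint_itv 0 (2 * pi) d0; have r1 := continuous_sqint_itv 0 (2 * pi) d1.
have hV l : circle_sqint (component V l) := smooth_circle_sqint rad (svV l).
have pV : circle_pair V (frequency (M i)) (phase (M i)) = 0.
  rewrite /circle_pair (inner_eq0l mD (hV ord0) r0 (z ord0)).
  by rewrite (inner_eq0l mD (hV ord_max) r1 (z ord_max)) addr0.
move: pV; rewrite VE circle_pair_lin; last first.
  by move=> l; apply: smooth_cartesian_mode; case: (hM l).
rewrite (bigD1 i)//= big1 ?addr0; last first.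
  move=> l li; have [al vl] := hM l; rewrite circle_pair_mode_neq ?mulr0// => e.
  by move/eqP : li; apply; exact: injM.
by move/eqP; rewrite mulf_eq0 (negbTE (mode_neq0_pair ai)) orbF => /eqP.
Qed.

End Eigenspaces.

(** * The spectrum *)

Lemma exists_argmin_nat (R : realType) (g : nat -> R) (n : nat) :
  exists2 j, (j <= n)%N & forall i, (i <= n)%N -> g j <= g i.
Proof.
elim: n => [|n [j jn jmin]]; first by exists 0%N => // -[].
have [h|h] := leP (g j) (g n.+1).
  by exists j; [exact: leqW|move=> i; rewrite leq_eqVlt => /predU1P[->//|/jmin]].
exists n.+1 => // i; rewrite leq_eqVlt => /predU1P[->//|/jmin].
by apply: le_trans; exact: ltW.
Qed.

(** * Sorted enumeration of an infinite family with finite sublevel sets *)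

Section SortedEnumeration.
Variables (R : realType) (T : pointedType) (A : set T) (V : T -> R).
Hypothesis finV : forall c, finite_set (A `&` [set x | V x <= c]).
Hypothesis infA : infinite_set A.

(** Any remaining element [x0] cuts out a finite sublevel set, and a minimum over this set is a
    minimum over everything that remains. *)
Lemma exists_argmin_setD (F : set T) : finite_set F ->
  exists x, (A `\` F) x /\ forall y, (A `\` F) y -> V x <= V y.
Proof.
move=> finF; have [x0 Fx0] : (A `\` F) !=set0 by apply: infinite_setN0; exact: infinite_setD.
pose B := (A `&` [set x | V x <= V x0]) `\` F.
have [n] : finite_set B by apply: sub_finite_set (finV (V x0)) => x [].
rewrite card_eq_sym => /card_set_bijP[f [fB finj fsurj]].
have Bx0 : B x0 by case: Fx0 => ? ?; do !split => //=.
have [i0 i0n fi0] := fsurj _ Bx0.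
case: n fB finj fsurj i0n => [//|n] fB finj fsurj i0n.
have [j jn jmin] := exists_argmin_nat (V \o f) n.
exists (f j); have [[Afj Vfj] Ffj] := fB j jn; split => // y [Ay Fy].
have [Vy|Vy] := leP (V y) (V x0); last exact: le_trans Vfj (ltW Vy).
have [i ilt <-] : (f @` `I_n.+1) y by apply: fsurj.
exact: jmin.
Qed.

Let next (F : set T) : T := xget point [set x | (A `\` F) x /\ forall y, (A `\` F) y -> V x <= V y].

Let nextP F : finite_set F -> (A `\` F) (next F) /\ forall y, (A `\` F) y -> V (next F) <= V y.
Proof. by move=> /exists_argmin_setD[x xP]; rewrite /next; case: xgetP => [y _ //|/(_ x)]. Qed.

Let Fixpoint used (n : nat) : set T := if n is m.+1 then used m `|` [set next (used m)] else set0.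

(** Greedy choice: [sigma n] minimizes [V] outside the set [used n] of earlier choices. *)
Lemma sorted_enumeration : exists sigma : nat -> T,
  set_bij setT A sigma /\ nondecreasing_seq (V \o sigma).
Proof.
have finU n : finite_set (used n).
  by elim: n => [|n IH] /=; [exact: finite_set0|rewrite finite_setU; split].
pose sigma n := next (used n).
have usedP n x : used n x <-> exists2 i, (i < n)%N & sigma i = x.
  elim: n => [|n IH] /=; first by split => // -[].
  split=> [[/IH[i ni <-]|->]|[i]].
  - by exists i => //; exact: ltnW.
  - by exists n.
  - by rewrite ltnS leq_eqVlt => /predU1P[->|ni] e; [right; rewrite -e|left; apply/IH; exists i].
have sA n : A (sigma n) by have [[]] := nextP (finU n).
have sN i n : (i < n)%N -> sigma i <> sigma n.
  by move=> ni e; have [[_ +] _] := nextP (finU n); apply; apply/usedP; exists i.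
have sinj : injective sigma.
  by move=> i j e; have [/sN|/sN + |//] := ltngtP i j; rewrite e.
exists sigma; split; last first.
  apply/nondecreasing_seqP => n; have [_] := nextP (finU n); apply; split; first exact: sA.
  by move=> /usedP[i ni e]; exact: (sN i n.+1 (ltnW ni) e).
split=> //; first by move=> i j _ _; exact: sinj.
(* An element never chosen would bound every chosen value from above, and the injective [sigma]
   would map all of [nat] into a finite sublevel set. *)
move=> x Ax; apply: contrapT => xN.
have xU n : (A `\` used n) x by split => // /usedP[i _ e]; apply: xN; exists i.
have : finite_set (sigma @^-1` (A `&` [set y | V y <= V x])).
  by apply: finite_preimage => // i j _ _; exact: sinj.
suff -> : sigma @^-1` (A `&` [set y | V y <= V x]) = setT by exact: infinite_nat.
apply/seteqP; split => // n _; split; first exact: sA.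
by have [_] := nextP (finU n); apply.
Qed.

End SortedEnumeration.

(** [sorted_enumeration] asks for a pointed type, whose point is the default of its choice function;
    [Rotation] is arbitrary. *)
HB.instance Definition _ := gen_eqMixin mode.
HB.instance Definition _ := gen_choiceMixin mode.
HB.instance Definition _ := isPointed.Build mode Rotation.

(** * Uniqueness of the dimension modulo null sets *)

Section Dimension.
Variables (R : realType) (rad : R).
Implicit Types (E : set (vfield R)).

Lemma ae_eq_disk_sum k (c : 'I_k -> R) (f g : 'I_k -> vfield R) :
  (forall i, ae_eq_disk rad (f i) (g i)) -> ae_eq_disk rad (lin_comb c f) (lin_comb c g).
Proof.
move=> fg; have h : \forall x \ae area R, forall i, disk rad x -> f i x = g i x.
  exact: filter_forall.
apply: filterS h => x h xd; rewrite /lin_comb.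
by apply: eq_bigr => i _; rewrite h.
Qed.

(** If [m < m'], the matrix of coordinates of [b'] in terms of [b] has more rows than columns; a
    nonzero vector of its left kernel is a linear relation among the [b']. *)
Lemma has_dimension_le E m m' : has_dimension rad E m -> has_dimension rad E m' -> (m' <= m)%N.
Proof.
move=> [b [Eb _ gen]] [b' [Eb' free' _]].
have /choice[a ha] : forall i : 'I_m', exists c : 'I_m -> R, ae_eq_disk rad (b' i) (lin_comb c b).
  by move=> i; apply: gen.
pose A : 'M[R]_(m', m) := \matrix_(i, j) a i j.
rewrite leqNgt; apply/negP => mm'.
have : kermx A != 0.
  rewrite kermx_eq0 /row_free; apply: contraL mm' => /eqP <-.
  by rewrite -leqNgt rank_leq_col.
case/rowV0Pn => x /sub_kermxP xA /eqP; apply.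
apply/rowP => i; rewrite [RHS]mxE; apply: (free' (fun i => x ord0 i)) => {i}.
have := ae_eq_disk_sum (fun i => x ord0 i) ha; apply: filterS => p h pd.
rewrite (h pd) /lin_comb; under eq_bigr do rewrite scaler_sumr.
rewrite exchange_big/=; apply: big1 => j _.
under eq_bigr do rewrite scalerA; rewrite -scaler_suml.
have := congr1 (fun M : 'rV[R]_m => M ord0 j) xA; rewrite !mxE.
under eq_bigr do rewrite mxE; by move=> ->; rewrite scale0r.
Qed.

Lemma has_dimension_unique E m m' :
  has_dimension rad E m -> has_dimension rad E m' -> m = m'.
Proof. by move=> h h'; apply/eqP;
  rewrite eqn_leq !(has_dimension_le h' h, has_dimension_le h h'). Qed.

End Dimension.

(** * Multiplicities and the ordered list of eigenvalues *)

Section Spectrum.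
Variables (R : realType) (lam mu rad : R).
Hypotheses (hmu : 0 < mu) (hlammu : 0 < lam + mu) (rad0 : 0 < rad).
Local Notation val := (mode_value lam mu rad).
Local Notation eigenspace := (lame_eigenspace lam mu rad).

Definition modes_at (L : R) : set mode := [set m | admissible m /\ val m = L].

Lemma finite_modes (N : nat) :
  finite_set [set m | match m with ModeIV n _ | ModeV n _ => (n < N)%N | _ => True end].
Proof.
pose dec (p : nat * nat * bool) : mode :=
  match p.1.1 with
  | 0 => TranslationX | 1 => TranslationY | 2 => Rotation | 3 => Dilation
  | 4 => ModeIII p.2 | 5 => ModeIV p.1.2 p.2 | _ => ModeV p.1.2 p.2
  end%N.
have finb : finite_set [set: bool].
  apply: (@sub_finite_set _ _ [set` [:: true; false]]); last exact: finite_seq.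
  by case.
(* The range [N.+1] keeps the dummy index 0 available when [N = 0]. *)
have : finite_set (dec @` ((`I_7 `*` `I_N.+1) `*` [set: bool])).
  by apply: finite_image; apply: finite_setX => //; apply: finite_setX; exact: finite_II.
apply: sub_finite_set => -[| | | |b|n b|n b] h.
- by exists (0, 0, true)%N.
- by exists (1, 0, true)%N.
- by exists (2, 0, true)%N.
- by exists (3, 0, true)%N.
- by exists (4, 0, b)%N.
- by exists (5, n, b)%N => //; do 2 split => //=; exact: leqW.
- by exists (6, n, b)%N => //; do 2 split => //=; exact: leqW.
Qed.

(** The values in (iv) and (v) grow linearly with [n]; [a] and [b] are the resulting bounds for
    [n - 1] and [n + 1], which explains the [+ 1] in [N]. *)
Lemma finite_sublevel c : finite_set (admissible `&` [set m | val m <= c]).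
Proof.
have l3 : 0 < lam + 3 * mu by move: hmu hlammu; lra.
pose a := c * rad / (2 * mu).
pose b := c * ((lam + 3 * mu) * rad) / (2 * (mu * (lam + mu))).
pose N := (Num.truncn (Num.max a b + 1)).+1.
apply: sub_finite_set (finite_modes N) => -[| | | |b'|n b'|n b'] //= [_].
  rewrite ler_pdivrMr// => h; rewrite -(@ltr_nat R).
  apply: le_lt_trans (truncnS_gt _).
  have : n%:R - 1 <= a by rewrite /a ler_pdivlMr ?mulr_gt0// [leLHS]mulrC.
  have : a <= Num.max a b by rewrite le_max lexx.
  lra.
rewrite ler_pdivrMr ?mulr_gt0// => h; rewrite -(@ltr_nat R).
apply: le_lt_trans (truncnS_gt _).
have : n%:R + 1 <= b.
  rewrite /b ler_pdivlMr ?mulr_gt0//; apply: le_trans h.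
  by rewrite le_eqVlt; apply/orP; left; apply/eqP; ring.
have : b <= Num.max a b by rewrite le_max lexx orbT.
lra.
Qed.

Lemma infinite_admissible : infinite_set admissible.
Proof.
move=> fin; have : finite_set ((fun n => ModeIV n.+2 true) @^-1` admissible).
  by apply: finite_preimage => // i j _ _ [].
suff -> : (fun n => ModeIV n.+2 true) @^-1` admissible = setT by exact: infinite_nat.
by apply/seteqP; split.
Qed.

Lemma finite_modes_at L : finite_set (modes_at L).
Proof. by apply: sub_finite_set (finite_sublevel L) => m [am <-]; split => /=. Qed.

Lemma modes_at_enum L k : (modes_at L #= `I_k)%card -> exists M : 'I_k -> mode,
  [/\ injective M, forall i, admissible (M i) /\ val (M i) = L &
      forall m, admissible m -> val m = L -> exists i, M i = m].
Proof.
rewrite card_eq_sym => /card_set_bijP[f [fA finj fsurj]].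
exists (fun i => f i); split.
- by move=> i j e; apply: val_inj; apply: finj => //; rewrite inE /=.
- by move=> i; exact: (fA i (ltn_ord i)).
- move=> m am vm; have [i ik <-] := fsurj m (conj am vm).
  by exists (Ordinal ik).
Qed.

Lemma ae_eq_disk_refl (u : vfield R) : ae_eq_disk rad u u.
Proof. by apply: aeW. Qed.

Lemma mode_field_smooth m : admissible m -> smooth_field (mode_field lam mu rad m).
Proof.
by move=> am; rewrite (mode_fieldE rad hlammu am); exact: (smooth_cartesian_mode hmu hlammu rad0).
Qed.

Lemma smooth_measurable_field (u : vfield R) : smooth_field u -> measurable_field rad u.
Proof. by move=> su i; exact: (continuous_measurable_plane (smooth_continuous (su i))). Qed.

Lemma mode_in_eigenspace m : admissible m -> eigenspace (val m) (mode_field lam mu rad m).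
Proof.
move=> am; apply: (strong_eigen_lame rad0 (strong_mode hmu hlammu rad0 am)).
  exact: (smooth_measurable_field (mode_field_smooth am)).
by rewrite (mode_fieldE rad hlammu am); exact: ae_eq_disk_refl.
Qed.

Lemma mode_eigenfunction m : admissible m ->
  is_eigenfunction lam mu rad (val m) (mode_field lam mu rad m).
Proof.
move=> am; split; first exact: mode_in_eigenspace.
move=> m0; have h := @modes_free _ _ _ _ hmu hlammu rad0 (val m) 1 (fun=> m) (fun=> 1).
have /eqP : (1 : R) = 0.
  apply: (h _ _ _ ord0) => //; first by move=> i j _; rewrite (ord1 i) (ord1 j).
  rewrite (_ : lin_comb _ _ = mode_field lam mu rad m)//.
  by apply/funext => x; rewrite /lin_comb big_ord1 scale1r.
by rewrite oner_eq0.
Qed.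

Lemma eigenspace_dimension L k : (modes_at L #= `I_k)%card ->
  has_dimension rad (eigenspace L) k.
Proof.
move=> /modes_at_enum[M [injM hM surjM]].
exists (fun i => mode_field lam mu rad (M i)); split.
- by move=> i; have [am <-] := hM i; exact: mode_in_eigenspace.
- by move=> c; exact: (modes_free hmu hlammu rad0 injM hM).
- by move=> u; exact: (eigen_span hmu hlammu rad0 injM hM surjM).
Qed.

Lemma eigenvalueP L : is_eigenvalue lam mu rad L <-> exists m, modes_at L m.
Proof.
split=> [[u [uE u0]]|[m [am <-]]]; last by exists (mode_field lam mu rad m);
  exact: mode_eigenfunction.
apply: contrapT => noM; apply: u0.
(* [eigen_span] with an empty list of modes makes the eigenfunction zero almost everywhere. *)
have e0 : (modes_at L #= `I_0)%card.
  have -> : modes_at L = set0 by apply/seteqP; split => // m hm; apply: noM; exists m.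
  by rewrite II0.
have [M [injM hM surjM]] := modes_at_enum e0.
have [c hc] := eigen_span hmu hlammu rad0 injM hM surjM uE.
by apply: filterS hc => x h xd; rewrite (h xd) /lin_comb big_ord0.
Qed.

(** Uniqueness of the dimension turns multiplicities into numbers of modes. The right-hand side is
    the common normal form shared with [is_sorted_mode_listP]. *)
Lemma is_spectrumP (s : nat -> R) : is_spectrum lam mu rad s <->
  nondecreasing_seq s /\ forall L, ([set j | s j = L] #= modes_at L)%card.
Proof.
split=> [[ns _ hs]|[ns hs]].
  split=> // L; have [m dm cm] := hs L; have [k ck] := finite_modes_at L.
  rewrite (has_dimension_unique dm (eigenspace_dimension ck)) in cm.
  by apply: card_eq_trans cm _; rewrite card_eq_sym.
split=> // L.
  have /card_set_bijP[f [fA finj fsurj]] := hs L.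
  split=> [/eigenvalueP[m mL]|[j sj]].
    by have [j sj _] := fsurj m mL; exists j.
  by apply/eigenvalueP; exists (f j); exact: fA.
have [k ck] := finite_modes_at L; exists k; first exact: eigenspace_dimension.
exact: card_eq_trans (hs L) ck.
Qed.

Lemma is_sorted_mode_listP (s : nat -> R) : is_sorted_mode_list lam mu rad s <->
  nondecreasing_seq s /\ forall L, ([set j | s j = L] #= modes_at L)%card.
Proof.
split=> [[ns [sigma [[sA sinj ssurj] sE]]]|[ns hs]]; split=> //.
  move=> L; apply/card_set_bijP; exists sigma; split.
  - by move=> j /= <-; split; [exact: sA|rewrite sE].
  - by move=> i j _ _; apply: sinj; rewrite inE.
  - by move=> m [am vm]; have [j _ e] := ssurj m am; exists j; rewrite //= sE e.
(* The bijections of the single fibres are chosen simultaneously and glued along [s]; injectivity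
   survives because equal modes have equal values. *)
have /choice[f fP] : forall L, exists f : nat -> mode, set_bij [set j | s j = L] (modes_at L) f.
  by move=> L; apply/card_set_bijP; exact: hs.
have vf j : modes_at (s j) (f (s j) j) by have [fA _ _] := fP (s j); exact: fA.
exists (fun j => f (s j) j); split; last by move=> j; have [_ ->] := vf j.
split.
- by move=> j _; have [] := vf j.
- move=> i j _ _ e; have es : s i = s j by have [_ <-] := vf i; have [_ <-] := vf j; rewrite e.
  have [_ finj _] := fP (s i); apply: finj; rewrite ?inE/= ?es//.
  by rewrite es in e *.
- move=> m am; have [_ _ fsurj] := fP (val m); have [j sj fj] := fsurj m (conj am erefl).
  by exists j => //=; rewrite sj.
Qed.

Lemma exists_sorted_mode_list : exists s : nat -> R, is_sorted_mode_list lam mu rad s.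
Proof.
have [sigma [bij nd]] := sorted_enumeration finite_sublevel infinite_admissible.
by exists (val \o sigma); split => //; exists sigma.
Qed.

(** One inclusion is [eigen_span] for the finite list of modes at [L]. In the other, a combination
    of such modes is again a strong solution, and measurability of [u] allows it to be changed on a
    null set. *)
Lemma eigenspaceE L : eigenspace L =
  lin_span rad [set mode_field lam mu rad m | m in modes_at L].
Proof.
apply/seteqP; split => u.
  move=> uE; split.
    by have [G [T [hu _ _]]] := uE; move=> i; have [[]] := hu i.
  have [k ck] := finite_modes_at L; have [M [injM hM surjM]] := modes_at_enum ck.
  have [c hc] := eigen_span hmu hlammu rad0 injM hM surjM uE.
  exists k, c, (fun i => mode_field lam mu rad (M i)); split => // i.
  by exists (M i) => //; exact: hM.
move=> [mu' [k [c [f [hf e]]]]].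
have /choice[M hM] : forall i, exists m, modes_at L m /\ mode_field lam mu rad m = f i.
  by move=> i; have [m mL <-] := hf i; exists m.
have fE : f = fun i => mode_field lam mu rad (M i) by apply/funext => i; have [_ ->] := hM i.
have [lE sV] := lin_comb_modes hmu hlammu rad0 c (fun i => (hM i).1).
apply: (strong_eigen_lame rad0 sV mu').
by rewrite -lE -fE.
Qed.

End Spectrum.

Theorem theorem2p3 (R : realType) (lam mu rad : R)
    (hmu : 0 < mu) (hlammu : 0 < lam + mu) (hrad : 0 < rad) :
  [/\ exists s : nat -> R, is_spectrum lam mu rad s,
      forall s : nat -> R,
        is_spectrum lam mu rad s <-> is_sorted_mode_list lam mu rad s,
      forall m : mode, admissible m ->
        is_eigenfunction lam mu rad (mode_value lam mu rad m)
          (mode_field lam mu rad m)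
    & forall L : R,
        lame_eigenspace lam mu rad L =
        lin_span rad [set mode_field lam mu rad m | m in
                    [set m : mode | admissible m /\ mode_value lam mu rad m = L]]].
Proof.
have h s : is_spectrum lam mu rad s <-> is_sorted_mode_list lam mu rad s.
  by rewrite (is_spectrumP hmu hlammu hrad) is_sorted_mode_listP.
split=> //.
- by have [s ls] := exists_sorted_mode_list hmu hlammu hrad; exists s; apply/h.
- by move=> m; exact: mode_eigenfunction.
- by move=> L; exact: eigenspaceE.
Qed.
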